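(* The assignments $B \mapsto \int B$, $f \mapsto \int f$ (described in the context) define a functor $\int: \mathbf{BiCat} \to \mathbf{rMulBiCat}_\otimes$, restricting to a functor $\int: \mathbf{MonCat} \to \mathbf{rMulCat}_\otimes$, inverse up to natural isomorphism to the functor $G: \mathbf{rMulBiCat}_\otimes\to\mathbf{BiCat}$ (respectively, to its restriction $G: \mathbf{rMulCat}_\otimes\to\mathbf{MonCat}$).
   Context: Bicategories and functors. $\mathbf{BiCat}$ is the category of bicategories (with 1-cells $a: x \to y$, horizontal composite of $a:x\to y$ and $b:y\to z$ written $a\otimes b$, horizontal units $1_x$, vertical composition in diagrammatic order, associators $\alpha_{a,b,c}:(a\otimes b)\otimes c\to a\otimes(b\otimes c)$, unitors $\lambda_a:1_x\otimes a\to a$, $\rho_a:a\otimes 1_y\to a$) and functors, i.e. pseudofunctors with structural isomorphisms $f_{a,b}:f(a)\otimes f(b)\to f(a\otimes b)$, $f_x:1_{f(x)}\to f(1_x)$ satisfying the usual coherence axioms. $\mathbf{MonCat}$ is the full subcategory on bicategories with a single 0-cell. Regular multi-bicategories. A regular multi-bicategory $X$ consists of 0-cells, 1-cells $a:x\to y$, and 2-cells $p:(a_1,\ldots,a_n)\to(b)$, $n\ge1$, where $(a_i)$ is a non-empty composable sequence with the same overall source and target as $b$, together with operations $\mathrm{cut}_{1,i}$ sending $t:(\Gamma)\to(a)$ and $s:(\Gamma_1,a,\Gamma_2)\to(b)$, where $a$ is the $i$-th input of $s$, to $\mathrm{cut}_{1,i}(t,s):(\Gamma_1,\Gamma,\Gamma_2)\to(b)$,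 such that composing three 2-cells in two different orders gives the same result (associativity and interchange). No units are part of the structure. Greek capitals denote possibly empty composable sequences. A regular multicategory is a regular multi-bicategory with a single 0-cell. Morphisms preserve all boundaries and cuts. A 2-cell $t:(\Gamma)\to(a)$ is universal at $\partial_1^+$ if every 2-cell $(\Gamma_1,\Gamma,\Gamma_2)\to(b)$ is $\mathrm{cut}(t,r)$ for a unique $r:(\Gamma_1,a,\Gamma_2)\to(b)$; $t:(\Gamma_1,a,\Gamma_2)\to(b)$, with $a$ its $i$-th input, is universal at $\partial_i^-$ if every 2-cell $(\Gamma_1,\Gamma,\Gamma_2)\to(b)$ with $\Gamma$ non-empty is $\mathrm{cut}(r,t)$ for a unique $r:(\Gamma)\to(a)$. A unit on $a$ is a 2-cell $\mathrm{id}_a:(a)\to(a)$ such that every cut with it returns the other 2-cell; $X$ is unital if each 1-cell has a unit. A tensor of $a:x\to y$, $b:y\to z$ is a 2-cell $t_{a,b}:(a,b)\to(a\otimes b)$ universal at $\partial_1^+$. A tensor unit on $x$ is a 1-cell $1_x:x\to x$ such that for all $a:x\to y$ there is $l_a:(1_x,a)\to(a)$ universal at $\partial_1^+$ and $\partial_2^-$, and for all $b:z\to x$ there is $r_b:(b,1_x)\to(b)$ universal at $\partial_1^+$ and $\partial_1^-$. $X$ is tensor representable if it is unital, each 0-cell has a tensor unit, and each composable pair of 1-cells has a tensor. A 1-cell $e:x\to x'$ is tensor universal if: for each $a:x\to y$ there is a 2-cell $(e,u)\to(a)$, and for each $a':x'\to y$ a 2-cell $(e,a')\to(v)$, both universal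 at $\partial_1^+$ and $\partial_2^-$ (for some $u$, $v$); and for each $b':z\to x'$ there is a 2-cell $(u',e)\to(b')$, and for each $b:z\to x$ a 2-cell $(b,e)\to(v')$, both universal at $\partial_1^+$ and $\partial_1^-$ (for some $u'$, $v'$). A morphism is tensor strong if it maps units on 1-cells to units, tensor universal 1-cells to tensor universal 1-cells, and tensors to tensors. $\mathbf{rMulBiCat}_\otimes$ is the category of tensor representable regular multi-bicategories and tensor strong morphisms; $\mathbf{rMulCat}_\otimes$ is its full subcategory on regular multicategories. The functor $G$. For each tensor representable $X$, make a choice of tensors $t_{a,b}$, tensor units $1_x$, and witnesses $\{l_a,r_a\}$ that are coherent, i.e. $\mathrm{cut}_{1,2}(p,l_b)=\mathrm{cut}_{1,1}(l_a,p)$ for $p:(a,\Gamma)\to(b)$, $\mathrm{cut}_{1,1}(p',r_b)=\mathrm{cut}_{1,n}(r_a,p')$ for $p':(\Gamma',a)\to(b)$ with $n$ inputs, and $\mathrm{cut}_{1,j}(r_a,q)=\mathrm{cut}_{1,j+1}(l_b,q)$ for $q$ with $j$-th and $(j+1)$-st inputs $a,b$, with $l_{1_x}=r_{1_x}$ (such choices exist). Then $GX$ is the bicategory with the 0-cells and 1-cells of $X$, 2-cells the single-input 2-cells of $X$, vertical composition $\mathrm{cut}_{1,1}$ with units $\mathrm{id}_a$, horizontal composites $a\otimes b$ and units $1_x$ as chosen, and $p\otimes q$ (for $p:(a)\to(c)$, $q:(b)\to(d)$), $\alpha$, $\lambda$, $\rho$ the unique 2-cells with $\mathrm{cut}_{1,1}(t_{a,b},p\otimes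 q)=\mathrm{cut}_{1,2}(q,\mathrm{cut}_{1,1}(p,t_{c,d}))$, $\mathrm{cut}_{1,1}(\mathrm{cut}_{1,1}(t_{a,b},t_{a\otimes b,c}),\alpha_{a,b,c})=\mathrm{cut}_{1,2}(t_{b,c},t_{a,b\otimes c})$, $\mathrm{cut}_{1,1}(t_{1_x,a},\lambda_a)=l_a$, $\mathrm{cut}_{1,1}(t_{a,1_y},\rho_a)=r_a$. For a tensor strong $f:X\to Y$, $Gf$ is the restriction of $f$ with $f_{a,b}$ the unique 2-cell with $\mathrm{cut}_{1,1}(t_{f(a),f(b)},f_{a,b})=f(t_{a,b})$ and $f_x:(1_{f(x)})\to(f(1_x))$ the unique 2-cell with $\mathrm{cut}_{1,1}(f_x,f(l_{1_x}))=l_{f(1_x)}$. The functor $\int$. For a bicategory $B$, $\int B$ has the same 0-cells and 1-cells as $B$; 2-cells $(a_1,\ldots,a_n)\to(b)$ of $\int B$ are the 2-cells $(\ldots(a_1\otimes a_2)\ldots\otimes a_{n-1})\otimes a_n\to b$ of $B$; composition is induced by that of $B$, using the unique coherence 2-cells built from associators, their inverses and vertical units to re-bracket as needed. For a functor $f:B\to C$, $\int f$ equals $f$ on 0-cells and 1-cells and sends the 2-cell corresponding to $p:(\ldots(a_1\otimes a_2)\ldots)\otimes a_n\to b$ to the 2-cell obtained by precomposing $f(p)$ with the unique coherence 2-cell $(\ldots(f(a_1)\otimes f(a_2))\ldots)\otimes f(a_n)\to f((\ldots(a_1\otimes a_2)\ldots)\otimes a_n)$ built from the $f_{a,b}$,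 associators, and vertical units. *)

(* Defs.v *)
(* Every composition (of morphisms, of functors, of 1-cells and 2-cells) is
   written in diagrammatic order. *)
From Stdlib Require Import ProofIrrelevance FunctionalExtensionality
  IndefiniteDescription Eqdep.

Set Implicit Arguments.
Unset Strict Implicit.
Unset Printing Implicit Defensive.

Definition the {A : Type} {P : A -> Prop} (h : exists! x, P x) : A :=
  proj1_sig (constructive_definite_description P h).

Lemma the_spec {A : Type} {P : A -> Prop} (h : exists! x, P x) : P (the h).
Proof. exact (proj2_sig (constructive_definite_description P h)). Qed.

Definition single (T : Type) : Prop := exists x : T, forall y, y = x.

Record category := Category {
  obj : Type;
  hom : obj -> obj -> Type;
  cid : forall x, hom x x;
  ccomp : forall x y z, hom x y -> hom y z -> hom x z;
  ccomp_id_l : forall x y (f : hom x y), ccomp (cid x) f = f;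
  ccomp_id_r : forall x y (f : hom x y), ccomp f (cid y) = f;
  ccomp_assoc : forall x y z t (f : hom x y) (g : hom y z) (h : hom z t),
    ccomp (ccomp f g) h = ccomp f (ccomp g h) }.
Arguments cid {c} x.
Arguments ccomp {c x y z} f g.

Record functor (C D : category) := Functor {
  fobj :> obj C -> obj D;
  fhom : forall x y, hom x y -> hom (fobj x) (fobj y);
  fhom_id : forall x, fhom (cid x) = cid (fobj x);
  fhom_comp : forall x y z (f : hom x y) (g : hom y z),
    fhom (ccomp f g) = ccomp (fhom f) (fhom g) }.
Arguments fhom {C D} _ {x y} _ : rename.

Definition functor_id (C : category) : functor C C :=
  Functor (fobj := fun x : obj C => x) (fhom := fun _ _ f => f)
    (fun _ => eq_refl) (fun _ _ _ _ _ => eq_refl).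

Lemma functor_comp_id C D E (F : functor C D) (H : functor D E) x :
  fhom H (fhom F (cid x)) = cid (H (F x)).
Proof. rewrite fhom_id; apply fhom_id. Qed.

Lemma functor_comp_comp C D E (F : functor C D) (H : functor D E) x y z
    (f : hom x y) (g : hom y z) :
  fhom H (fhom F (ccomp f g)) = ccomp (fhom H (fhom F f)) (fhom H (fhom F g)).
Proof. rewrite fhom_comp; apply fhom_comp. Qed.

Definition functor_comp C D E (F : functor C D) (H : functor D E) :
    functor C E :=
  Functor (fobj := fun x => H (F x)) (fhom := fun _ _ f => fhom H (fhom F f))
    (functor_comp_id F H) (fun _ _ _ f g => functor_comp_comp F H f g).

Definition is_iso {C : category} {x y : obj C} (f : hom x y) : Prop :=
  exists g : hom y x, ccomp f g = cid x /\ ccomp g f = cid y.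

Definition naturally_isomorphic C D (F F' : functor C D) : Prop :=
  exists eta : forall x, hom (F x) (F' x),
    (forall x, is_iso (eta x)) /\
    (forall x y (f : hom x y),
       ccomp (fhom F f) (eta y) = ccomp (eta x) (fhom F' f)).

Definition inverse_up_to_iso C D (F : functor C D) (H : functor D C) : Prop :=
  naturally_isomorphic (functor_comp F H) (functor_id C) /\
  naturally_isomorphic (functor_comp H F) (functor_id D).

Definition full_subcategory (C : category) (P : obj C -> Prop) : category :=
  Category (obj := {x : obj C | P x})
    (hom := fun x y => hom (proj1_sig x) (proj1_sig y))
    (cid := fun x => cid (proj1_sig x)) (ccomp := fun _ _ _ f g => ccomp f g)
    (fun _ _ f => ccomp_id_l f) (fun _ _ f => ccomp_id_r f)
    (fun _ _ _ _ f g h => ccomp_assoc f g h).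

Definition restrict C D (P : obj C -> Prop) (Q : obj D -> Prop)
    (F : functor C D) (PQ : forall x, P x -> Q (F x)) :
    functor (full_subcategory P) (full_subcategory Q) :=
  Functor (C := full_subcategory P) (D := full_subcategory Q)
    (fobj := fun x => exist Q (F (proj1_sig x)) (PQ _ (proj2_sig x)))
    (fhom := fun _ _ f => fhom F f)
    (fun x => fhom_id F (proj1_sig x)) (fun _ _ _ f g => fhom_comp F f g).
Arguments restrict {C D P Q} F PQ.

Inductive path {ob : Type} (one : ob -> ob -> Type) : ob -> ob -> Type :=
| nil x : path one x x
| cons x y z (a : one x y) (G : path one y z) : path one x z.
Arguments nil {ob one x}.
Arguments cons {ob one x y z} a G.

Declare Scope path_scope.
Delimit Scope path_scope with path.
Bind Scope path_scope with path.
Notation "a :: G" := (cons a G) : path_scope.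
Notation "[ a ]" := (cons a nil) : path_scope.
Notation "[ a ; b ]" := (cons a (cons b nil)) : path_scope.
Notation "[ a ; b ; c ]" := (cons a (cons b (cons c nil))) : path_scope.
Local Open Scope path_scope.

Fixpoint app {ob} {one : ob -> ob -> Type} {x y z} (G : path one x y) :
    path one y z -> path one x z :=
  match G in path _ x y return path one y z -> path one x z with
  | nil => fun H => H
  | a :: G => fun H => a :: app G H
  end.
Notation "G ++ H" := (app G H) : path_scope.

Definition nonempty {ob} {one : ob -> ob -> Type} {x y} (G : path one x y) :=
  match G with nil => False | _ :: _ => True end.

Fixpoint pmap {ob ob'} {one : ob -> ob -> Type} {one' : ob' -> ob' -> Type}
    (f0 : ob -> ob') (f1 : forall x y, one x y -> one' (f0 x) (f0 y)) {x y}
    (G : path one x y) : path one' (f0 x) (f0 y) :=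
  match G in path _ x y return path one' (f0 x) (f0 y) with
  | nil => nil
  | a :: G => f1 _ _ a :: pmap f1 G
  end.

Section PathLemmas.
Context {ob : Type} {one : ob -> ob -> Type}.
Local Notation path := (path one).

Lemma app_nil_r {x y} (G : path x y) : G ++ nil = G.
Proof. induction G as [|? ? ? a G IH]; simpl; congruence. Qed.

Lemma app_assoc {x y z t} (G : path x y) (H : path y z) (K : path z t) :
  (G ++ H) ++ K = G ++ (H ++ K).
Proof.
induction G as [|? ? ? a G IH]; simpl; [reflexivity|]; now rewrite IH.
Qed.

Lemma app_par {x y z t u} (G : path x y) (E : path y z) (H : path z t)
    (K : path t u) :
  G ++ (E ++ (H ++ K)) = (G ++ (E ++ H)) ++ K.
Proof. now rewrite !app_assoc. Qed.

Lemma app_nest {x y z t u v} (G : path x y) (D : path y z) (E : path z t)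
    (D' : path t u) (G' : path u v) :
  G ++ ((D ++ (E ++ D')) ++ G') = (G ++ D) ++ (E ++ (D' ++ G')).
Proof. now rewrite !app_assoc. Qed.

Lemma pmap_app {ob'} {one' : ob' -> ob' -> Type} {f0 : ob -> ob'}
    (f1 : forall x y, one x y -> one' (f0 x) (f0 y)) {x y z}
    (G : path x y) (H : path y z) :
  pmap f1 (G ++ H) = pmap f1 G ++ pmap f1 H.
Proof.
induction G as [|? ? ? a G IH]; simpl; [reflexivity|]; now rewrite IH.
Qed.

Lemma pmap_app3 {ob'} {one' : ob' -> ob' -> Type} {f0 : ob -> ob'}
    (f1 : forall x y, one x y -> one' (f0 x) (f0 y)) {x y z t}
    (G : path x y) (E : path y z) (H : path z t) :
  pmap f1 (G ++ (E ++ H)) = pmap f1 G ++ (pmap f1 E ++ pmap f1 H).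
Proof. now rewrite !pmap_app. Qed.

Lemma pmap_id {x y} (G : path x y) :
  G = pmap (f0 := fun x => x) (fun _ _ a => a) G.
Proof.
induction G as [|? ? ? a G IH]; simpl; [reflexivity|]; now rewrite <- IH.
Qed.

Lemma pmap_comp {ob' ob''} {one' : ob' -> ob' -> Type}
    {one'' : ob'' -> ob'' -> Type} {f0 : ob -> ob'} {g0 : ob' -> ob''}
    (f1 : forall x y, one x y -> one' (f0 x) (f0 y))
    (g1 : forall x y, one' x y -> one'' (g0 x) (g0 y)) {x y} (G : path x y) :
  pmap g1 (pmap f1 G)
  = pmap (f0 := fun x => g0 (f0 x)) (fun _ _ a => g1 _ _ (f1 _ _ a)) G.
Proof.
induction G as [|? ? ? a G IH]; simpl; [reflexivity|]; now rewrite IH.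
Qed.
End PathLemmas.

(* For every structure the data are kept apart from the axioms, so that a
   construction can be given on data and its axioms stated afterwards. *)

Record bicat_data := BicatData {
  ob : Type;
  one : ob -> ob -> Type;
  two : forall x y, one x y -> one x y -> Type;
  id2 : forall x y (a : one x y), two a a;
  vcomp : forall x y (a b c : one x y), two a b -> two b c -> two a c;
  unit1 : forall x, one x x;
  tens : forall x y z, one x y -> one y z -> one x z;
  tens2 : forall x y z (a c : one x y) (b d : one y z),
    two a c -> two b d -> two (tens a b) (tens c d);
  assoc : forall x y z t (a : one x y) (b : one y z) (c : one z t),
    two (tens (tens a b) c) (tens a (tens b c));
  lunit : forall x y (a : one x y), two (tens (unit1 x) a) a;
  runit : forall x y (a : one x y), two (tens a (unit1 y)) a }.
Arguments one b x y : rename, clear implicits.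
Arguments two {b x y} _ _ : rename.
Arguments id2 {b x y} a : rename.
Arguments vcomp {b x y a b0 c} _ _ : rename.
Arguments unit1 {b} x : rename.
Arguments tens {b x y z} _ _ : rename.
Arguments tens2 {b x y z a c b0 d} _ _ : rename.
Arguments assoc {b x y z t} _ _ _ : rename.
Arguments lunit {b x y} _ : rename.
Arguments runit {b x y} _ : rename.

Declare Scope bicat_scope.
Delimit Scope bicat_scope with bicat.
Notation "a ⊗ b" := (tens a b) (at level 40, left associativity) : bicat_scope.
Notation "p ⊗₂ q" := (tens2 p q) (at level 40, left associativity)
  : bicat_scope.
Notation "p ⋅ q" := (vcomp p q) (at level 45, left associativity)
  : bicat_scope.
Local Open Scope bicat_scope.

Definition invertible {B : bicat_data} {x y} {a b : one B x y} (p : two a b) :=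
  exists q : two b a, p ⋅ q = id2 a /\ q ⋅ p = id2 b.

Record is_bicategory (B : bicat_data) : Prop := IsBicategory {
  vcomp_id_l : forall x y (a b : one B x y) (p : two a b), id2 a ⋅ p = p;
  vcomp_id_r : forall x y (a b : one B x y) (p : two a b), p ⋅ id2 b = p;
  vcomp_assoc : forall x y (a b c d : one B x y)
      (p : two a b) (q : two b c) (r : two c d),
    p ⋅ q ⋅ r = p ⋅ (q ⋅ r);
  tens2_id : forall x y z (a : one B x y) (b : one B y z),
    id2 a ⊗₂ id2 b = id2 (a ⊗ b);
  tens2_vcomp : forall x y z (a a' a'' : one B x y) (b b' b'' : one B y z)
      (p : two a a') (p' : two a' a'') (q : two b b') (q' : two b' b''),
    (p ⋅ p') ⊗₂ (q ⋅ q') = (p ⊗₂ q) ⋅ (p' ⊗₂ q');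
  assoc_nat : forall x y z t (a a' : one B x y) (b b' : one B y z)
      (c c' : one B z t) (p : two a a') (q : two b b') (r : two c c'),
    ((p ⊗₂ q) ⊗₂ r) ⋅ assoc a' b' c' = assoc a b c ⋅ (p ⊗₂ (q ⊗₂ r));
  lunit_nat : forall x y (a a' : one B x y) (p : two a a'),
    (id2 (unit1 x) ⊗₂ p) ⋅ lunit a' = lunit a ⋅ p;
  runit_nat : forall x y (a a' : one B x y) (p : two a a'),
    (p ⊗₂ id2 (unit1 y)) ⋅ runit a' = runit a ⋅ p;
  assoc_inv : forall x y z t (a : one B x y) (b : one B y z) (c : one B z t),
    invertible (assoc a b c);
  lunit_inv : forall x y (a : one B x y), invertible (lunit a);
  runit_inv : forall x y (a : one B x y), invertible (runit a);
  pentagon : forall x y z t u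
      (a : one B x y) (b : one B y z) (c : one B z t) (d : one B t u),
    (assoc a b c ⊗₂ id2 d) ⋅ assoc a (b ⊗ c) d ⋅ (id2 a ⊗₂ assoc b c d)
    = assoc (a ⊗ b) c d ⋅ assoc a b (c ⊗ d);
  triangle : forall x y z (a : one B x y) (b : one B y z),
    assoc a (unit1 y) b ⋅ (id2 a ⊗₂ lunit b) = runit a ⊗₂ id2 b }.

Record bicategory := Bicategory {
  bdata :> bicat_data;
  bicat_ax : is_bicategory bdata }.

Record pf_data (B C : bicat_data) := PfData {
  pf0 : ob B -> ob C;
  pf1 : forall x y, one B x y -> one C (pf0 x) (pf0 y);
  pf2 : forall x y (a b : one B x y), two a b -> two (pf1 a) (pf1 b);
  pf_tens : forall x y z (a : one B x y) (b : one B y z),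
    two (pf1 a ⊗ pf1 b) (pf1 (a ⊗ b));
  pf_unit : forall x, two (unit1 (pf0 x)) (pf1 (unit1 x)) }.
Arguments pf0 {B C} p x : rename.
Arguments pf1 {B C} p {x y} a : rename.
Arguments pf2 {B C} p {x y a b} _ : rename.
Arguments pf_tens {B C} p {x y z} a b : rename.
Arguments pf_unit {B C} p x : rename.

Record is_pseudofunctor (B C : bicat_data) (f : pf_data B C) : Prop :=
    IsPseudofunctor {
  pf2_id : forall x y (a : one B x y), pf2 f (id2 a) = id2 (pf1 f a);
  pf2_vcomp : forall x y (a b c : one B x y) (p : two a b) (q : two b c),
    pf2 f (p ⋅ q) = pf2 f p ⋅ pf2 f q;
  pf_tens_nat : forall x y z (a c : one B x y) (b d : one B y z)
      (p : two a c) (q : two b d),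
    (pf2 f p ⊗₂ pf2 f q) ⋅ pf_tens f c d = pf_tens f a b ⋅ pf2 f (p ⊗₂ q);
  pf_tens_inv : forall x y z (a : one B x y) (b : one B y z),
    invertible (pf_tens f a b);
  pf_unit_inv : forall x, invertible (pf_unit f x);
  pf_assoc : forall x y z t (a : one B x y) (b : one B y z) (c : one B z t),
    (pf_tens f a b ⊗₂ id2 (pf1 f c)) ⋅ pf_tens f (a ⊗ b) c
      ⋅ pf2 f (assoc a b c)
    = assoc (pf1 f a) (pf1 f b) (pf1 f c)
      ⋅ (id2 (pf1 f a) ⊗₂ pf_tens f b c) ⋅ pf_tens f a (b ⊗ c);
  pf_lunit : forall x y (a : one B x y),
    (pf_unit f x ⊗₂ id2 (pf1 f a)) ⋅ pf_tens f (unit1 x) a ⋅ pf2 f (lunit a)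
    = lunit (pf1 f a);
  pf_runit : forall x y (a : one B x y),
    (id2 (pf1 f a) ⊗₂ pf_unit f y) ⋅ pf_tens f a (unit1 y) ⋅ pf2 f (runit a)
    = runit (pf1 f a) }.

Record pseudofunctor (B C : bicat_data) := Pseudofunctor {
  pfdata :> pf_data B C;
  pf_ax : is_pseudofunctor pfdata }.

Definition pf_id_data (B : bicat_data) : pf_data B B :=
  PfData (pf0 := fun x => x) (pf1 := fun _ _ a => a) (fun _ _ _ _ p => p)
    (fun _ _ _ a b => id2 (a ⊗ b)) (fun x => id2 (unit1 x)).

Definition pf_comp_data (B C D : bicat_data) (f : pf_data B C)
    (g : pf_data C D) : pf_data B D :=
  PfData (pf0 := fun x => pf0 g (pf0 f x)) (pf1 := fun _ _ a => pf1 g (pf1 f a))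
    (fun _ _ _ _ p => pf2 g (pf2 f p))
    (fun _ _ _ a b => pf_tens g (pf1 f a) (pf1 f b) ⋅ pf2 g (pf_tens f a b))
    (fun x => pf_unit g (pf0 f x) ⋅ pf2 g (pf_unit f x)).

Lemma pf_id_ax (B : bicategory) : is_pseudofunctor (pf_id_data B).
Proof.
destruct B as [B H]; simpl.
assert (I : forall x y (a : one B x y), invertible (id2 a)).
{ intros x y a; exists (id2 a); split; apply (vcomp_id_l H). }
constructor; simpl; intros; auto;
  rewrite ?(tens2_id H), ?(vcomp_id_l H), ?(vcomp_id_r H); auto.
Qed.

Section PfComp.
Context {B C D : bicat_data} (HC : is_bicategory C) (HD : is_bicategory D).
Context {f : pf_data B C} {g : pf_data C D}.
Context (Hf : is_pseudofunctor f) (Hg : is_pseudofunctor g).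

Lemma invertible_vcomp (E : bicat_data) (HE : is_bicategory E) x y
    (a b c : one E x y) (p : two a b) (q : two b c) :
  invertible p -> invertible q -> invertible (p ⋅ q).
Proof.
intros [p' [H1 H2]] [q' [H3 H4]]; exists (q' ⋅ p'); split.
- rewrite (vcomp_assoc HE), <- (vcomp_assoc HE q), H3, (vcomp_id_l HE); auto.
- rewrite (vcomp_assoc HE), <- (vcomp_assoc HE p'), H2, (vcomp_id_l HE); auto.
Qed.

Lemma invertible_pf2 x y (a b : one C x y) (p : two a b) :
  invertible p -> invertible (pf2 g p).
Proof.
intros [q [H1 H2]]; exists (pf2 g q).
now rewrite <- !(pf2_vcomp Hg), H1, H2, !(pf2_id Hg).
Qed.

Lemma tens2_id_vcomp (E : bicat_data) (HE : is_bicategory E) x y z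
    (a : one E x y) (b c d : one E y z) (p : two b c) (q : two c d) :
  id2 a ⊗₂ (p ⋅ q) = (id2 a ⊗₂ p) ⋅ (id2 a ⊗₂ q).
Proof. rewrite <- (tens2_vcomp HE); now rewrite (vcomp_id_l HE). Qed.

Lemma tens2_vcomp_id (E : bicat_data) (HE : is_bicategory E) x y z
    (a : one E y z) (b c d : one E x y) (p : two b c) (q : two c d) :
  (p ⋅ q) ⊗₂ id2 a = (p ⊗₂ id2 a) ⋅ (q ⊗₂ id2 a).
Proof. rewrite <- (tens2_vcomp HE); now rewrite (vcomp_id_l HE). Qed.

Lemma pf_tens_nat_l x y z (a c : one C x y) (b : one C y z) (p : two a c) :
  (pf2 g p ⊗₂ id2 (pf1 g b)) ⋅ pf_tens g c b
  = pf_tens g a b ⋅ pf2 g (p ⊗₂ id2 b).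
Proof. rewrite <- (pf_tens_nat Hg); now rewrite (pf2_id Hg). Qed.

Lemma pf_tens_nat_r x y z (a : one C x y) (b d : one C y z) (p : two b d) :
  (id2 (pf1 g a) ⊗₂ pf2 g p) ⋅ pf_tens g a d
  = pf_tens g a b ⋅ pf2 g (id2 a ⊗₂ p).
Proof. rewrite <- (pf_tens_nat Hg); now rewrite (pf2_id Hg). Qed.

Lemma pf_comp_ax : is_pseudofunctor (pf_comp_data f g).
Proof.
constructor; simpl.
- intros; now rewrite (pf2_id Hf), (pf2_id Hg).
- intros; now rewrite (pf2_vcomp Hf), (pf2_vcomp Hg).
- intros; rewrite <- (vcomp_assoc HD), (pf_tens_nat Hg), !(vcomp_assoc HD).
  now rewrite <- !(pf2_vcomp Hg), (pf_tens_nat Hf).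
- intros; apply (invertible_vcomp HD); [apply (pf_tens_inv Hg)|].
  apply invertible_pf2, (pf_tens_inv Hf).
- intros; apply (invertible_vcomp HD); [apply (pf_unit_inv Hg)|].
  apply invertible_pf2, (pf_unit_inv Hf).
- intros x y z t a b c.
  rewrite (tens2_vcomp_id HD), (tens2_id_vcomp HD), !(vcomp_assoc HD).
  rewrite <- (vcomp_assoc HD (pf2 g _ ⊗₂ _)), pf_tens_nat_l.
  rewrite <- (vcomp_assoc HD (id2 _ ⊗₂ pf2 g _)), pf_tens_nat_r.
  rewrite !(vcomp_assoc HD), <- !(pf2_vcomp Hg).
  rewrite <- !(vcomp_assoc HC), (pf_assoc Hf), !(vcomp_assoc HC).
  rewrite (pf2_vcomp Hg), <- !(vcomp_assoc HD).
  now rewrite (pf_assoc Hg).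
- intros x y a.
  rewrite (tens2_vcomp_id HD), !(vcomp_assoc HD).
  rewrite <- (vcomp_assoc HD (pf2 g _ ⊗₂ _)), pf_tens_nat_l.
  rewrite !(vcomp_assoc HD), <- !(pf2_vcomp Hg).
  rewrite <- !(vcomp_assoc HC), (pf_lunit Hf), <- !(vcomp_assoc HD).
  now rewrite (pf_lunit Hg).
- intros x y a.
  rewrite (tens2_id_vcomp HD), !(vcomp_assoc HD).
  rewrite <- (vcomp_assoc HD (id2 _ ⊗₂ pf2 g _)), pf_tens_nat_r.
  rewrite !(vcomp_assoc HD), <- !(pf2_vcomp Hg).
  rewrite <- !(vcomp_assoc HC), (pf_runit Hf), <- !(vcomp_assoc HD).
  now rewrite (pf_runit Hg).
Qed.
End PfComp.

Definition pf_id (B : bicategory) : pseudofunctor B B :=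
  Pseudofunctor (pf_id_ax B).

Definition pf_comp (B C D : bicategory) (f : pseudofunctor B C)
    (g : pseudofunctor C D) : pseudofunctor B D :=
  Pseudofunctor (pf_comp_ax (bicat_ax C) (bicat_ax D) (pf_ax f) (pf_ax g)).

Lemma pseudofunctor_eq (B C : bicat_data) (f g : pseudofunctor B C) :
  pfdata f = pfdata g -> f = g.
Proof.
destruct f as [f Hf], g as [g Hg]; simpl; intros <-; f_equal.
apply proof_irrelevance.
Qed.

Lemma pf_data_eq (B C : bicat_data) f0 f1 f2 t t' u u' :
  (forall x y z (a : one B x y) (b : one B y z), t x y z a b = t' x y z a b) ->
  (forall x, u x = u' x) ->
  @PfData B C f0 f1 f2 t u = PfData f2 t' u'.
Proof.
intros Ht Hu; f_equal; [|extensionality x; apply Hu].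
extensionality x; extensionality y; extensionality z.
extensionality a; extensionality b; apply Ht.
Qed.

Lemma pf_comp_id_l (B C : bicategory) (f : pseudofunctor B C) :
  pf_comp (pf_id B) f = f.
Proof.
apply pseudofunctor_eq; destruct f as [[f0 f1 f2 t u] Hf].
apply pf_data_eq; simpl; intros;
  rewrite (pf2_id Hf); apply (vcomp_id_r (bicat_ax C)).
Qed.

Lemma pf_comp_id_r (B C : bicategory) (f : pseudofunctor B C) :
  pf_comp f (pf_id C) = f.
Proof.
apply pseudofunctor_eq; destruct f as [[f0 f1 f2 t u] Hf].
apply pf_data_eq; simpl; intros; apply (vcomp_id_l (bicat_ax C)).
Qed.

Lemma pf_comp_assoc (B C D E : bicategory) (f : pseudofunctor B C)
    (g : pseudofunctor C D) (h : pseudofunctor D E) :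
  pf_comp (pf_comp f g) h = pf_comp f (pf_comp g h).
Proof.
apply pseudofunctor_eq; apply pf_data_eq; simpl; intros;
  rewrite (pf2_vcomp (pf_ax h)); symmetry; apply (vcomp_assoc (bicat_ax E)).
Qed.

Definition BiCat : category :=
  Category (obj := bicategory) (hom := fun B C => pseudofunctor B C)
    (cid := pf_id) (ccomp := pf_comp)
    pf_comp_id_l pf_comp_id_r pf_comp_assoc.

Definition single_0cell_bicat (B : obj BiCat) : Prop :=
  single (ob (B : bicategory)).

Definition MonCat : category := full_subcategory single_0cell_bicat.

(* [mtwo G b] is the type of 2-cells [(G) -> (b)].  The index [G] ranges over
   all sequences; the axiom [mregular] leaves no 2-cell with an empty input. *)

Record mb_data := MbData {
  mob : Type;
  mone : mob -> mob -> Type;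
  mtwo : forall x y, path mone x y -> mone x y -> Type;
  cut : forall x y z w (G1 : path mone x y) (G : path mone y z) (a : mone y z)
      (G2 : path mone z w) (b : mone x w),
    mtwo G a -> mtwo (G1 ++ a :: G2) b -> mtwo (G1 ++ (G ++ G2)) b }.
Arguments mone {m} x y : rename.
Arguments mtwo {m x y} G b : rename.
Arguments cut {m x y z w} G1 {G a} G2 {b} t s : rename.

Notation mpath X := (path (@mone X)).

Definition mcast {X : mb_data} {x y} {P Q : mpath X x y} {b : mone x y}
    (e : P = Q) (p : mtwo P b) : mtwo Q b :=
  eq_rect P (fun R => mtwo R b) p Q e.

Record is_regular_mb (X : mb_data) : Prop := IsRegularMb {
  mregular : forall x y (G : mpath X x y) (b : mone x y),
    mtwo G b -> nonempty G;
  cut_assoc : forall x y z t u v (G1 : mpath X x y) (D1 : mpath X y z)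
      (D : mpath X z t) (c : mone z t) (D2 : mpath X t u) (a : mone y u)
      (G2 : mpath X u v) (b : mone x v)
      (r : mtwo D c) (t : mtwo (D1 ++ c :: D2) a)
      (s : mtwo (G1 ++ a :: G2) b),
    cut (G1 ++ D1) (D2 ++ G2) r
      (mcast (app_nest G1 D1 [c] D2 G2) (cut G1 G2 t s))
    = mcast (app_nest G1 D1 D D2 G2) (cut G1 G2 (cut D1 D2 r t) s);
  cut_interchange : forall x y z t u v (G1 : mpath X x y)
      (G : mpath X y z) (a : mone y z) (G2 : mpath X z t)
      (D : mpath X t u) (c : mone t u) (G3 : mpath X u v) (b : mone x v)
      (p : mtwo G a) (q : mtwo D c) (s : mtwo (G1 ++ a :: (G2 ++ c :: G3)) b),
    cut (G1 ++ (G ++ G2)) G3 q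
      (mcast (app_par G1 G G2 (c :: G3)) (cut G1 (G2 ++ c :: G3) p s))
    = mcast (app_par G1 G G2 (D ++ G3))
        (cut G1 (G2 ++ (D ++ G3)) p
          (mcast (eq_sym (app_par G1 [a] G2 (D ++ G3)))
            (cut (G1 ++ a :: G2) G3 q
              (mcast (app_par G1 [a] G2 (c :: G3)) s)))) }.

Section Universality.
Context {X : mb_data}.

(* Universal at the output, and at the input [a] standing between [G1] and
   [G2].  In [univ_in] the case of an empty [G] has to be excluded: [G1] and
   [G2] may be non-empty. *)
Definition univ_out {x y} {G : mpath X x y} {a : mone x y} (t : mtwo G a) :=
  forall x' y' (G1 : mpath X x' x) (G2 : mpath X y y') (b : mone x' y')
    (s : mtwo (G1 ++ (G ++ G2)) b),
  exists! r : mtwo (G1 ++ a :: G2) b, cut G1 G2 t r = s.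

Definition univ_in {x y z w} (G1 : mpath X x y) (a : mone y z)
    (G2 : mpath X z w) {b : mone x w} (t : mtwo (G1 ++ a :: G2) b) :=
  forall (G : mpath X y z), nonempty G ->
  forall s : mtwo (G1 ++ (G ++ G2)) b,
  exists! r : mtwo G a, cut G1 G2 r t = s.
Arguments univ_in {x y z w} G1 a G2 {b} t.

Definition is_unit {x y} {a : mone x y} (i : @mtwo X x y [a] a) : Prop :=
  (forall (G : mpath X x y) (t : mtwo G a),
     cut nil nil t i = mcast (eq_sym (app_nil_r G)) t) /\
  (forall x' y' (G1 : mpath X x' x) (G2 : mpath X y y') (b : mone x' y')
     (s : mtwo (G1 ++ a :: G2) b), cut G1 G2 i s = s).

Definition is_tensor {x y z} {a : mone x y} {b : mone y z} {c : mone x z}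
    (t : @mtwo X x z [a; b] c) : Prop := univ_out t.

Definition lunit_witness {x y} (e : mone x x) (a : mone x y)
    (l : @mtwo X x y [e; a] a) : Prop := univ_out l /\ univ_in [e] a nil l.

Definition runit_witness {x z} (e : mone x x) (b : mone z x)
    (r : @mtwo X z x [b; e] b) : Prop := univ_out r /\ univ_in nil b [e] r.

Definition is_tensor_unit {x} (e : @mone X x x) : Prop :=
  (forall y (a : mone x y), exists l, @lunit_witness x y e a l) /\
  (forall z (b : mone z x), exists r, @runit_witness x z e b r).

Definition tensor_universal {x x'} (e : @mone X x x') : Prop :=
  (forall y (a : mone x y), exists (u : mone x' y) (t : mtwo [e; u] a),
     univ_out t /\ univ_in [e] u nil t) /\
  (forall y (a' : mone x' y), exists (v : mone x y) (t : mtwo [e; a'] v),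
     univ_out t /\ univ_in [e] a' nil t) /\
  (forall z (b' : mone z x'), exists (u' : mone z x) (t : mtwo [u'; e] b'),
     univ_out t /\ univ_in nil u' [e] t) /\
  (forall z (b : mone z x), exists (v' : mone z x') (t : mtwo [b; e] v'),
     univ_out t /\ univ_in nil b [e] t).
End Universality.
Arguments univ_in {X x y z w} G1 a G2 {b} t.

Record tensor_representable (X : mb_data) : Prop := TensorRepresentable {
  unital : forall x y (a : mone x y), exists i : mtwo [a] a, @is_unit X x y a i;
  has_tensor_unit : forall x, exists e, @is_tensor_unit X x e;
  has_tensor : forall x y z (a : mone x y) (b : mone y z),
    exists (c : mone x z) (t : mtwo [a; b] c), @is_tensor X x y z a b c t }.

Record rep_mb := RepMb {
  mdata :> mb_data;
  rep_mb_regular : is_regular_mb mdata;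
  rep_mb_rep : tensor_representable mdata }.

Record mm_data (X Y : mb_data) := MmData {
  mm0 : mob X -> mob Y;
  mm1 : forall x y, @mone X x y -> @mone Y (mm0 x) (mm0 y);
  mm2 : forall x y (G : mpath X x y) (b : mone x y),
    mtwo G b -> mtwo (pmap mm1 G) (mm1 b) }.
Arguments mm0 {X Y} m x : rename.
Arguments mm1 {X Y} m x y a : rename.
Arguments mm2 {X Y} m {x y G b} p : rename.

Definition is_morphism {X Y : mb_data} (f : mm_data X Y) : Prop :=
  forall x y z w (G1 : mpath X x y) (G : mpath X y z) (a : mone y z)
    (G2 : mpath X z w) (b : mone x w) (t : mtwo G a)
    (s : mtwo (G1 ++ a :: G2) b),
  mcast (pmap_app3 (mm1 f) G1 G G2) (mm2 f (cut G1 G2 t s))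
  = cut (pmap (mm1 f) G1) (pmap (mm1 f) G2) (mm2 f t)
      (mcast (pmap_app3 (mm1 f) G1 [a] G2) (mm2 f s)).

Record tensor_strong {X Y : mb_data} (f : mm_data X Y) : Prop :=
    TensorStrong {
  ts_unit : forall x y (a : mone x y) (i : mtwo [a] a),
    is_unit i -> @is_unit Y _ _ (mm1 f _ _ a) (mm2 f i);
  ts_universal : forall x y (e : mone x y),
    tensor_universal e -> tensor_universal (mm1 f _ _ e);
  ts_tensor : forall x y z (a : mone x y) (b : mone y z) (c : mone x z)
      (t : mtwo [a; b] c),
    is_tensor t ->
    @is_tensor Y _ _ _ (mm1 f _ _ a) (mm1 f _ _ b) (mm1 f _ _ c) (mm2 f t) }.

Record strong_morphism (X Y : mb_data) := StrongMorphism {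
  mmdata :> mm_data X Y;
  mm_morphism : is_morphism mmdata;
  mm_strong : tensor_strong mmdata }.

Definition mm_id_data (X : mb_data) : mm_data X X :=
  MmData (mm0 := fun x => x) (mm1 := fun _ _ a => a)
    (fun _ _ G _ p => mcast (pmap_id G) p).

Definition mm_comp_data (X Y Z : mb_data) (f : mm_data X Y) (g : mm_data Y Z) :
    mm_data X Z :=
  MmData (mm0 := fun x => mm0 g (mm0 f x))
    (mm1 := fun _ _ a => mm1 g _ _ (mm1 f _ _ a))
    (fun _ _ G _ p => mcast (pmap_comp (mm1 f) (mm1 g) G) (mm2 g (mm2 f p))).

Section Casts.
Context {X : mb_data}.

Lemma mcast_id {x y} {P : mpath X x y} {b : mone x y} (e : P = P)
  (p : mtwo P b) : mcast e p = p.
Proof. now rewrite (UIP_refl _ _ e). Qed.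

Lemma mcast_mcast {x y} {P Q R : mpath X x y} {b : mone x y} (e : P = Q)
  (e' : Q = R) (p : mtwo P b) : mcast e' (mcast e p) = mcast (eq_trans e e') p.
Proof. now destruct e'. Qed.

Lemma mcast_pi {x y} {P Q : mpath X x y} {b : mone x y} (e e' : P = Q)
  (p : mtwo P b) : mcast e p = mcast e' p.
Proof. now rewrite (proof_irrelevance _ e e'). Qed.

Lemma mcast_move {x y} {P Q : mpath X x y} {b : mone x y} (e : P = Q)
  (p : mtwo P b) (q : mtwo Q b) : mcast e p = q -> p = mcast (eq_sym e) q.
Proof. now destruct e. Qed.

Lemma cut_mcast {x y z w} {G1 G1' : mpath X x y} {G G' : mpath X y z}
    {G2 G2' : mpath X z w} {a : mone y z} {b : mone x w}
    (e1 : G1 = G1') (e : G = G') (e2 : G2 = G2') (t : mtwo G a) P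
    (s : mtwo P b) (h : P = G1 ++ a :: G2) (h' : P = G1' ++ a :: G2')
    (k : G1 ++ (G ++ G2) = G1' ++ (G' ++ G2')) :
  cut G1' G2' (mcast e t) (mcast h' s) = mcast k (cut G1 G2 t (mcast h s)).
Proof.
destruct e1, e, e2; rewrite (mcast_id k), (mcast_pi h h'); reflexivity.
Qed.
End Casts.

Lemma mm2_mcast {X Y : mb_data} (f : mm_data X Y) {x y} {P Q : mpath X x y}
    {b : mone x y} (e : P = Q) (p : mtwo P b) :
  mm2 f (mcast e p) = mcast (f_equal (pmap (mm1 f)) e) (mm2 f p).
Proof. now destruct e. Qed.

Lemma mm_id_morphism (X : mb_data) : is_morphism (mm_id_data X).
Proof.
intros x y z w G1 G a G2 b t s; simpl.
rewrite !mcast_mcast.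
symmetry; etransitivity.
{ apply (cut_mcast (pmap_id G1) (pmap_id G) (pmap_id G2)) with
    (h := eq_refl)
    (k := eq_trans (pmap_id _) (pmap_app3 (f0 := fun x => x) _ G1 G G2)). }
reflexivity.
Qed.

Lemma mm_id_strong (X : mb_data) : tensor_strong (mm_id_data X).
Proof.
constructor; intros.
- exact (eq_rect_r (@is_unit X x y a) H (mcast_id _ i)).
- exact H.
- exact (eq_rect_r (@is_tensor X x y z a b c) H (mcast_id _ t)).
Qed.

Lemma mm_comp_morphism (X Y Z : mb_data) (f : mm_data X Y) (g : mm_data Y Z) :
  is_morphism f -> is_morphism g -> is_morphism (mm_comp_data f g).
Proof.
intros Hf Hg x y z w G1 G a G2 b t s; simpl.
rewrite (mcast_move (Hf _ _ _ _ _ _ _ _ _ t s)).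
rewrite !mm2_mcast.
rewrite (mcast_move (Hg _ _ _ _ _ _ _ _ _ (mm2 f t)
  (mcast (pmap_app3 (mm1 f) G1 [a] G2) (mm2 f s)))).
rewrite !mm2_mcast, !mcast_mcast.
symmetry; etransitivity.
{ apply (cut_mcast (pmap_comp (mm1 f) (mm1 g) G1)
    (pmap_comp (mm1 f) (mm1 g) G) (pmap_comp (mm1 f) (mm1 g) G2)) with
    (h := eq_trans (f_equal (pmap (mm1 g)) (pmap_app3 (mm1 f) G1 [a] G2))
            (pmap_app3 (mm1 g) (pmap (mm1 f) G1) [mm1 f _ _ a]
              (pmap (mm1 f) G2)))
    (k := f_equal2 app (pmap_comp (mm1 f) (mm1 g) G1)
            (f_equal2 app (pmap_comp (mm1 f) (mm1 g) G)
              (pmap_comp (mm1 f) (mm1 g) G2))). }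
apply mcast_pi.
Qed.

Lemma mm_comp_strong (X Y Z : mb_data) (f : mm_data X Y) (g : mm_data Y Z) :
  tensor_strong f -> tensor_strong g -> tensor_strong (mm_comp_data f g).
Proof.
intros Hf Hg; constructor; intros.
- exact (eq_rect_r (@is_unit Z _ _ (mm1 g _ _ (mm1 f _ _ a)))
    (ts_unit Hg (ts_unit Hf H)) (mcast_id _ _)).
- exact (ts_universal Hg (ts_universal Hf H)).
- exact (eq_rect_r (@is_tensor Z _ _ _ _ _ (mm1 g _ _ (mm1 f _ _ c)))
    (ts_tensor Hg (ts_tensor Hf H)) (mcast_id _ _)).
Qed.

Definition mm_id (X : mb_data) : strong_morphism X X :=
  StrongMorphism (@mm_id_morphism X) (mm_id_strong X).

Definition mm_comp (X Y Z : mb_data) (f : strong_morphism X Y)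
    (g : strong_morphism Y Z) : strong_morphism X Z :=
  StrongMorphism (mm_comp_morphism (mm_morphism f) (mm_morphism g))
    (mm_comp_strong (mm_strong f) (mm_strong g)).

Lemma strong_morphism_eq (X Y : mb_data) (f g : strong_morphism X Y) :
  mmdata f = mmdata g -> f = g.
Proof.
destruct f as [f Hf Hf'], g as [g Hg Hg']; simpl; intros <-; f_equal;
  apply proof_irrelevance.
Qed.

Lemma mm_data_eq (X Y : mb_data) f0 f1 f2 f2' :
  (forall x y G b p, f2 x y G b p = f2' x y G b p) ->
  @MmData X Y f0 f1 f2 = MmData f2'.
Proof.
intros H; f_equal; extensionality x; extensionality y; extensionality G.
extensionality b; extensionality p; apply H.
Qed.

Lemma mm_comp_id_l (X Y : mb_data) (f : strong_morphism X Y) :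
  mm_comp (mm_id X) f = f.
Proof.
apply strong_morphism_eq; destruct f as [[f0 f1 f2] Hf Hf'].
apply mm_data_eq; simpl; intros.
pose proof (mm2_mcast (MmData f2) (pmap_id G) p) as E; simpl in E.
rewrite E, mcast_mcast; apply mcast_id.
Qed.

Lemma mm_comp_id_r (X Y : mb_data) (f : strong_morphism X Y) :
  mm_comp f (mm_id Y) = f.
Proof.
apply strong_morphism_eq; destruct f as [[f0 f1 f2] Hf Hf'].
apply mm_data_eq; simpl; intros.
rewrite mcast_mcast; apply mcast_id.
Qed.

Lemma mm_comp_assoc (X Y Z W : mb_data) (f : strong_morphism X Y)
    (g : strong_morphism Y Z) (h : strong_morphism Z W) :
  mm_comp (mm_comp f g) h = mm_comp f (mm_comp g h).
Proof.
apply strong_morphism_eq; apply mm_data_eq; simpl; intros.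
rewrite mm2_mcast, !mcast_mcast; apply mcast_pi.
Qed.

Definition rMulBiCat_tens : category :=
  Category (obj := rep_mb) (hom := fun X Y => strong_morphism X Y)
    (cid := fun X => mm_id X) (ccomp := fun _ _ _ f g => mm_comp f g)
    (fun _ _ f => mm_comp_id_l f) (fun _ _ f => mm_comp_id_r f)
    (fun _ _ _ _ f g h => mm_comp_assoc f g h).

Definition single_0cell_mb (X : obj rMulBiCat_tens) : Prop :=
  single (mob (X : rep_mb)).

Definition rMulCat_tens : category := full_subcategory single_0cell_mb.

(* The cells [ch_l a] and [ch_r a] witness that [ch_unit x] is a tensor unit.
   The casts only re-associate composable sequences. *)
Record coherent_choice (X : mb_data) := CoherentChoice {
  ch_tens : forall x y z, @mone X x y -> @mone X y z -> @mone X x z;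
  ch_t : forall x y z (a : @mone X x y) (b : @mone X y z),
    mtwo [a; b] (ch_tens a b);
  ch_t_tensor : forall x y z (a : @mone X x y) (b : @mone X y z),
    is_tensor (ch_t a b);
  ch_unit : forall x, @mone X x x;
  ch_l : forall x y (a : @mone X x y), mtwo [ch_unit x; a] a;
  ch_r : forall x y (a : @mone X x y), mtwo [a; ch_unit y] a;
  ch_l_witness : forall x y (a : @mone X x y), lunit_witness (ch_l a);
  ch_r_witness : forall x y (a : @mone X x y), runit_witness (ch_r a);
  ch_coh_l : forall x y z (a : @mone X x y) (G : mpath X y z) (b : @mone X x z)
      (p : mtwo (a :: G) b),
    mcast (app_nil_r (ch_unit x :: a :: G)) (cut [ch_unit x] nil p (ch_l b))
    = cut nil G (ch_l a) p;
  ch_coh_r : forall x y z (G : mpath X x y) (a : @mone X y z) (b : @mone X x z)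
      (p : mtwo (G ++ [a]) b),
    mcast (app_assoc G [a] [ch_unit z]) (cut nil [ch_unit z] p (ch_r b))
    = cut G nil (ch_r a) p;
  ch_coh_m : forall x y z w v (G1 : mpath X x y) (a : @mone X y z)
      (b : @mone X z w) (G2 : mpath X w v) (c : @mone X x v)
      (q : mtwo (G1 ++ a :: b :: G2) c),
    mcast (app_assoc G1 [a] (ch_unit z :: b :: G2))
      (cut (G1 ++ [a]) G2 (ch_l b)
        (mcast (eq_sym (app_assoc G1 [a] (b :: G2))) q))
    = cut G1 (b :: G2) (ch_r a) q;
  ch_coh_unit : forall x, ch_l (ch_unit x) = ch_r (ch_unit x) }.
Arguments ch_tens {X} c {x y z} a b : rename.
Arguments ch_t {X} c {x y z} a b : rename.
Arguments ch_t_tensor {X} c {x y z} a b : rename.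
Arguments ch_unit {X} c x : rename.
Arguments ch_l {X} c {x y} a : rename.
Arguments ch_r {X} c {x y} a : rename.
Arguments ch_l_witness {X} c {x y} a : rename.
Arguments ch_r_witness {X} c {x y} a : rename.

(* A unit on [a] is unique when it exists, so this involves no choice. *)
Definition mid {X : rep_mb} {x y} (a : @mone X x y) : mtwo [a] a :=
  proj1_sig (constructive_indefinite_description _ (unital (rep_mb_rep X) a)).

Lemma mid_unit {X : rep_mb} {x y} (a : @mone X x y) : is_unit (mid a).
Proof.
exact (proj2_sig (constructive_indefinite_description _
  (unital (rep_mb_rep X) a))).
Qed.

Section CutLemmas.
Context {X : rep_mb}.
Let HX := rep_mb_regular X.

Definition post {x y} {P : mpath X x y} {a b : mone x y} (q : mtwo P a)
  (p : mtwo [a] b) : mtwo P b := mcast (app_nil_r P) (cut nil nil q p).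

Lemma post_mid {x y} {P : mpath X x y} {a : mone x y} (q : mtwo P a) :
  post q (mid a) = q.
Proof.
unfold post; rewrite (proj1 (mid_unit a)), mcast_mcast; apply mcast_id.
Qed.

Lemma mcast_post {x y} {P Q : mpath X x y} {a b : mone x y} (e : P = Q)
    (q : mtwo P a) (p : mtwo [a] b) : post (mcast e q) p = mcast e (post q p).
Proof. now destruct e. Qed.

Lemma cut_post {x y z} {P : mpath X x y} {e : mpath X y z} {c : mone x y}
    {a b : mone x z} (r : mtwo P c) (t : mtwo (c :: e) a) (s : mtwo [a] b) :
  cut nil e r (post t s) = post (cut nil e r t) s.
Proof.
pose proof (cut_assoc HX (G1 := nil) (D1 := nil) (D := P) (G2 := nil)
  r t s) as H.
apply (f_equal (mcast (f_equal (app P) (app_nil_r e)))) in H.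
rewrite mcast_mcast in H; unfold post.
etransitivity; [|etransitivity; [exact H|apply mcast_pi]].
exact (cut_mcast (G1 := nil) (G1' := nil) eq_refl eq_refl (app_nil_r e) r
  (cut nil nil t s) (app_nest nil nil [c] e nil) (app_nil_r (c :: e))
  (f_equal (app P) (app_nil_r e))).
Qed.

Lemma post_post {x y} {P : mpath X x y} {a b c : mone x y} (q : mtwo P a)
    (p : mtwo [a] b) (s : mtwo [b] c) : post (post q p) s = post q (post p s).
Proof.
transitivity (mcast (app_nil_r P) (post (cut nil nil q p) s)).
- apply mcast_post.
- apply (f_equal (mcast (app_nil_r P))); symmetry; apply (cut_post q p s).
Qed.

Lemma post_nil_2 {x y z} {a : mone x y} {b : mone y z} {c d : @mone X x z}
    (t : mtwo [a; b] c) (p : mtwo [c] d) : post t p = cut nil nil t p.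
Proof. apply mcast_id. Qed.

Lemma tensor_tensor_out {x y z w} {a : @mone X x y} {b : mone y z}
    {ab : mone x z} {c : mone z w} {d k : mone x w} (t : mtwo [a; b] ab)
    (t' : mtwo [ab; c] d) (s : mtwo [a; b; c] k) :
  is_tensor t -> is_tensor t' ->
  exists! h : mtwo [d] k, cut nil nil (cut nil [c] t t') h = s.
Proof.
intros Ht Ht'.
assert (E : forall h : mtwo [d] k,
  cut nil nil (cut nil [c] t t') h = cut nil [c] t (cut nil nil t' h)).
{ intros h; rewrite <- (post_nil_2 t' h).
  etransitivity; [|symmetry; apply (cut_post t t' h)].
  symmetry; apply mcast_id. }
destruct (Ht _ _ nil [c] k s) as [r [Hr Ur]].
destruct (Ht' _ _ nil nil k r) as [h [Hh Uh]].
exists h; split.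
- rewrite E; etransitivity; [apply (f_equal (cut nil [c] t) Hh)|exact Hr].
- intros h' Hh'; apply Uh; symmetry; apply Ur.
  etransitivity; [symmetry; apply E|exact Hh'].
Qed.

Lemma tensor_univ_in {x y z} {a : @mone X x y} {e : mone y z} {c : mone x z}
    (m : mtwo [a; e] c) :
  tensor_universal e -> is_tensor m -> univ_in nil a [e] m.
Proof.
intros [_ [_ [_ He]]] Hm.
destruct (He _ a) as [v [s [Hs Us]]].
destruct (Hm _ _ nil nil v s) as [p [Hp _]].
destruct (Hs _ _ nil nil c m) as [q [Hq _]].
change (mtwo [c] v) in (type of p); change (mtwo [v] c) in (type of q).
assert (Hp' : post m p = s) by (rewrite post_nil_2; exact Hp).
assert (Hq' : post s q = m) by (rewrite post_nil_2; exact Hq).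
assert (Epq : post p q = mid c).
{ destruct (Hm _ _ nil nil c m) as [i [_ Ui]].
  transitivity i; [symmetry|]; apply Ui.
  - transitivity (post m (post p q)); [symmetry; apply post_nil_2|].
    rewrite <- post_post, Hp'; exact Hq'.
  - transitivity (post m (mid c)); [symmetry; apply post_nil_2|].
    apply post_mid. }
intros G HG t.
destruct (Us G HG (post t p)) as [r [Hr Ur]].
assert (C : forall r : mtwo G a, cut nil [e] r m = post (cut nil [e] r s) q).
{ intros r'; rewrite <- Hq' at 1; apply cut_post. }
assert (C' : forall r : mtwo G a, cut nil [e] r s = post (cut nil [e] r m) p).
{ intros r'; rewrite <- Hp' at 1; apply cut_post. }
exists r; split.
- rewrite C; etransitivity; [apply (f_equal (fun t => post t q) Hr)|].
  rewrite post_post, Epq; apply post_mid.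
- intros r' Hr'; apply Ur; rewrite C'.
  apply (f_equal (fun t => post t p) Hr').
Qed.

Lemma tensor_unit_universal (c : coherent_choice X) x :
  tensor_universal (ch_unit c x).
Proof.
split; [|split; [|split]]; intros y a; exists a.
1, 2: exists (ch_l c a); apply ch_l_witness.
all: exists (ch_r c a); apply ch_r_witness.
Qed.
End CutLemmas.

Section G.
Context {X : rep_mb} (c : coherent_choice X).
Local Notation "a ⊠ b" := (ch_tens c a b) (at level 40, left associativity).

Definition G_tens2 x y z (a a' : @mone X x y) (b b' : @mone X y z)
    (p : mtwo [a] a') (q : mtwo [b] b') : mtwo [a ⊠ b] (a' ⊠ b') :=
  the (P := fun h => cut nil nil (ch_t c a b) h
                     = cut [a] nil q (cut nil [b'] p (ch_t c a' b')))
    (ch_t_tensor c a b _ _ nil nil _ (cut [a] nil q (cut nil [b'] p (ch_t c a' b')))).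

Definition G_assoc x y z w (a : @mone X x y) (b : @mone X y z)
    (d : @mone X z w) : mtwo [(a ⊠ b) ⊠ d] (a ⊠ (b ⊠ d)) :=
  the (P := fun h => cut nil nil (cut nil [d] (ch_t c a b) (ch_t c (a ⊠ b) d)) h
                     = cut [a] nil (ch_t c b d) (ch_t c a (b ⊠ d)))
    (tensor_tensor_out (cut [a] nil (ch_t c b d) (ch_t c a (b ⊠ d)))
      (ch_t_tensor c a b) (ch_t_tensor c (a ⊠ b) d)).

Definition G_lunit x y (a : @mone X x y) : mtwo [ch_unit c x ⊠ a] a :=
  the (P := fun h => cut nil nil (ch_t c (ch_unit c x) a) h = ch_l c a)
    (ch_t_tensor c (ch_unit c x) a _ _ nil nil _ (ch_l c a)).

Definition G_runit x y (a : @mone X x y) : mtwo [a ⊠ ch_unit c y] a :=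
  the (P := fun h => cut nil nil (ch_t c a (ch_unit c y)) h = ch_r c a)
    (ch_t_tensor c a (ch_unit c y) _ _ nil nil _ (ch_r c a)).

Definition G_data : bicat_data :=
  BicatData (ob := mob X) (one := @mone X) (two := fun _ _ a b => mtwo [a] b)
    (unit1 := ch_unit c) (tens := @ch_tens X c)
    (fun _ _ a => mid a) (fun _ _ _ _ _ p q => cut nil nil p q) G_tens2 G_assoc G_lunit G_runit.
End G.

Section GMorphism.
Context {X Y : rep_mb} (c : coherent_choice X) (d : coherent_choice Y).
Context (f : strong_morphism X Y).
Local Notation f1 := (mm1 f _ _).

Definition G_mor_tens x y z (a : @mone X x y) (b : @mone X y z) :
    mtwo [ch_tens d (f1 a) (f1 b)] (f1 (ch_tens c a b)) :=
  the (P := fun h => cut nil nil (ch_t d (f1 a) (f1 b)) h = mm2 f (ch_t c a b))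
    (ch_t_tensor d (f1 a) (f1 b) _ _ nil nil _ (mm2 f (ch_t c a b))).

Lemma mm2_l_unit_univ x :
  univ_in (X := Y) nil (f1 (ch_unit c x)) [f1 (ch_unit c x)]
    (mm2 f (ch_l c (ch_unit c x))).
Proof.
apply tensor_univ_in.
- apply (ts_universal (mm_strong f)), tensor_unit_universal.
- apply (ts_tensor (mm_strong f)), ch_l_witness.
Qed.

Definition G_mor_unit x : mtwo [ch_unit d (mm0 f x)] (f1 (ch_unit c x)) :=
  the (P := fun h : mtwo [ch_unit d (mm0 f x)] (f1 (ch_unit c x)) =>
              cut nil [f1 (ch_unit c x)] h (mm2 f (ch_l c (ch_unit c x)))
              = ch_l d (f1 (ch_unit c x)))
    (@mm2_l_unit_univ x [ch_unit d (mm0 f x)] I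
      (ch_l d (f1 (ch_unit c x)))).

Definition G_mor : pf_data (G_data c) (G_data d) :=
  PfData (B := G_data c) (C := G_data d) (pf0 := mm0 f) (pf1 := mm1 f)
    (fun _ _ a b p => mm2 f (p : mtwo [a] b)) G_mor_tens G_mor_unit.
End GMorphism.

Record G_is_functor (c : forall X : rep_mb, coherent_choice X) : Prop :=
    GIsFunctor {
  G_ob : forall X, is_bicategory (G_data (c X));
  G_hom : forall (X Y : rep_mb) (f : strong_morphism X Y),
    is_pseudofunctor (G_mor (c X) (c Y) f);
  G_id : forall X, G_mor (c X) (c X) (mm_id X) = pf_id_data (G_data (c X));
  G_comp : forall (X Y Z : rep_mb) (f : strong_morphism X Y)
      (g : strong_morphism Y Z),
    G_mor (c X) (c Z) (mm_comp f g)
    = pf_comp_data (G_mor (c X) (c Y) f) (G_mor (c Y) (c Z) g) }.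

Definition G_functor (c : forall X : rep_mb, coherent_choice X)
    (H : G_is_functor c) : functor rMulBiCat_tens BiCat :=
  Functor (C := rMulBiCat_tens) (D := BiCat)
    (fobj := fun X => Bicategory (G_ob H X))
    (fhom := fun X Y f => Pseudofunctor (G_hom H f))
    (fun X => pseudofunctor_eq
      (f := Pseudofunctor (G_hom H (mm_id X)))
      (g := pf_id (Bicategory (G_ob H X))) (G_id H X))
    (fun X Y Z f g => pseudofunctor_eq
      (f := Pseudofunctor (G_hom H (mm_comp f g)))
      (g := pf_comp (B := Bicategory (G_ob H X)) (C := Bicategory (G_ob H Y))
              (D := Bicategory (G_ob H Z))
              (Pseudofunctor (G_hom H f)) (Pseudofunctor (G_hom H g)))
      (G_comp H f g)).

Section Int.
Context (B : bicat_data).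
Local Notation bpath := (path (one B)).

(* [lb w [c1; ..; cn]] is [(..((w ⊗ c1) ⊗ c2)..) ⊗ cn]. *)
Fixpoint lb {x y z} (w : one B x y) (G : bpath y z) : one B x z :=
  match G in path _ y z return one B x y -> one B x z with
  | nil => fun w => w
  | c :: G => fun w => lb (w ⊗ c) G
  end w.

Definition int_two x y (G : bpath x y) : one B x y -> Type :=
  match G in path _ x y return one B x y -> Type with
  | nil => fun _ => Empty_set
  | a :: G => fun b => two (lb a G) b
  end.
Arguments int_two {x y} G b.

Fixpoint lb_map {x y z} {w w' : one B x y} (p : two w w') (G : bpath y z) :
    two (lb w G) (lb w' G) :=
  match G in path _ y z
    return forall w w' : one B x y, two w w' -> two (lb w G) (lb w' G)
  with
  | nil => fun _ _ p => p
  | c :: G => fun _ _ p => lb_map (p ⊗₂ id2 c) G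
  end w w' p.

(* The inputs of a 2-cell of [int_data] are bracketed to the left, so the
   re-bracketings in a cut only use associators in the direction
   [(a ⊗ b) ⊗ c -> a ⊗ (b ⊗ c)], and no inverse associator.  [lb_app] is an
   identity up to the equality of its boundaries, which are not convertible. *)

Fixpoint lb_tens {x y z t} (w : one B x y) (c : one B y z) (G : bpath z t) :
    two (lb (w ⊗ c) G) (w ⊗ lb c G) :=
  match G in path _ z t
    return forall c : one B y z, two (lb (w ⊗ c) G) (w ⊗ lb c G)
  with
  | nil => fun c => id2 (w ⊗ c)
  | d :: G => fun c => lb_map (assoc w c d) G ⋅ lb_tens w (c ⊗ d) G
  end c.

Fixpoint lb_app {x y z t} (w : one B x y) (G : bpath y z) :
    forall H : bpath z t, two (lb w (G ++ H)) (lb (lb w G) H) :=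
  match G in path _ y z
    return forall (w : one B x y) (H : bpath z t),
      two (lb w (G ++ H)) (lb (lb w G) H)
  with
  | nil => fun w H => id2 (lb w H)
  | c :: G => fun w H => lb_app (w ⊗ c) G H
  end w.

(* Given [p : (G) -> (a)], the 2-cell [lb w (G ++ G2) -> lb (w ⊗ a) G2]. *)
Definition int_insert {x y z t} (w : one B x y) {G : bpath y z}
    {a : one B y z} (p : int_two G a) (G2 : bpath z t) :
    two (lb w (G ++ G2)) (lb (w ⊗ a) G2) :=
  match G in path _ y z
    return forall (w : one B x y) (a : one B y z), int_two G a ->
      forall G2 : bpath z t, two (lb w (G ++ G2)) (lb (w ⊗ a) G2)
  with
  | nil => fun _ _ p _ => match p with end
  | c :: G => fun w a p G2 =>
      lb_app (w ⊗ c) G G2 ⋅ lb_map (lb_tens w c G ⋅ (id2 w ⊗₂ p)) G2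
  end w a p G2.

Fixpoint int_whisker {x y z t u} (w : one B x y) (G1 : bpath y z) :
    forall (G : bpath z t) (a : one B z t), int_two G a ->
    forall G2 : bpath t u,
    two (lb w (G1 ++ (G ++ G2))) (lb w (G1 ++ a :: G2)) :=
  match G1 in path _ y z
    return forall (w : one B x y) (G : bpath z t) (a : one B z t),
      int_two G a -> forall G2 : bpath t u,
      two (lb w (G1 ++ (G ++ G2))) (lb w (G1 ++ a :: G2))
  with
  | nil => fun w G _ p G2 => int_insert w p G2
  | c :: G1 => fun w G _ p G2 => int_whisker (w ⊗ c) G1 p G2
  end w.

Definition int_cut_head {y z w} {G : bpath y z} {a : one B y z}
    {G2 : bpath z w} {b : one B y w} (p : int_two G a)
    (s : int_two (a :: G2) b) : int_two (G ++ G2) b :=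
  match G in path _ y z
    return forall (a : one B y z) (G2 : bpath z w) (b : one B y w),
      int_two G a -> int_two (a :: G2) b -> int_two (G ++ G2) b
  with
  | nil => fun _ _ _ p _ => match p with end
  | c :: G => fun _ G2 _ p s => lb_app c G G2 ⋅ lb_map p G2 ⋅ s
  end a G2 b p s.

Definition int_cut x y z w (G1 : bpath x y) (G : bpath y z) (a : one B y z)
    (G2 : bpath z w) (b : one B x w) :
    int_two G a -> int_two (G1 ++ a :: G2) b ->
    int_two (G1 ++ (G ++ G2)) b :=
  match G1 in path _ x y
    return forall (G : bpath y z) (a : one B y z) (G2 : bpath z w)
      (b : one B x w), int_two G a -> int_two (G1 ++ a :: G2) b ->
      int_two (G1 ++ (G ++ G2)) b
  with
  | nil => fun G _ G2 _ p s => int_cut_head p s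
  | c :: G1 => fun G _ G2 _ p s => int_whisker c G1 p G2 ⋅ s
  end G a G2 b.

Definition int_data : mb_data := MbData int_cut.
End Int.

Section IntMorphism.
Context {B C : bicat_data} (f : pf_data B C).

Fixpoint int_mor_coh {x y z} (w : one B x y) (G : path (one B) y z) :
    two (lb (pf1 f w) (pmap (@pf1 _ _ f) G)) (pf1 f (lb w G)) :=
  match G in path _ y z
    return forall w : one B x y,
      two (lb (pf1 f w) (pmap (@pf1 _ _ f) G)) (pf1 f (lb w G))
  with
  | nil => fun w => id2 (pf1 f w)
  | c :: G => fun w =>
      lb_map (pf_tens f w c) (pmap (@pf1 _ _ f) G) ⋅ int_mor_coh (w ⊗ c) G
  end w.

Definition int_mor2 x y (G : path (one B) x y) (b : one B x y) :
    int_two G b -> int_two (pmap (@pf1 _ _ f) G) (pf1 f b) :=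
  match G in path _ x y
    return forall b : one B x y,
      int_two G b -> int_two (pmap (@pf1 _ _ f) G) (pf1 f b)
  with
  | nil => fun _ p => match p with end
  | a :: G => fun b p => int_mor_coh a G ⋅ pf2 f p
  end b.

Definition int_mor : mm_data (int_data B) (int_data C) :=
  MmData (X := int_data B) (Y := int_data C) (mm0 := pf0 f)
    (mm1 := @pf1 _ _ f) int_mor2.
End IntMorphism.

Record int_is_functor : Prop := IntIsFunctor {
  int_regular : forall B : bicategory, is_regular_mb (int_data B);
  int_rep : forall B : bicategory, tensor_representable (int_data B);
  int_morphism : forall (B C : bicategory) (f : pseudofunctor B C),
    is_morphism (int_mor f);
  int_strong : forall (B C : bicategory) (f : pseudofunctor B C),
    tensor_strong (int_mor f);
  int_id : forall B : bicategory,
    int_mor (pf_id B) = mm_id_data (int_data B);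
  int_comp : forall (B C D : bicategory) (f : pseudofunctor B C)
      (g : pseudofunctor C D),
    int_mor (pf_comp f g) = mm_comp_data (int_mor f) (int_mor g) }.

Definition int_functor (H : int_is_functor) : functor BiCat rMulBiCat_tens :=
  Functor (C := BiCat) (D := rMulBiCat_tens)
    (fobj := fun B => RepMb (int_regular H B) (int_rep H B))
    (fhom := fun B C f =>
      StrongMorphism (int_morphism H f) (int_strong H f))
    (fun B => strong_morphism_eq
      (f := StrongMorphism (int_morphism H (pf_id B)) (int_strong H (pf_id B)))
      (g := mm_id (int_data B)) (int_id H B))
    (fun B C D f g => strong_morphism_eq
      (f := StrongMorphism (int_morphism H (pf_comp f g))
              (int_strong H (pf_comp f g)))
      (g := mm_comp (StrongMorphism (int_morphism H f) (int_strong H f))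
              (StrongMorphism (int_morphism H g) (int_strong H g)))
      (int_comp H f g)).

(* Main.v *)
Require Import Defs.
From Stdlib Require Import FunctionalExtensionality IndefiniteDescription Eqdep
  Classical.

(**
Both functors keep the 0-cells and the 1-cells, so everything happens at the
level of 2-cells, and there the theorem says that a 2-cell out of
[(..(a1 ⊗ a2)..) ⊗ an] is the same thing as a 2-cell with inputs [a1, .., an].

The cells of a representable multi-bicategory [X] are manipulated as operators:
cutting a cell into a fixed position of the inputs of another one.  Up to the
bracketing of the input sequences these operators compose associatively
([Cut_nest]) and commute when their positions are disjoint ([Cut_swap]).  A
2-cell of [G X] is determined by what it becomes after cutting universal tensor
cells into its input, and the defining equations of the structure cells of [G X]
([tens2_spec], [assoc_spec], [lunit_spec], [runit_spec]) then rewrite both sides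
of an axiom to one and the same composite of tensor cells.  The triangle and the
unit laws use the coherence of the unit witnesses.  Such witnesses exist
([coherent_unit_exists]): an arbitrary family [m] of left witnesses, with
[i = m e], is corrected to the family [l] such that cutting [m a] into the second
input of [l a] gives the same cell as cutting [i] into the first input of [m a].

For the multi-bicategory of a bicategory [B], a 2-cell [p : (G) -> (a)] is turned
into the family of 2-cells [insertion w p : lb w G -> w ⊗ a], natural in [w].
A cut becomes a plain composite of such families ([insertion_cut]), and [p] can be
recovered from its component at a unit ([insertion_unit_inj]).  Associativity and
interchange of cuts are then functoriality and naturality.  A cell is universal
at its output exactly when it is invertible in [B] ([int_univ_out],
[univ_out_invertible]), and a 1-cell is tensor universal exactly when it is an
equivalence ([equivalence_tensor_universal]).  Invertible cells and equivalences
are preserved by pseudofunctors, which is why these give tensor strong morphisms.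

The isomorphism from the multi-bicategory of [G X] to [X] composes a 2-cell with
the iterated universal tensor [iter_tensor]; it is bijective by universality and
it respects cuts ([unfold_cut]).  The isomorphism from [G] of the multi-bicategory
of [B] to [B] is the identity on cells; its structure 2-cells are the chosen tensor
cells, which are invertible, and a comparison of the unit 1-cells
([unit_comparison]).  Both are natural for arbitrary choices of tensors and units,
and since neither changes 0-cells they restrict to the one-object case.
*)

Set Implicit Arguments.
Unset Strict Implicit.
Unset Printing Implicit Defensive.
Local Open Scope path_scope.
Local Open Scope bicat_scope.

(** * Calculus of cuts *)

Definition decide (P : Prop) : {P} + {~ P}.
Proof.
assert (H : exists b : bool, if b then P else ~ P).
{ destruct (classic P); [exists true|exists false]; assumption. }
destruct (constructive_indefinite_description _ H) as [[] h]; auto.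
Defined.

Section Cells.
Context {X : rep_mb}.
Let HX := rep_mb_regular X.

(** The input sequence is part of a cell, so that cells whose input sequences agree
only up to re-association can be compared by an ordinary equality. *)
Definition cell {x y} (b : @mone X x y) : Type := {P : mpath X x y & mtwo P b}.
Definition inputs {x y} {b : @mone X x y} (m : cell b) : mpath X x y := projT1 m.
Definition pack {x y} {P : mpath X x y} {b : mone x y} (p : mtwo P b) : cell b :=
  existT (fun P => mtwo P b) P p.

Lemma pack_inj {x y} {P : mpath X x y} {b : mone x y} (p q : mtwo P b) :
  pack p = pack q -> p = q.
Proof. apply inj_pair2. Qed.

Lemma pack_mcast {x y} {P Q : mpath X x y} {b : mone x y} (e : P = Q)
  (p : mtwo P b) : pack (mcast e p) = pack p.
Proof. now destruct e. Qed.

Lemma cell_pack {x y} {b : @mone X x y} (m : cell b) P :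
  inputs m = P -> exists p : mtwo P b, m = pack p.
Proof. intros <-; exists (projT2 m); now destruct m. Qed.

(** A total version of [cut], with a junk value where [s] does not have the input
[a] between [G1] and [G2]: the laws of cuts become equations of cells, with
conditions on input sequences and without casts. *)
Definition Cut {x y z w} (G1 : mpath X x y) {a : mone y z} (G2 : mpath X z w)
    {b : mone x w} (t : cell a) (s : cell b) : cell b :=
  match decide (inputs s = G1 ++ a :: G2) with
  | left e => pack (cut G1 G2 (projT2 t) (mcast e (projT2 s)))
  | right _ => s
  end.

Lemma Cut_pack {x y z w} (G1 : mpath X x y) {a : mone y z} (G2 : mpath X z w)
    {b : mone x w} {G} (t : mtwo G a) (s : mtwo (G1 ++ a :: G2) b) :
  Cut G1 G2 (pack t) (pack s) = pack (cut G1 G2 t s).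
Proof.
unfold Cut; destruct (decide _) as [e|n]; [|now destruct n].
simpl in *; now rewrite mcast_id.
Qed.

Lemma inputs_Cut {x y z w} (G1 : mpath X x y) {a : mone y z} (G2 : mpath X z w)
    {b : mone x w} (t : cell a) (s : cell b) :
  inputs s = G1 ++ a :: G2 ->
  inputs (Cut G1 G2 t s) = G1 ++ (inputs t ++ G2).
Proof.
intros e; destruct (cell_pack e) as [s' ->]; destruct t as [G t].
change (existT _ G t) with (pack t); now rewrite Cut_pack.
Qed.

Lemma Cut_nest {x y z t u v} {G1 : mpath X x y} {D1 : mpath X y z}
    {c : mone z t} {D2 : mpath X t u} {a : mone y u}
    {G2 : mpath X u v} {b : mone x v} (r : cell c) (q : cell a) (s : cell b) :
  inputs q = D1 ++ c :: D2 -> inputs s = G1 ++ a :: G2 ->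
  Cut G1 G2 (Cut D1 D2 r q) s = Cut (G1 ++ D1) (D2 ++ G2) r (Cut G1 G2 q s).
Proof.
intros e e'; destruct (cell_pack e) as [q' ->], (cell_pack e') as [s' ->].
destruct r as [D r]; change (existT _ D r) with (pack r).
rewrite !Cut_pack.
rewrite <- (pack_mcast (app_nest G1 D1 D D2 G2)), <- (cut_assoc HX).
rewrite <- Cut_pack; f_equal; apply pack_mcast.
Qed.

Lemma Cut_swap {x y z t u v} {G1 : mpath X x y}
      {a : mone y z} {G2 : mpath X z t}
      {c : mone t u} {G3 : mpath X u v} {b : mone x v}
      (p : cell a) (q : cell c) (s : cell b) :
  inputs s = G1 ++ a :: (G2 ++ c :: G3) ->
  Cut (G1 ++ (inputs p ++ G2)) G3 q (Cut G1 (G2 ++ c :: G3) p s)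
  = Cut G1 (G2 ++ (inputs q ++ G3)) p (Cut (G1 ++ a :: G2) G3 q s).
Proof.
intros e; destruct (cell_pack e) as [s' ->].
destruct p as [G p], q as [D q]; simpl inputs.
change (existT _ G p) with (pack p); change (existT _ D q) with (pack q).
rewrite Cut_pack.
pose proof (cut_interchange HX p q s') as H; apply (f_equal pack) in H.
rewrite pack_mcast, <- !Cut_pack in H.
etransitivity; [|etransitivity; [exact H|]].
- f_equal; symmetry; apply pack_mcast.
- f_equal; etransitivity; [apply pack_mcast|].
  rewrite <- Cut_pack; f_equal; apply pack_mcast.
Qed.

Lemma Cut_mid {x y z w} (G1 : mpath X x y) {a : mone y z} (G2 : mpath X z w)
    {b : mone x w} (s : cell b) :
  inputs s = G1 ++ a :: G2 -> Cut G1 G2 (pack (mid a)) s = s.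
Proof.
intros e; destruct (cell_pack e) as [s' ->].
rewrite Cut_pack; f_equal; apply (proj2 (mid_unit a)).
Qed.

Lemma mid_Cut {x y} {a : @mone X x y} (s : cell a) :
  Cut nil nil s (pack (mid a)) = s.
Proof.
destruct s as [G s]; change (existT _ G s) with (pack s).
etransitivity; [exact (Cut_pack (G1 := nil) (G2 := nil) s (mid a))|].
rewrite (proj1 (mid_unit a)); apply pack_mcast.
Qed.

Definition universal_out {x y} {a : @mone X x y} (t : cell a) : Prop :=
  univ_out (projT2 t).

Lemma Cut_univ_out_inj {x y z w} {G1 : mpath X x y} {a : mone y z}
    {G2 : mpath X z w} {b : mone x w} (t : cell a) (s s' : cell b) :
  universal_out t -> inputs s = G1 ++ a :: G2 -> inputs s' = G1 ++ a :: G2 ->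
  Cut G1 G2 t s = Cut G1 G2 t s' -> s = s'.
Proof.
intros Ht e e'; destruct (cell_pack e) as [r ->], (cell_pack e') as [r' ->].
destruct t as [G t]; change (existT _ G t) with (pack t).
rewrite !Cut_pack; intros H; apply pack_inj in H.
destruct (Ht _ _ G1 G2 b (cut G1 G2 t r')) as [q [_ Uq]].
f_equal; transitivity q; [symmetry|]; apply Uq; simpl; auto.
Qed.

Lemma Cut_univ_out_ex {x y z w} {G1 : mpath X x y} {a : mone y z}
    {G2 : mpath X z w} {b : mone x w} (t : cell a) (s : cell b) :
  universal_out t -> inputs s = G1 ++ (inputs t ++ G2) ->
  exists r : cell b, inputs r = G1 ++ a :: G2 /\ Cut G1 G2 t r = s.
Proof.
intros Ht e; destruct t as [G t]; simpl in e.
destruct (cell_pack e) as [s' ->].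
destruct (Ht _ _ G1 G2 b s') as [q [Hq _]].
exists (pack q); split; [reflexivity|].
change (existT _ G t) with (pack t); rewrite Cut_pack; f_equal; exact Hq.
Qed.

Lemma universal_out_intro {x y} {a : @mone X x y} (t : cell a) :
  (forall x' y' (G1 : mpath X x' x) (G2 : mpath X y y') (b : mone x' y')
    (s : cell b), inputs s = G1 ++ (inputs t ++ G2) ->
  exists r : cell b, inputs r = G1 ++ a :: G2 /\ Cut G1 G2 t r = s) ->
  (forall x' y' (G1 : mpath X x' x) (G2 : mpath X y y') (b : mone x' y')
    (s s' : cell b), inputs s = G1 ++ a :: G2 -> inputs s' = G1 ++ a :: G2 ->
     Cut G1 G2 t s = Cut G1 G2 t s' -> s = s') ->
  universal_out t.
Proof.
intros E U x' y' G1 G2 b s; destruct t as [G t]; simpl in s.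
change (existT _ G t) with (pack t) in E, U.
destruct (E _ _ G1 G2 b (pack s) eq_refl) as [r [e Hr]].
destruct (cell_pack e) as [r' ->].
rewrite Cut_pack in Hr; apply pack_inj in Hr.
exists r'; split; [exact Hr|].
intros q Hq; apply pack_inj, (U _ _ G1 G2); auto.
rewrite !Cut_pack, Hr; f_equal; symmetry; exact Hq.
Qed.

(** The witness [t'] gives [t] the shape that [univ_in] asks for. *)
Definition universal_in {x y z w} (G1 : mpath X x y) (a : mone y z)
    (G2 : mpath X z w) {b : mone x w} (t : cell b) : Prop :=
  exists t' : mtwo (G1 ++ a :: G2) b, t = pack t' /\ univ_in G1 a G2 t'.

Lemma inputs_nonempty {x y} {a : @mone X x y} (s : cell a) :
  nonempty (inputs s).
Proof. exact (mregular HX (projT2 s)). Qed.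

Lemma Cut_univ_in_inj {x y z w} {G1 : mpath X x y} {a : mone y z}
    {G2 : mpath X z w} {b : mone x w} (t : cell b) (s s' : cell a) :
  universal_in G1 a G2 t -> inputs s = inputs s' ->
  Cut G1 G2 s t = Cut G1 G2 s' t -> s = s'.
Proof.
intros [t' [-> Ht]] e; destruct (cell_pack e) as [q ->].
pose proof (inputs_nonempty s').
destruct s' as [G s']; simpl in *.
change (existT _ G s') with (pack s'); rewrite !Cut_pack; intros E.
apply pack_inj in E.
destruct (Ht G H (cut G1 G2 s' t')) as [r [_ Ur]].
f_equal; transitivity r; [symmetry|]; apply Ur; simpl; auto.
Qed.

Lemma Cut_univ_in_ex {x y z w} {G1 : mpath X x y} {a : mone y z}
    {G2 : mpath X z w} {b : mone x w} (t : cell b) (G : mpath X y z) (s : cell b) :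
  universal_in G1 a G2 t -> nonempty G -> inputs s = G1 ++ (G ++ G2) ->
  exists r : cell a, inputs r = G /\ Cut G1 G2 r t = s.
Proof.
intros [t' [-> Ht]] HG e; destruct (cell_pack e) as [q ->].
destruct (Ht G HG q) as [r [Hr _]].
exists (pack r); split; [reflexivity|].
rewrite Cut_pack; f_equal; exact Hr.
Qed.
End Cells.

Section CellMorphism.
Context {X Y : rep_mb} (f : strong_morphism X Y).
Definition cmap {x y} {b : @mone X x y} (m : cell b) : cell (mm1 f _ _ b) :=
  pack (mm2 f (projT2 m)).

Lemma inputs_cmap {x y} {b : @mone X x y} (m : cell b) :
  inputs (cmap m) = pmap (mm1 f) (inputs m).
Proof. reflexivity. Qed.

Lemma cmap_Cut {x y z w} (G1 : mpath X x y) {a : mone y z} (G2 : mpath X z w)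
    {b : mone x w} (t : cell a) (s : cell b) :
  inputs s = G1 ++ a :: G2 ->
  cmap (Cut G1 G2 t s) = Cut (pmap (mm1 f) G1) (pmap (mm1 f) G2) (cmap t) (cmap s).
Proof.
intros e; destruct (cell_pack e) as [s' ->].
destruct t as [G t]; change (existT _ G t) with (pack t).
rewrite Cut_pack; unfold cmap; simpl.
rewrite <- (pack_mcast (pmap_app3 (mm1 f) G1 G G2)), (mm_morphism f t s').
rewrite <- Cut_pack; f_equal; apply pack_mcast.
Qed.
End CellMorphism.

Lemma inputs_pack {X : rep_mb} {x y} {P : mpath X x y} {b : mone x y}
  (p : mtwo P b) : inputs (pack p) = P.
Proof. reflexivity. Qed.

(** Computes input sequences through cuts, then normalizes both sides to right
nested concatenations.  When one side is an existential variable, it is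
instantiated with the normal form. *)
Ltac inputs_simpl :=
  repeat match goal with
  | H : inputs ?s = _ |- context [inputs ?s] => rewrite !H
  | H : forall y a, inputs _ = _ |- context [inputs _] => rewrite !H
  | |- context [inputs (pack ?p)] => rewrite !(inputs_pack p)
  | |- context [inputs (cmap ?f ?m)] => rewrite !(inputs_cmap f m)
  | |- context [inputs (Cut ?G1 ?G2 ?t ?s)] =>
      rewrite !(@inputs_Cut _ _ _ _ _ G1 _ G2 _ t s) by solve_inputs
  end
with solve_inputs :=
  intros; try solve [inputs_simpl;
  repeat (rewrite ?app_assoc, ?app_nil_r, ?pmap_app; cbn [app pmap]); reflexivity].

Section Tensor.
Context {X : rep_mb}.

(** [Cut_nest] with the position given only up to equality, as it is met after
simplification. *)
Lemma Cut_nest_at {x y z t u v} (G1 : mpath X x y) (D1 : mpath X y z)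
    {c : mone z t} (D2 : mpath X t u) {a : mone y u}
    (G2 : mpath X u v) {b : mone x v} H1 H2 (r : cell c) (q : cell a) (s : cell b) :
  inputs q = D1 ++ c :: D2 -> inputs s = G1 ++ a :: G2 ->
  H1 = G1 ++ D1 -> H2 = D2 ++ G2 ->
  Cut G1 G2 (Cut D1 D2 r q) s = Cut H1 H2 r (Cut G1 G2 q s).
Proof. intros Iq Is -> ->; now apply Cut_nest. Qed.

Lemma Cut_swap_at {x y z t u v} (G1 : mpath X x y)
      {a : mone y z} (G2 : mpath X z t)
      {c : mone t u} (G3 : mpath X u v) {b : mone x v} H1 H2 H3 H4
      (p : cell a) (q : cell c) (s : cell b) :
  inputs s = G1 ++ a :: (G2 ++ c :: G3) ->
  H1 = G1 ++ (inputs p ++ G2) -> H2 = G2 ++ c :: G3 ->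
  H3 = G2 ++ (inputs q ++ G3) -> H4 = G1 ++ a :: G2 ->
  Cut H1 G3 q (Cut G1 H2 p s) = Cut G1 H3 p (Cut H4 G3 q s).
Proof. intros Is -> -> -> ->; now apply Cut_swap. Qed.

Lemma universal_in_intro {x y z w} {G1 : mpath X x y} {a : mone y z}
    {G2 : mpath X z w} {b : mone x w} (t : cell b) :
  inputs t = G1 ++ a :: G2 ->
  (forall (G : mpath X y z) (s : cell b), nonempty G ->
     inputs s = G1 ++ (G ++ G2) ->
     exists r : cell a, inputs r = G /\ Cut G1 G2 r t = s) ->
  (forall r r' : cell a, inputs r = inputs r' ->
     Cut G1 G2 r t = Cut G1 G2 r' t -> r = r') ->
  universal_in G1 a G2 t.
Proof.
intros e E U; destruct (cell_pack e) as [t' ->]; exists t'; split; [reflexivity|].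
intros G HG s; destruct (E G (pack s) HG eq_refl) as [r [Hr H]].
destruct (cell_pack Hr) as [r' ->]; rewrite Cut_pack in H.
exists r'; split; [now apply pack_inj|].
intros q Hq; apply pack_inj, U; [reflexivity|].
rewrite !Cut_pack, H; f_equal; symmetry; exact Hq.
Qed.

Lemma Cut_vertical {x y} {a b c : @mone X x y} (u : cell a) (p : cell b)
    (q : cell c) : inputs p = [a] -> inputs q = [b] ->
  Cut nil nil (Cut nil nil u p) q = Cut nil nil u (Cut nil nil p q).
Proof.
intros Ip Iq; apply (Cut_nest (G1 := nil) (D1 := nil) (D2 := nil) (G2 := nil)); auto.
Qed.

(** Each cell factors through the other one, and by uniqueness the two factors are
inverse. *)
Lemma tensors_isomorphic {x y} {a b : @mone X x y} (s : cell a) (t : cell b) :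
  universal_out s -> universal_out t -> inputs s = inputs t ->
  exists (p : cell b) (q : cell a), inputs p = [a] /\ inputs q = [b] /\
    Cut nil nil s p = t /\ Cut nil nil t q = s /\
    Cut nil nil p q = pack (mid a) /\ Cut nil nil q p = pack (mid b).
Proof.
intros Hs Ht e.
assert (E : forall (c d : @mone X x y) (u : cell c) (v : cell d), universal_out u ->
  inputs u = inputs v -> exists p : cell d, inputs p = [c] /\ Cut nil nil u p = v).
{ intros c d u v Hu e'.
  apply (Cut_univ_out_ex (G1 := nil) (G2 := nil)); auto.
  simpl; rewrite app_nil_r; auto. }
assert (U : forall (c d : @mone X x y) (u : cell c) (v : cell d) (p : cell d)
  (q : cell c), universal_out u -> inputs p = [c] -> inputs q = [d] ->
  Cut nil nil u p = v -> Cut nil nil v q = u ->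
  Cut nil nil p q = pack (mid c)).
{ intros c d u v p q Hu Ip Iq H1 H2.
  apply (Cut_univ_out_inj (G1 := nil) (G2 := nil)) with u; [auto|solve_inputs|solve_inputs|].
  now rewrite mid_Cut, <- Cut_vertical, H1, H2. }
destruct (E _ _ s t Hs e) as [p [Ip Hp]], (E _ _ t s Ht (eq_sym e)) as [q [Iq Hq]].
exists p, q; repeat split; eauto.
Qed.

(** Tensor universality of [e] provides some tensor of [e] and [a] with this property,
and any other tensor differs from it by an invertible cell. *)
Lemma universal_tensor_in_l {x y z} {e : @mone X x y} {a : mone y z}
    {c : mone x z} (m : cell c) :
  tensor_universal e -> universal_out m -> inputs m = [e; a] ->
  universal_in [e] a nil m.
Proof.
intros [_ [He _]] Hm Im.
destruct (He _ a) as [v [s [Hs Us]]].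
assert (Us' : universal_in [e] a nil (pack s)) by (exists s; auto).
destruct (@tensors_isomorphic _ _ c v m (pack s)) as (p & q & Ip & Iq & Hp & Hq & Hpq & _); auto.
assert (C : forall r : cell a, Cut [e] nil r m
  = Cut nil nil (Cut [e] nil r (pack s)) q).
{ intros r; rewrite (Cut_nest (G1 := nil) (D1 := [e]) (D2 := nil) (G2 := nil));
    [now rewrite Hq| |]; solve_inputs. }
assert (C' : forall r : cell a, Cut [e] nil r (pack s)
  = Cut nil nil (Cut [e] nil r m) p).
{ intros r; rewrite (Cut_nest (G1 := nil) (D1 := [e]) (D2 := nil) (G2 := nil));
    [now rewrite Hp| |]; solve_inputs. }
apply universal_in_intro; [exact Im| |].
- intros G t HG It.
  destruct (@Cut_univ_in_ex X _ _ _ _ [e] a nil _ (pack s) G (Cut nil nil t p))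
    as [r [Ir Hr]]; auto; [solve_inputs|].
  exists r; split; [exact Ir|].
  now rewrite C, Hr, Cut_vertical, Hpq, mid_Cut.
- intros r r' e' H; apply (Cut_univ_in_inj Us' e').
  now rewrite !C', H.
Qed.

Lemma universal_tensor_in_r {x y z} {a : @mone X x y} {e : mone y z}
    {c : mone x z} (m : cell c) :
  tensor_universal e -> universal_out m -> inputs m = [a; e] ->
  universal_in nil a [e] m.
Proof.
intros He Hm Im; destruct (cell_pack Im) as [m' ->].
exists m'; split; [reflexivity|]; now apply tensor_univ_in.
Qed.
End Tensor.

(** * Existence of coherent choices *)

Section TensorUnit.
Context {X : rep_mb}.

Lemma universal_out_Cut {x y z w} {D1 : mpath X x y} {c : mone y z}
    {D2 : mpath X z w} {a : mone x w} (r : cell c) (t : cell a) :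
  inputs t = D1 ++ c :: D2 -> universal_out r -> universal_out t ->
  universal_out (Cut D1 D2 r t).
Proof.
intros It Hr Ht; apply universal_out_intro.
- intros x' y' G1 G2 b s Is; rewrite inputs_Cut in Is by auto.
  destruct (@Cut_univ_out_ex X _ _ _ _ (G1 ++ D1) c (D2 ++ G2) _ r s)
    as [s' [Is' Hs']]; [auto|solve_inputs|].
  destruct (@Cut_univ_out_ex X _ _ _ _ G1 a G2 _ t s') as [q [Iq Hq]];
    [auto|solve_inputs|].
  exists q; split; [exact Iq|]; rewrite Cut_nest by auto; congruence.
- intros x' y' G1 G2 b s s' Is Is'; rewrite !Cut_nest by auto; intros H.
  apply (Cut_univ_out_inj Ht Is Is').
  apply (Cut_univ_out_inj (G1 := G1 ++ D1) (G2 := D2 ++ G2) Hr); [solve_inputs|solve_inputs|auto].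
Qed.

(** If [r] and [r] cut into [t] are universal, so is [t].  With a corrected witness in
the role of [t], this is how it inherits universality. *)
Lemma universal_out_cancel {x y z w} {D1 : mpath X x y} {c : mone y z}
    {D2 : mpath X z w} {a : mone x w} (r : cell c) (t : cell a) :
  inputs t = D1 ++ c :: D2 -> universal_out r ->
  universal_out (Cut D1 D2 r t) -> universal_out t.
Proof.
intros It Hr Ht; apply universal_out_intro.
- intros x' y' G1 G2 b s Is.
  destruct (@Cut_univ_out_ex X _ _ _ _ G1 a G2 _ (Cut D1 D2 r t)
    (Cut (G1 ++ D1) (D2 ++ G2) r s)) as [q [Iq Hq]]; [auto|solve_inputs|].
  exists q; split; [exact Iq|]; rewrite Cut_nest in Hq by auto.
  apply (Cut_univ_out_inj (G1 := G1 ++ D1) (G2 := D2 ++ G2) Hr); [solve_inputs|solve_inputs|auto].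
- intros x' y' G1 G2 b s s' Is Is' H; apply (Cut_univ_out_inj Ht Is Is').
  rewrite !Cut_nest by auto; now f_equal.
Qed.

Context {x : mob X} {e : @mone X x x} (He : tensor_universal e).
Context {i : cell e} (Ii : inputs i = [e; e]) (Hi : universal_out i).

(** The correction of an arbitrary witness [m] by the multiplication [i] of the unit:
[m] cut into the second input of [l] is [i] cut into the first input of [m]. *)
Lemma unit_l_exists y (a : @mone X x y) (m : cell a) :
  inputs m = [e; a] -> universal_out m ->
  exists l : cell a, inputs l = [e; a] /\ Cut [e] nil m l = Cut nil [a] i m.
Proof.
intros Im Hm.
destruct (@Cut_univ_out_ex X _ _ _ _ [e] a nil _ m (Cut nil [a] i m)) as [l H].
- exact Hm.
- solve_inputs.
- exists l; exact H.
Qed.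

Lemma unit_r_exists y (a : @mone X y x) (n : cell a) :
  inputs n = [a; e] -> universal_out n ->
  exists r : cell a, inputs r = [a; e] /\ Cut nil [e] n r = Cut [a] nil i n.
Proof.
intros In Hn.
destruct (@Cut_univ_out_ex X _ _ _ _ nil a [e] _ n (Cut [a] nil i n)) as [l H].
- exact Hn.
- solve_inputs.
- exists l; exact H.
Qed.

Section Left.
Context {m l : forall y (a : @mone X x y), cell a}.
Context (Im : forall y (a : @mone X x y), inputs (m a) = [e; a]).
Context (Hm : forall y (a : @mone X x y), universal_out (m a)).
Context (Il : forall y (a : @mone X x y), inputs (l a) = [e; a]).
Context (Hl : forall y (a : @mone X x y), Cut [e] nil (m a) (l a) = Cut nil [a] i (m a)).

Lemma unit_l_out y (a : @mone X x y) : universal_out (l a).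
Proof.
apply (universal_out_cancel (D1 := [e]) (D2 := nil)) with (m a); [solve_inputs|auto|].
rewrite Hl; apply universal_out_Cut; [solve_inputs|auto|auto].
Qed.

Lemma unit_l_in y (a : @mone X x y) : universal_in [e] a nil (l a).
Proof. apply universal_tensor_in_l; [auto|apply unit_l_out|auto]. Qed.

(** Both sides are compared after cutting [m a] into [a].  As [m b] is universal
at its second input, [p] with [m a] cut into it is some [q] cut into that input of
[m b].  After [m b], the cell [l b] acts by definition as [i]. *)
Lemma unit_l_coh y z (a : @mone X x y) (G : mpath X y z) (b : @mone X x z)
    (p : cell b) : inputs p = a :: G ->
  Cut [e] nil p (l b) = Cut nil G (l a) p.
Proof.
intros Ip.
apply (Cut_univ_out_inj (G1 := [e]) (G2 := G)) with (m a); [auto|solve_inputs|solve_inputs|].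
assert (Hmb : universal_in [e] b nil (m b))
  by (apply universal_tensor_in_l; auto).
destruct (@Cut_univ_in_ex X _ _ _ _ [e] b nil _ (m b) (a :: G) (Cut nil G (m a) p))
  as [q [Iq Hq]]; [auto|exact I|solve_inputs|].
rewrite <- (Cut_nest_at (D1 := nil) (D2 := G)) by solve_inputs.
rewrite <- Hq; erewrite (Cut_nest_at (D1 := [e]) (D2 := nil)) by solve_inputs.
rewrite Hl; erewrite (Cut_swap_at (G2 := nil)) by solve_inputs.
rewrite Hq; erewrite <- (Cut_nest_at (D1 := nil) (D2 := [a])) by solve_inputs.
rewrite <- Hl; erewrite (Cut_nest_at (D1 := [e]) (D2 := nil)) by solve_inputs.
reflexivity.
Qed.

(** Coherence of [l] for the cell [m e] compares [l e] and [i], both cut into the first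
input of [m e], where [m e] is universal. *)
Lemma unit_l_unit : l e = i.
Proof.
apply (@Cut_univ_in_inj X _ _ _ _ nil e [e] _ (m e)).
- apply universal_tensor_in_r; auto.
- solve_inputs.
- rewrite <- unit_l_coh by auto; apply Hl.
Qed.

End Left.

Section Right.
Context {n r : forall y (a : @mone X y x), cell a}.
Context (In : forall y (a : @mone X y x), inputs (n a) = [a; e]).
Context (Hn : forall y (a : @mone X y x), universal_out (n a)).
Context (Ir : forall y (a : @mone X y x), inputs (r a) = [a; e]).
Context (Hr : forall y (a : @mone X y x), Cut nil [e] (n a) (r a) = Cut [a] nil i (n a)).

Lemma unit_r_out y (a : @mone X y x) : universal_out (r a).
Proof.
apply (universal_out_cancel (D1 := nil) (D2 := [e])) with (n a); [solve_inputs|auto|].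
rewrite Hr; apply universal_out_Cut; [solve_inputs|auto|auto].
Qed.

Lemma unit_r_in y (a : @mone X y x) : universal_in nil a [e] (r a).
Proof. apply universal_tensor_in_r; [auto|apply unit_r_out|auto]. Qed.

Lemma nonempty_rcons {y z} (G : mpath X y z) {w} (a : mone z w) : nonempty (G ++ [a]).
Proof. now destruct G. Qed.

Lemma unit_r_coh y z (G : mpath X y z) (a : @mone X z x) (b : @mone X y x)
    (p : cell b) : inputs p = G ++ [a] ->
  Cut nil [e] p (r b) = Cut G nil (r a) p.
Proof.
intros Ip.
apply (Cut_univ_out_inj (G1 := G) (G2 := [e])) with (n a); [auto|solve_inputs|solve_inputs|].
assert (Hmb : universal_in nil b [e] (n b))
  by (apply universal_tensor_in_r; auto).
destruct (@Cut_univ_in_ex X _ _ _ _ nil b [e] _ (n b) (G ++ [a]) (Cut G nil (n a) p))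
  as [q [Iq Hq]]; [auto|apply nonempty_rcons|solve_inputs|].
rewrite <- (Cut_nest_at (D1 := G) (D2 := nil)) by solve_inputs.
rewrite <- Hq; erewrite (Cut_nest_at (D1 := nil) (D2 := [e])) by solve_inputs.
rewrite Hr; erewrite <- (Cut_swap_at (G1 := nil) (G2 := nil)) by solve_inputs.
rewrite Hq; erewrite <- (Cut_nest_at (D1 := [a]) (D2 := nil)) by solve_inputs.
rewrite <- Hr; erewrite (Cut_nest_at (D1 := nil) (D2 := [e])) by solve_inputs.
reflexivity.
Qed.

Lemma unit_r_unit : r e = i.
Proof.
apply (@Cut_univ_in_inj X _ _ _ _ [e] e nil _ (n e)).
- apply universal_tensor_in_l; auto.
- solve_inputs.
- rewrite <- (unit_r_coh (G := [e])) by auto; apply Hr.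
Qed.
End Right.
End TensorUnit.

Section Middle.
Context {X : rep_mb} {x : mob X} {e : @mone X x x}.
Context {y z : mob X} {a : @mone X y x} {b : @mone X x z}.
Context {i : cell e} {l : cell b} {n r : cell a}.
Context (Il : inputs l = [e; b]).
Context (In : inputs n = [a; e]) (Ir : inputs r = [a; e]).
Context (Hn : universal_out n) (Hlo : universal_out l).
Context (Hr : Cut nil [e] n r = Cut [a] nil i n).
Context (Hl : Cut [e] nil l l = Cut nil [b] i l).

(** After cutting [n] into [a], the right-hand side becomes [i] cut next to [n].  What
is left is an identity about [i] and [l] only, since [q] with [n] cut into it
factors through the universal cell [l]. *)
Lemma unit_coh_middle y' z' (G1 : mpath X y' y) (G2 : mpath X z z') (c : @mone X y' z')
    (q : cell c) : inputs q = G1 ++ a :: b :: G2 ->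
  Cut (G1 ++ [a]) G2 l q = Cut G1 (b :: G2) r q.
Proof.
intros Iq.
(* After [n], the cell [r] acts on [a] as [i] acts on the unit. *)
apply (Cut_univ_out_inj (G1 := G1) (G2 := e :: b :: G2)) with n; [auto|solve_inputs|solve_inputs|].
erewrite <- (Cut_nest_at (D1 := nil) (D2 := [e])) by solve_inputs.
rewrite Hr; erewrite (Cut_nest_at (D1 := [a]) (D2 := nil)) by solve_inputs.
erewrite <- (Cut_swap_at (G2 := nil)) by solve_inputs.
destruct (@Cut_univ_out_ex X _ _ _ _ (G1 ++ [a]) b G2 _ l (Cut G1 (b :: G2) n q))
  as [q' [Iq' Hq']]; [auto|solve_inputs|].
rewrite <- Hq'.
erewrite <- !Cut_nest_at with (D1 := [e]) (D2 := nil) by solve_inputs.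
rewrite Hl; erewrite Cut_nest_at with (D1 := nil) (D2 := [b]) by solve_inputs.
reflexivity.
Qed.
End Middle.

Lemma pack_cut {X : rep_mb} {x y z w} (G1 : mpath X x y) {a : mone y z} (G2 : mpath X z w)
    {b : mone x w} {G} (t : mtwo G a) (s : mtwo (G1 ++ a :: G2) b) :
  pack (cut G1 G2 t s) = Cut G1 G2 (pack t) (pack s).
Proof. symmetry; apply Cut_pack. Qed.

(** Turns packed cuts into cuts of packed cells and drops casts.  The intermediate
[change] restores the syntactic form of the boundary expected by [pack_cut]. *)
Ltac push_pack :=
  repeat match goal with
  | |- context [@pack ?X ?x ?y ?P ?b (@cut ?X' ?x' ?y' ?z' ?w' ?G1 ?G ?a ?G2 ?b' ?t ?s)] =>
      change (@pack X x y P b (@cut X' x' y' z' w' G1 G a G2 b' t s))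
        with (@pack X x y (G1 ++ (G ++ G2)) b (@cut X' x' y' z' w' G1 G a G2 b' t s));
      rewrite (@pack_cut X x' y' z' w' G1 a G2 b' G t s)
  | |- context [@pack ?X ?x ?y ?P ?b (@mcast ?X' ?x' ?y' ?Q ?Q' ?b' ?e ?s)] =>
      change (@pack X x y P b (@mcast X' x' y' Q Q' b' e s))
        with (@pack X x y Q' b (@mcast X' x' y' Q Q' b' e s));
      rewrite (@pack_mcast X x' y' Q Q' b' e s)
  end; cbn [app].

Lemma universal_in_pack {X : rep_mb} {x y z w} {G1 : mpath X x y} {a : mone y z}
    {G2 : mpath X z w} {b : mone x w} (t : mtwo (G1 ++ a :: G2) b) :
  universal_in G1 a G2 (pack t) -> univ_in G1 a G2 t.
Proof. intros [t' [e H]]; apply pack_inj in e; now subst. Qed.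

Lemma tensor_unit_tensor_universal {X : mb_data} {x} (e : @mone X x x) :
  is_tensor_unit e -> tensor_universal e.
Proof.
intros [Hl Hr]; split; [|split; [|split]]; intros y a; exists a; auto.
Qed.

Lemma choose_family (A : Type) (B : A -> Type) (R : forall a, B a -> Prop) :
  (forall a, exists b, R a b) -> exists f : forall a, B a, forall a, R a (f a).
Proof.
intros H; exists (fun a => proj1_sig (constructive_indefinite_description _ (H a))).
intros a; apply proj2_sig.
Qed.

Lemma choose_family2 (A : Type) (A' : A -> Type) (B : forall a, A' a -> Type)
    (R : forall a a', B a a' -> Prop) :
  (forall a a', exists b, R a a' b) ->
  exists f : forall a a', B a a', forall a a', R a a' (f a a').
Proof.
intros H; apply (choose_family (R := fun a (f : forall a', B a a') => forall a', R a a' (f a'))).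
intros a; apply choose_family, H.
Qed.

(** The part of a coherent choice that concerns a single 0-cell; the coherence
conditions never involve two different units. *)
Record coherent_unit {X : rep_mb} (x : mob X) := CoherentUnit {
  cu_one : @mone X x x;
  cu_l : forall y (a : @mone X x y), mtwo [cu_one; a] a;
  cu_r : forall y (a : @mone X y x), mtwo [a; cu_one] a;
  cu_l_witness : forall y (a : @mone X x y), lunit_witness (cu_l a);
  cu_r_witness : forall y (a : @mone X y x), runit_witness (cu_r a);
  cu_coh_l : forall y z (a : @mone X x y) (G : mpath X y z) (b : @mone X x z)
      (p : mtwo (a :: G) b),
    Cut [cu_one] nil (pack p) (pack (cu_l b)) = Cut nil G (pack (cu_l a)) (pack p);
  cu_coh_r : forall y z (G : mpath X y z) (a : @mone X z x) (b : @mone X y x)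
      (p : mtwo (G ++ [a]) b),
    Cut nil [cu_one] (pack p) (pack (cu_r b)) = Cut G nil (pack (cu_r a)) (pack p);
  cu_coh_m : forall y z y' z' (G1 : mpath X y' y) (a : @mone X y x)
      (b : @mone X x z) (G2 : mpath X z z') (c : @mone X y' z')
      (q : mtwo (G1 ++ a :: b :: G2) c),
    Cut (G1 ++ [a]) G2 (pack (cu_l b)) (pack q) = Cut G1 (b :: G2) (pack (cu_r a)) (pack q);
  cu_coh_unit : cu_l cu_one = cu_r cu_one }.

(** Start from any witnesses [m] and [n] of a tensor unit [e], and take [m e] as the
multiplication [i] of [e] to correct both families.  Both corrections agree with [i]
at [e], which gives the condition on [cu_l cu_one] and [cu_r cu_one]. *)
Lemma coherent_unit_exists {X : rep_mb} (x : mob X) : inhabited (coherent_unit x).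
Proof.
destruct (has_tensor_unit (rep_mb_rep X) x) as [e He].
destruct (choose_family2 (proj1 He)) as [m Hm].
destruct (choose_family2 (proj2 He)) as [n Hn].
pose proof (tensor_unit_tensor_universal He) as Hu; clear He.
pose (M := fun y a => pack (m y a)); pose (N := fun y a => pack (n y a)).
assert (Mo : forall y a, universal_out (M y a)) by (intros; apply Hm).
assert (No : forall y a, universal_out (N y a)) by (intros; apply Hn).
assert (Im : forall y a, inputs (M y a) = [e; a]) by reflexivity.
assert (In : forall y a, inputs (N y a) = [a; e]) by reflexivity.
set (i := M x e); pose proof (Mo _ e : universal_out i) as Hi.
assert (Ii : inputs i = [e; e]) by reflexivity.
assert (EL : forall y (a : @mone X x y), exists l : mtwo [e; a] a,
  Cut [e] nil (M y a) (pack l) = Cut nil [a] i (M y a)).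
{ intros y a.
  destruct (unit_l_exists Ii (Im y a) (Mo y a)) as [l [Il Hl]].
  destruct (cell_pack Il) as [l' ->]; eauto. }
assert (ER : forall y (a : @mone X y x), exists r : mtwo [a; e] a,
  Cut nil [e] (N y a) (pack r) = Cut [a] nil i (N y a)).
{ intros y a.
  destruct (unit_r_exists Ii (In y a) (No y a)) as [l [Il Hl]].
  destruct (cell_pack Il) as [l' ->]; eauto. }
destruct (choose_family2 EL) as [l Hl], (choose_family2 ER) as [r Hr].
pose (L := fun y a => pack (l y a)); pose (R := fun y a => pack (r y a)).
change (forall y a, Cut [e] nil (M y a) (L y a) = Cut nil [a] i (M y a)) in Hl.
change (forall y a, Cut nil [e] (N y a) (R y a) = Cut [a] nil i (N y a)) in Hr.
assert (Il : forall y a, inputs (L y a) = [e; a]) by reflexivity.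
assert (Ir : forall y a, inputs (R y a) = [a; e]) by reflexivity.
constructor.
refine (@CoherentUnit X x e l r _ _ _ _ _ _).
- intros y a; split; [apply (unit_l_out Hi Im Mo Il Hl)|].
  apply universal_in_pack, (unit_l_in Hu Hi Im Mo Il Hl).
- intros y a; split; [apply (unit_r_out Hi In No Ir Hr)|].
  apply universal_in_pack, (unit_r_in Hu Hi In No Ir Hr).
- intros; now apply (unit_l_coh Hu Ii Im Mo Il Hl).
- intros; now apply (unit_r_coh Hu Ii In No Ir Hr).
- intros; apply (unit_coh_middle (i := i) (n := N _ a)); auto.
  + apply (unit_l_out Hi Im Mo Il Hl).
  + change (Cut [e] nil (L _ b) (L _ b) = Cut nil [b] i (L _ b)).
    rewrite (unit_l_coh Hu Ii Im Mo Il Hl (a := e) (G := [b])) by auto.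
    now rewrite (unit_l_unit Hu Ii Im Mo Il Hl).
- apply pack_inj; transitivity i; [|symmetry].
  + apply (unit_l_unit Hu Ii Im Mo Il Hl).
  + apply (unit_r_unit Hu Ii In No Ir Hr).
Qed.

Lemma coherent_choice_exists (X : rep_mb) : inhabited (coherent_choice X).
Proof.
pose (u := fun x : mob X => proj1_sig (constructive_indefinite_description
  (fun _ : coherent_unit x => True)
  (match coherent_unit_exists x with inhabits h => ex_intro _ h I end))).
pose (t := fun x y z (a : @mone X x y) (b : @mone X y z) =>
  constructive_indefinite_description _ (has_tensor (rep_mb_rep X) a b)).
pose (t' := fun x y z (a : @mone X x y) (b : @mone X y z) =>
  constructive_indefinite_description _ (proj2_sig (t x y z a b))).
constructor.
refine (@CoherentChoice X (fun x y z a b => proj1_sig (t x y z a b))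
  (fun x y z a b => proj1_sig (t' x y z a b))
  (fun x y z a b => proj2_sig (t' x y z a b))
  (fun x => cu_one (u x)) (fun x y => @cu_l _ _ (u x) y)
  (fun x y => @cu_r _ _ (u y) x)
  (fun x y => @cu_l_witness _ _ (u x) y)
  (fun x y => @cu_r_witness _ _ (u y) x) _ _ _ (fun x => cu_coh_unit (u x))).
- intros; apply pack_inj; push_pack; apply cu_coh_l.
- intros; apply pack_inj; push_pack; apply cu_coh_r.
- intros; apply pack_inj; push_pack; apply cu_coh_m.
Qed.

(** * The bicategory of 2-cells with one input *)

Section GBicategory.
Context {X : rep_mb} (c : coherent_choice X).
Local Notation "a ⊠ b" := (ch_tens c a b) (at level 40, left associativity).
Local Notation τ a b := (pack (ch_t c a b)).
Local Notation e := (ch_unit c _).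

Lemma tensor_out {x y z} (a : @mone X x y) (b : @mone X y z) :
  universal_out (τ a b).
Proof. exact (ch_t_tensor c a b). Qed.

Lemma tens2_spec {x y z} {a a' : @mone X x y} {b b' : @mone X y z}
    (p : mtwo [a] a') (q : mtwo [b] b') :
  Cut nil nil (τ a b) (pack (G_tens2 c p q))
  = Cut [a] nil (pack q) (Cut nil [b'] (pack p) (τ a' b')).
Proof.
pose proof (the_spec (ch_t_tensor c a b _ _ nil nil _ (cut [a] nil q (cut nil [b'] p (ch_t c a' b'))))) as H.
apply (f_equal pack) in H; revert H; push_pack; auto.
Qed.

Lemma assoc_spec {x y z w} (a : @mone X x y) (b : @mone X y z) (d : @mone X z w) :
  Cut nil [d] (τ a b) (Cut nil nil (τ (a ⊠ b) d) (pack (G_assoc c a b d)))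
  = Cut [a] nil (τ b d) (τ a (b ⊠ d)).
Proof.
pose proof (the_spec (tensor_tensor_out (cut [a] nil (ch_t c b d) (ch_t c a (b ⊠ d)))
      (ch_t_tensor c a b) (ch_t_tensor c (a ⊠ b) d))) as H.
apply (f_equal pack) in H; revert H; push_pack; intros H; etransitivity; [|exact H].
erewrite Cut_nest_at with (D1 := nil) (D2 := [d]) by solve_inputs; reflexivity.
Qed.

Lemma lunit_spec {x y} (a : @mone X x y) :
  Cut nil nil (τ e a) (pack (G_lunit c a)) = pack (ch_l c a).
Proof.
pose proof (the_spec (ch_t_tensor c (ch_unit c x) a _ _ nil nil _ (ch_l c a))) as H.
apply (f_equal pack) in H; revert H; push_pack; auto.
Qed.

Lemma runit_spec {x y} (a : @mone X x y) :
  Cut nil nil (τ a e) (pack (G_runit c a)) = pack (ch_r c a).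
Proof.
pose proof (the_spec (ch_t_tensor c a (ch_unit c y) _ _ nil nil _ (ch_r c a))) as H.
apply (f_equal pack) in H; revert H; push_pack; auto.
Qed.

(** The equations characterizing the structure cells of [G X], used inside a larger
composite: [s] stands for whatever follows. *)
Lemma tens2_spec_in {x y z x' y'} {a a' : @mone X x y} {b b' : @mone X y z}
    (p : mtwo [a] a') (q : mtwo [b] b') (G1 : mpath X x' x) (G2 : mpath X z y')
    {d : @mone X x' y'} (s : cell d) : inputs s = G1 ++ (a' ⊠ b') :: G2 ->
  Cut G1 G2 (τ a b) (Cut G1 G2 (pack (G_tens2 c p q)) s)
  = Cut (G1 ++ [a]) G2 (pack q) (Cut G1 (b' :: G2) (pack p) (Cut G1 G2 (τ a' b') s)).
Proof.
intros Is; erewrite <- Cut_nest_at with (D1 := nil) (D2 := nil) by solve_inputs.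
rewrite tens2_spec; erewrite !Cut_nest_at with (D1 := [a]) (D2 := nil) by solve_inputs.
now erewrite Cut_nest_at with (D1 := nil) (D2 := [b']) by solve_inputs.
Qed.

Lemma assoc_spec_in {x y z w x' y'} (a : @mone X x y) (b : @mone X y z) (d : @mone X z w)
    (G1 : mpath X x' x) (G2 : mpath X w y')
    {k : @mone X x' y'} (s : cell k) : inputs s = G1 ++ (a ⊠ (b ⊠ d)) :: G2 ->
  Cut G1 (d :: G2) (τ a b) (Cut G1 G2 (τ (a ⊠ b) d) (Cut G1 G2 (pack (G_assoc c a b d)) s))
  = Cut (G1 ++ [a]) G2 (τ b d) (Cut G1 G2 (τ a (b ⊠ d)) s).
Proof.
intros Is; erewrite <- (Cut_nest_at (D1 := nil) (D2 := nil) _ (s := s)) by solve_inputs.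
erewrite <- Cut_nest_at with (D1 := nil) (D2 := [d]) by solve_inputs.
rewrite assoc_spec; now erewrite Cut_nest_at with (D1 := [a]) (D2 := nil) by solve_inputs.
Qed.

Lemma lunit_spec_in {x y x' y'} (a : @mone X x y) (G1 : mpath X x' x) (G2 : mpath X y y')
    {k : @mone X x' y'} (s : cell k) : inputs s = G1 ++ a :: G2 ->
  Cut G1 G2 (τ e a) (Cut G1 G2 (pack (G_lunit c a)) s) = Cut G1 G2 (pack (ch_l c a)) s.
Proof.
intros Is; erewrite <- Cut_nest_at with (D1 := nil) (D2 := nil) by solve_inputs.
now rewrite lunit_spec.
Qed.

Lemma runit_spec_in {x y x' y'} (a : @mone X x y) (G1 : mpath X x' x) (G2 : mpath X y y')
    {k : @mone X x' y'} (s : cell k) : inputs s = G1 ++ a :: G2 ->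
  Cut G1 G2 (τ a e) (Cut G1 G2 (pack (G_runit c a)) s) = Cut G1 G2 (pack (ch_r c a)) s.
Proof.
intros Is; erewrite <- Cut_nest_at with (D1 := nil) (D2 := nil) by solve_inputs.
now rewrite runit_spec.
Qed.

(** Cells out of an iterated tensor are compared after cutting the universal tensor
cells into them. *)
Lemma tensor_ext {x y z} {a : @mone X x y} {b : @mone X y z} {k : @mone X x z}
    (p q : mtwo [a ⊠ b] k) :
  Cut nil nil (τ a b) (pack p) = Cut nil nil (τ a b) (pack q) -> p = q.
Proof.
intros H; apply pack_inj.
now apply (Cut_univ_out_inj (G1 := nil) (G2 := nil)) with (τ a b); [apply tensor_out| | |].
Qed.

Lemma tensor_ext3 {x y z w} {a : @mone X x y} {b : @mone X y z} {d : @mone X z w} {k : @mone X x w}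
    (p q : mtwo [a ⊠ b ⊠ d] k) :
  Cut nil [d] (τ a b) (Cut nil nil (τ (a ⊠ b) d) (pack p))
  = Cut nil [d] (τ a b) (Cut nil nil (τ (a ⊠ b) d) (pack q)) -> p = q.
Proof.
intros H; apply tensor_ext.
apply (Cut_univ_out_inj (G1 := nil) (G2 := [d])) with (τ a b); auto; [apply tensor_out|solve_inputs|solve_inputs].
Qed.

Lemma tensor_ext4 {x y z w v} {a : @mone X x y} {b : @mone X y z} {d : @mone X z w}
    {h : @mone X w v} {k : @mone X x v}
    (p q : mtwo [a ⊠ b ⊠ d ⊠ h] k) :
  Cut nil [d; h] (τ a b) (Cut nil [h] (τ (a ⊠ b) d) (Cut nil nil (τ (a ⊠ b ⊠ d) h) (pack p)))
  = Cut nil [d; h] (τ a b) (Cut nil [h] (τ (a ⊠ b) d) (Cut nil nil (τ (a ⊠ b ⊠ d) h) (pack q))) ->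
  p = q.
Proof.
intros H; apply tensor_ext3.
apply (Cut_univ_out_inj (G1 := nil) (G2 := [d; h])) with (τ a b); auto; [apply tensor_out|solve_inputs|solve_inputs].
Qed.

(** A cell comparing two universal cells with the same inputs is invertible. *)
Lemma invertible_between {x y} {a b : @mone X x y} {s : cell a} {t : cell b} (p : mtwo [a] b) :
  universal_out s -> universal_out t -> inputs s = inputs t -> Cut nil nil s (pack p) = t ->
  exists q : mtwo [b] a, cut nil nil p q = mid a /\ cut nil nil q p = mid b.
Proof.
intros Hs Ht I E; destruct (tensors_isomorphic Hs Ht I) as (p' & q & Ip & Iq & H1 & H2 & H3 & H4).
assert (p' = pack p) as ->.
{ apply (Cut_univ_out_inj (G1 := nil) (G2 := nil)) with s; auto; congruence. }
destruct (cell_pack Iq) as [q' ->]; exists q'.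
split; apply pack_inj; push_pack; auto.
Qed.

Lemma vertical_assoc {x y} {a b k l : @mone X x y} (p : mtwo [a] b) (q : mtwo [b] k) (r : mtwo [k] l) :
  cut nil nil (cut nil nil p q) r = cut nil nil p (cut nil nil q r).
Proof. apply pack_inj; push_pack; now apply Cut_vertical. Qed.

Lemma choice_coh_l {x y z} (a : @mone X x y) (G : mpath X y z) (b : @mone X x z)
    (p : cell b) : inputs p = a :: G ->
  Cut [e] nil p (pack (ch_l c b)) = Cut nil G (pack (ch_l c a)) p.
Proof.
intros Ip; destruct (cell_pack Ip) as [q ->].
pose proof (ch_coh_l c q) as H; apply (f_equal pack) in H; revert H; push_pack; auto.
Qed.

Lemma choice_coh_r {x y z} (G : mpath X x y) (a : @mone X y z) (b : @mone X x z)
    (p : cell b) : inputs p = G ++ [a] ->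
  Cut nil [e] p (pack (ch_r c b)) = Cut G nil (pack (ch_r c a)) p.
Proof.
intros Ip; destruct (cell_pack Ip) as [q ->].
pose proof (ch_coh_r c q) as H; apply (f_equal pack) in H; revert H; push_pack; auto.
Qed.

Lemma choice_coh_m {x y z w v} (G1 : mpath X x y) (a : @mone X y z)
      (b : @mone X z w) (G2 : mpath X w v) (k : @mone X x v)
    (q : cell k) : inputs q = G1 ++ a :: b :: G2 ->
  Cut (G1 ++ [a]) G2 (pack (ch_l c b)) q = Cut G1 (b :: G2) (pack (ch_r c a)) q.
Proof.
intros Ip; destruct (cell_pack Ip) as [r ->].
pose proof (ch_coh_m c r) as H; apply (f_equal pack) in H; revert H; push_pack; auto.
Qed.

(** Every axiom is checked after composition with the universal tensor cells of its
source, where both sides reduce to the same composite of tensor cells. *)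
Lemma G_bicategory : is_bicategory (G_data c).
Proof.
constructor; simpl; intros.
- apply pack_inj; push_pack; now apply Cut_mid.
- apply pack_inj; push_pack; apply mid_Cut.
- apply vertical_assoc.
- apply tensor_ext; rewrite tens2_spec, mid_Cut.
  now rewrite !Cut_mid by solve_inputs.
- apply tensor_ext; rewrite tens2_spec; push_pack.
  rewrite tens2_spec_in, tens2_spec by solve_inputs; cbn [app].
  erewrite !Cut_nest_at with (D1 := nil) (D2 := nil) by solve_inputs; cbn [app].
  now erewrite <- (Cut_swap_at (G1 := nil) (G2 := nil)) by solve_inputs.
- apply tensor_ext3; push_pack.
  rewrite tens2_spec_in, assoc_spec_in, tens2_spec by solve_inputs; cbn [app].
  erewrite (Cut_swap_at (G1 := nil) (G2 := nil)) by solve_inputs.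
  rewrite !tens2_spec_in by solve_inputs; cbn [app].
  erewrite <- (Cut_swap_at (G1 := nil) (G2 := nil) (p := τ a' b')) by solve_inputs.
  rewrite assoc_spec by solve_inputs.
  erewrite (Cut_swap_at (G1 := nil) (G2 := nil) (p := pack p) (q := τ b' c')) by solve_inputs.
  erewrite (Cut_swap_at (G1 := [a]) (G2 := nil)) by solve_inputs.
  now erewrite (Cut_swap_at (G1 := nil) (G2 := [b'])) by solve_inputs.
- apply tensor_ext; push_pack.
  rewrite tens2_spec_in, lunit_spec, lunit_spec_in, Cut_mid by solve_inputs.
  now apply choice_coh_l.
- apply tensor_ext; push_pack.
  rewrite tens2_spec_in, runit_spec, runit_spec_in, Cut_mid by solve_inputs.
  now apply (choice_coh_r (G := nil)).
- apply (invertible_between (s := Cut nil [c0] (τ a b) (τ (a ⊠ b) c0))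
    (t := Cut [a] nil (τ b c0) (τ a (b ⊠ c0)))); [| |solve_inputs|].
  1, 2: apply universal_out_Cut; [solve_inputs|apply tensor_out|apply tensor_out].
  rewrite <- assoc_spec; now erewrite Cut_nest_at with (D1 := nil) (D2 := [c0]) by solve_inputs.
- apply (invertible_between (s := τ e a) (t := pack (ch_l c a))).
  + apply tensor_out.
  + apply ch_l_witness.
  + solve_inputs.
  + apply lunit_spec.
- apply (invertible_between (s := τ a e) (t := pack (ch_r c a))).
  + apply tensor_out.
  + apply ch_r_witness.
  + solve_inputs.
  + apply runit_spec.
- (* Both bracketings become [τ c0 d], then [τ b (c0 ⊠ d)], then [τ a (b ⊠ (c0 ⊠ d))]. *)
  apply tensor_ext4; push_pack.
  erewrite (Cut_nest_at (D1 := nil) (D2 := nil)) by solve_inputs.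
  rewrite tens2_spec_in, Cut_mid by solve_inputs; cbn [app].
  rewrite !assoc_spec_in by solve_inputs; cbn [app].
  rewrite tens2_spec, Cut_mid by solve_inputs.
  rewrite assoc_spec_in by solve_inputs; cbn [app].
  erewrite <- (Cut_swap_at (G1 := nil) (G2 := nil)) by solve_inputs.
  now rewrite assoc_spec.
- apply tensor_ext3; push_pack.
  rewrite assoc_spec_in, tens2_spec by solve_inputs; cbn [app].
  rewrite tens2_spec, Cut_mid by solve_inputs; cbn [app].
  erewrite <- Cut_nest_at with (D1 := nil) (D2 := nil) by solve_inputs.
  rewrite lunit_spec, Cut_mid by solve_inputs.
  erewrite <- (Cut_nest_at (D1 := nil) (D2 := nil) (c := a ⊠ ch_unit c y)) by solve_inputs.
  rewrite runit_spec; now apply (choice_coh_m (G1 := nil)).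
Qed.
End GBicategory.

(** * Tensor strong morphisms induce pseudofunctors *)

Ltac fold_cmap := repeat match goal with
  | |- context [@pack ?Y ?x ?y ?P ?b (@mm2 ?X ?Y' (mmdata ?f) ?x' ?y' ?G ?a ?p)] =>
    change (@pack Y x y P b (@mm2 X Y' (mmdata f) x' y' G a p))
      with (@cmap _ Y f x' y' a (@pack _ x' y' G a p))
  end.

(** Applies the morphism [f] to an equation of cells. *)
Ltac map_eq f E :=
  let H := fresh "H" in
  pose proof (f_equal (cmap f) E) as H; rewrite !cmap_Cut in H by solve_inputs;
  cbn [pmap app] in H.

Lemma unit_unique {X : rep_mb} {x y} {a : @mone X x y} (i : mtwo [a] a) :
  is_unit i -> i = mid a.
Proof.
intros Hi; apply pack_inj; rewrite <- (mid_Cut (pack i)).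
etransitivity; [exact (Cut_pack (G1 := nil) (G2 := nil) i (mid a))|].
f_equal; exact (proj2 Hi _ _ nil nil _ (mid a)).
Qed.

Section GMor.
Context {X Y : rep_mb} (c : coherent_choice X) (d : coherent_choice Y).
Context (f : strong_morphism X Y).
Local Notation f1 := (mm1 f _ _).
Local Notation F := (cmap f).

Lemma universal_out_cmap_tensor {x y z} (a : @mone X x y) (b : @mone X y z) k (t : mtwo [a; b] k) :
  univ_out t -> universal_out (F (pack t)).
Proof. exact (@ts_tensor _ _ _ (mm_strong f) _ _ _ _ _ _ t). Qed.

Lemma mor_tens_spec {x y z} (a : @mone X x y) (b : @mone X y z) :
  Cut nil nil (pack (ch_t d (f1 a) (f1 b))) (pack (G_mor_tens c d f a b))
  = F (pack (ch_t c a b)).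
Proof.
pose proof (the_spec (ch_t_tensor d (f1 a) (f1 b) _ _ nil nil _ (mm2 f (ch_t c a b)))) as H.
apply (f_equal pack) in H; revert H; push_pack; auto.
Qed.

Lemma mor_tens_spec_in {x y z x' y'} (a : @mone X x y) (b : @mone X y z)
    (G1 : mpath Y x' (mm0 f x)) (G2 : mpath Y (mm0 f z) y') {k : @mone Y x' y'} (s : cell k) :
  inputs s = G1 ++ f1 (ch_tens c a b) :: G2 ->
  Cut G1 G2 (pack (ch_t d (f1 a) (f1 b))) (Cut G1 G2 (pack (G_mor_tens c d f a b)) s)
  = Cut G1 G2 (F (pack (ch_t c a b))) s.
Proof.
intros Is; erewrite <- Cut_nest_at with (D1 := nil) (D2 := nil) by solve_inputs.
now rewrite mor_tens_spec.
Qed.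

Lemma mor_unit_spec x :
  Cut nil [f1 (ch_unit c x)] (pack (G_mor_unit c d f x)) (F (pack (ch_l c (ch_unit c x))))
  = pack (ch_l d (f1 (ch_unit c x))).
Proof.
pose proof (the_spec (@mm2_l_unit_univ X Y c f x [ch_unit d (mm0 f x)] I
      (ch_l d (f1 (ch_unit c x))))) as H.
apply (f_equal pack) in H; revert H; push_pack; auto.
Qed.

(** The unit comparison is defined by this property at the unit itself.  For general [a]
the two cells are compared after cutting the image of [ch_l c a], a universal cell,
into their second input: by coherence in [X] and in [Y] both become the comparison
followed by two images of left unit cells. *)
Lemma mor_unit_l {x y} (a : @mone X x y) :
  Cut nil [f1 a] (pack (G_mor_unit c d f x)) (F (pack (ch_l c a)))
  = pack (ch_l d (f1 a)).
Proof.
apply (Cut_univ_out_inj (G1 := [ch_unit d (mm0 f x)]) (G2 := nil)) with (F (pack (ch_l c a)));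
  [apply universal_out_cmap_tensor, ch_l_witness|solve_inputs|solve_inputs|].
rewrite (choice_coh_l d (a := f1 (ch_unit c x)) (G := [f1 a])) by solve_inputs.
rewrite <- mor_unit_spec.
erewrite Cut_nest_at with (D1 := nil) by solve_inputs; cbn [app].
pose proof (choice_coh_l c (a := ch_unit c x) (G := [a]) (p := pack (ch_l c a)) eq_refl) as H.
apply (f_equal F) in H; rewrite !cmap_Cut in H by solve_inputs; cbn [pmap] in H.
rewrite <- H; now erewrite <- (Cut_swap_at (G1 := nil) (G2 := nil)) by solve_inputs.
Qed.

(** The middle coherence conditions of [X] and [Y] translate the statement for [ch_r]
into the defining equation of the comparison, which is about [ch_l]. *)
Lemma mor_unit_r {x y} (a : @mone X x y) :
  Cut [f1 a] nil (pack (G_mor_unit c d f y)) (F (pack (ch_r c a)))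
  = pack (ch_r d (f1 a)).
Proof.
assert (Hr : universal_out (F (pack (ch_r c a))))
  by (apply universal_out_cmap_tensor, ch_r_witness).
assert (Hu : tensor_universal (f1 (ch_unit c y)))
  by (apply (ts_universal (mm_strong f)), tensor_unit_universal).
apply (@Cut_univ_in_inj Y _ _ _ _ nil (f1 a) [f1 (ch_unit c y)] _ (F (pack (ch_r c a))));
  [apply universal_tensor_in_r; auto|solve_inputs|].
rewrite <- (choice_coh_m d (G1 := nil) (G2 := nil)) by solve_inputs.
rewrite <- mor_unit_spec.
erewrite Cut_nest_at with (D1 := [f1 a]) by solve_inputs; cbn [app].
erewrite (Cut_nest_at (D1 := nil)) by solve_inputs; cbn [app].
f_equal.
pose proof (choice_coh_m c (G1 := nil) (G2 := nil) (q := pack (ch_r c a)) eq_refl) as H.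
apply (f_equal F) in H; rewrite !cmap_Cut in H by solve_inputs; cbn [pmap] in H.
symmetry; exact H.
Qed.

(** Both [ch_l] at the image of the unit and the image of [ch_l] are universal at their
first input, because the image of the unit is tensor universal; the comparison
cells between them are therefore mutually inverse. *)
Lemma mor_unit_invertible x :
  exists q : mtwo [f1 (ch_unit c x)] (ch_unit d (mm0 f x)),
    cut nil nil (G_mor_unit c d f x) q = mid _ /\
    cut nil nil q (G_mor_unit c d f x) = mid _.
Proof.
set (e' := f1 (ch_unit c x)).
assert (He : tensor_universal e')
  by (apply (ts_universal (mm_strong f)), tensor_unit_universal).
assert (Hl : universal_in nil (ch_unit d (mm0 f x)) [e'] (pack (ch_l d e'))).
{ apply universal_tensor_in_r; [exact He|apply ch_l_witness|solve_inputs]. }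
assert (Hf : universal_in nil e' [e'] (F (pack (ch_l c (ch_unit c x))))).
{ apply universal_tensor_in_r; [exact He| |solve_inputs].
  apply universal_out_cmap_tensor, ch_l_witness. }
pose proof (mor_unit_spec x) as H; fold e' in H.
destruct (@Cut_univ_in_ex Y _ _ _ _ nil (ch_unit d (mm0 f x)) [e'] e' (pack (ch_l d e')) [e']
  (F (pack (ch_l c (ch_unit c x))))) as [q [Iq Hq]]; [exact Hl|exact I|solve_inputs|].
destruct (cell_pack Iq) as [q' ->]; exists q'; subst e'; split; apply pack_inj; push_pack.
- apply (Cut_univ_in_inj Hl); [solve_inputs|].
  erewrite Cut_nest_at with (D1 := nil) (D2 := nil) by solve_inputs; cbn [app].
  now rewrite Hq, H, Cut_mid.
- apply (Cut_univ_in_inj Hf); [solve_inputs|].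
  erewrite Cut_nest_at with (D1 := nil) (D2 := nil) by solve_inputs; cbn [app].
  now rewrite H, Hq, Cut_mid.
Qed.

Lemma G_pseudofunctor : is_pseudofunctor (G_mor c d f).
Proof.
constructor; simpl; intros.
- apply unit_unique, (ts_unit (mm_strong f)), mid_unit.
- apply pack_inj; push_pack; fold_cmap; push_pack.
  rewrite cmap_Cut by solve_inputs; reflexivity.
- apply tensor_ext; push_pack; fold_cmap.
  rewrite tens2_spec_in, mor_tens_spec_in, !mor_tens_spec by solve_inputs.
  map_eq f (tens2_spec c p q); symmetry; exact H.
- apply (invertible_between (s := pack (ch_t d (f1 a) (f1 b))) (t := F (pack (ch_t c a b)))).
  + apply tensor_out.
  + apply universal_out_cmap_tensor, ch_t_tensor.
  + solve_inputs.
  + apply mor_tens_spec.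
- apply mor_unit_invertible.
- apply tensor_ext3; push_pack; fold_cmap.
  erewrite !Cut_nest_at with (D1 := nil) (D2 := nil) by solve_inputs; cbn [app].
  rewrite tens2_spec_in, Cut_mid by solve_inputs; cbn [app].
  rewrite !mor_tens_spec_in by solve_inputs.
  map_eq f (assoc_spec c a b c0); rewrite H.
  rewrite assoc_spec_in by solve_inputs; cbn [app].
  rewrite tens2_spec_in, mor_tens_spec, Cut_mid by solve_inputs; cbn [app].
  erewrite <- (Cut_nest_at (D1 := nil) (D2 := nil)) by solve_inputs; cbn [app].
  now rewrite mor_tens_spec.
- apply tensor_ext; push_pack; fold_cmap.
  erewrite Cut_nest_at with (D1 := nil) (D2 := nil) by solve_inputs; cbn [app].
  rewrite tens2_spec_in, mor_tens_spec_in, Cut_mid, lunit_spec by solve_inputs; cbn [app].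
  map_eq f (lunit_spec c a); rewrite H; apply mor_unit_l.
- apply tensor_ext; push_pack; fold_cmap.
  erewrite Cut_nest_at with (D1 := nil) (D2 := nil) by solve_inputs; cbn [app].
  rewrite tens2_spec_in, mor_tens_spec_in, Cut_mid, runit_spec by solve_inputs; cbn [app].
  map_eq f (runit_spec c a); rewrite H; apply mor_unit_r.
Qed.
End GMor.

Lemma pf_data_ext (B C : bicat_data) f0 f1 f2 f2' t t' u u' :
  (forall x y (a b : one B x y) (p : two a b), f2 x y a b p = f2' x y a b p) ->
  (forall x y z (a : one B x y) (b : one B y z), t x y z a b = t' x y z a b) ->
  (forall x, u x = u' x) ->
  @PfData B C f0 f1 f2 t u = @PfData B C f0 f1 f2' t' u'.
Proof.
intros H Ht Hu.
assert (f2 = f2') as <-.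
{ extensionality x; extensionality y; extensionality a; extensionality b;
  extensionality p; apply H. }
now apply pf_data_eq.
Qed.

Lemma cmap_id {X : rep_mb} {x y} {a : @mone X x y} (m : cell a) :
  cmap (mm_id X) m = m.
Proof. destruct m as [P p]; exact (pack_mcast (pmap_id P) p). Qed.

Lemma cmap_comp {X Y Z : rep_mb} (f : strong_morphism X Y) (g : strong_morphism Y Z)
    {x y} {a : @mone X x y} (m : cell a) :
  cmap (mm_comp f g) m = cmap g (cmap f m).
Proof.
destruct m as [P p]; exact (pack_mcast (pmap_comp (mm1 f) (mm1 g) P) (mm2 g (mm2 f p))).
Qed.

(** The structure cells of [G_mor] are pinned down by their defining equations. *)
Lemma mor_tens_ext {X Y : rep_mb} (c : coherent_choice X) (d : coherent_choice Y)
    (f : strong_morphism X Y) {x y z} (a : @mone X x y) (b : @mone X y z)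
    (h : mtwo [ch_tens d (mm1 f _ _ a) (mm1 f _ _ b)] (mm1 f _ _ (ch_tens c a b))) :
  Cut nil nil (pack (ch_t d (mm1 f _ _ a) (mm1 f _ _ b))) (pack h) = cmap f (pack (ch_t c a b)) ->
  G_mor_tens c d f a b = h.
Proof. intros H; apply tensor_ext; now rewrite mor_tens_spec. Qed.

Lemma mor_unit_ext {X Y : rep_mb} (c : coherent_choice X) (d : coherent_choice Y)
    (f : strong_morphism X Y) x
    (h : mtwo [ch_unit d (mm0 f x)] (mm1 f _ _ (ch_unit c x))) :
  Cut nil [mm1 f _ _ (ch_unit c x)] (pack h) (cmap f (pack (ch_l c (ch_unit c x))))
  = pack (ch_l d (mm1 f _ _ (ch_unit c x))) ->
  G_mor_unit c d f x = h.
Proof.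
intros H; apply pack_inj.
apply (@Cut_univ_in_inj Y _ _ _ _ nil (mm1 f _ _ (ch_unit c x))
  [mm1 f _ _ (ch_unit c x)] _ (cmap f (pack (ch_l c (ch_unit c x))))).
- apply universal_tensor_in_r; [|apply universal_out_cmap_tensor, ch_l_witness|solve_inputs].
  apply (ts_universal (mm_strong f)), tensor_unit_universal.
- reflexivity.
- now rewrite mor_unit_spec.
Qed.

Lemma G_mor_id {X : rep_mb} (c : coherent_choice X) :
  G_mor c c (mm_id X) = pf_id_data (G_data c).
Proof.
apply pf_data_ext; simpl.
- intros; apply mcast_id.
- intros; apply (@mor_tens_ext X X c c (mm_id X)); rewrite cmap_id; apply mid_Cut.
- intros; apply (@mor_unit_ext X X c c (mm_id X)); rewrite cmap_id; now apply Cut_mid.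
Qed.

Lemma G_mor_comp {X Y Z : rep_mb} (c : coherent_choice X) (d : coherent_choice Y)
    (e : coherent_choice Z) (f : strong_morphism X Y) (g : strong_morphism Y Z) :
  G_mor c e (mm_comp f g) = pf_comp_data (G_mor c d f) (G_mor d e g).
Proof.
apply pf_data_ext; simpl.
- intros; apply mcast_id.
- intros; apply (@mor_tens_ext X Z c e (mm_comp f g)); simpl; push_pack; fold_cmap.
  etransitivity; [apply (@mor_tens_spec_in Y Z d e g _ _ _ _ _ _ _ nil nil); solve_inputs|].
  map_eq g (mor_tens_spec c d f a b); rewrite cmap_comp; exact H.
- intros; apply (@mor_unit_ext X Z c e (mm_comp f g)); simpl; push_pack; fold_cmap.
  rewrite cmap_comp.
  etransitivity; [refine (@Cut_nest_at _ _ _ _ _ _ _ nil nil _ nil _ [_] _ _ _ _ _ _ _ _ _ _); solve_inputs|].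
  map_eq g (mor_unit_spec c d f x).
  etransitivity; [apply f_equal; exact H|].
  apply (mor_unit_l d e g).
Qed.

Lemma G_functorial (c : forall X : rep_mb, coherent_choice X) : G_is_functor c.
Proof.
constructor; intros.
- apply G_bicategory.
- apply G_pseudofunctor.
- apply G_mor_id.
- apply G_mor_comp.
Qed.

(** * Insertion of a 2-cell into a left bracketing *)

Section TwoCells.
Context {B : bicategory}.
Let HB := bicat_ax B.

(** A 2-cell together with its boundary.  Left bracketings of [G ++ H] are equal to, but
not convertible with, iterated left bracketings; bundling lets equations be stated
across such equalities. *)
Definition bundled x y := {ab : one B x y * one B x y & two (fst ab) (snd ab)}.
Definition bundle {x y} {a b : one B x y} (p : two a b) : bundled x y :=
  existT (fun ab => two (fst ab) (snd ab)) (a, b) p.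
Local Notation "p ≈ q" := (bundle p = bundle q) (at level 70).

Lemma bundle_inj {x y} {a b : one B x y} (p q : two a b) : p ≈ q -> p = q.
Proof. apply inj_pair2. Qed.

Lemma bundle_vcomp {x y} {a b k a' b' k' : one B x y} {p : two a b} {q : two b k}
    {p' : two a' b'} {q' : two b' k'} : p ≈ p' -> q ≈ q' -> p ⋅ q ≈ p' ⋅ q'.
Proof.
intros Hp Hq.
assert (a = a') by exact (f_equal (fun s => fst (projT1 s)) Hp).
assert (b = b') by exact (f_equal (fun s => snd (projT1 s)) Hp).
assert (k = k') by exact (f_equal (fun s => snd (projT1 s)) Hq).
subst; apply bundle_inj in Hp, Hq; now subst.
Qed.

Lemma bundle_id_vcomp {x y} {a b k c : one B x y} {p : two a b} {q : two b k} :
  p ≈ id2 c -> p ⋅ q ≈ q.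
Proof.
intros H.
assert (a = c) by exact (f_equal (fun s => fst (projT1 s)) H).
assert (b = c) by exact (f_equal (fun s => snd (projT1 s)) H).
subst; apply bundle_inj in H; subst; now rewrite (vcomp_id_l HB).
Qed.

Lemma bundle_tens2_l {x y z} (w : one B x y) {a b a' b' : one B y z}
    {p : two a b} {p' : two a' b'} :
  p ≈ p' -> id2 w ⊗₂ p ≈ id2 w ⊗₂ p'.
Proof. intros H; exact (f_equal (fun s : bundled y z => bundle (id2 w ⊗₂ projT2 s)) H). Qed.

Lemma bundle_lb_map {x y z} (G : path (one B) y z) {a b a' b' : one B x y}
    {p : two a b} {p' : two a' b'} :
  p ≈ p' -> lb_map p G ≈ lb_map p' G.
Proof. intros H; exact (f_equal (fun s : bundled x y => bundle (lb_map (projT2 s) G)) H). Qed.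

(** Replaces the source of a 2-cell by an equal one without naming the cast. *)
Lemma bundle_source {x y} {a a' b : one B x y} (e : a = a') (p : two a b) :
  exists p' : two a' b, p ≈ p'.
Proof. destruct e; eauto. Qed.

(** An equation between composites, used in the middle of a right-nested composite. *)
Lemma vcomp_then {x y} {a b b' k l : one B x y} {p : two a b} {q : two b k}
    {p' : two a b'} {q' : two b' k} (E : p ⋅ q = p' ⋅ q') (s : two k l) :
  p ⋅ (q ⋅ s) = p' ⋅ (q' ⋅ s).
Proof. rewrite <- !(vcomp_assoc HB), E; auto. Qed.
End TwoCells.
Notation "p ≈ q" := (bundle p = bundle q) (at level 70).

Section Rebracketing.
Context {B : bicategory}.
Let HB := bicat_ax B.
Local Notation bpath := (path (one B)).

Lemma interchange_l {x y z} {a a' : one B x y} {b b' : one B y z} (p : two a a') (q : two b b') :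
  (p ⊗₂ id2 b) ⋅ (id2 a' ⊗₂ q) = (id2 a ⊗₂ q) ⋅ (p ⊗₂ id2 b').
Proof.
rewrite <- !(tens2_vcomp HB), !(vcomp_id_l HB), !(vcomp_id_r HB); auto.
Qed.

Lemma lb_map_id {x y z} (w : one B x y) (G : bpath y z) : lb_map (id2 w) G = id2 (lb w G).
Proof.
revert x w; induction G as [|? ? ? c G IH]; simpl; intros; [auto|].
rewrite (tens2_id HB); apply IH.
Qed.

Lemma lb_map_vcomp {x y z} {w w' w'' : one B x y} (p : two w w') (q : two w' w'') (G : bpath y z) :
  lb_map (p ⋅ q) G = lb_map p G ⋅ lb_map q G.
Proof.
revert w w' w'' p q; induction G as [|? ? ? c G IH]; simpl; intros; [auto|].
rewrite (tens2_vcomp_id HB); apply IH.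
Qed.

Lemma lb_app_eq {x y z t} (w : one B x y) (G : bpath y z) (H : bpath z t) :
  lb w (G ++ H) = lb (lb w G) H.
Proof. revert x w; induction G as [|? ? ? c G IH]; simpl; auto. Qed.

(** [lb_app] is an identity across the equality of its boundaries. *)
Lemma lb_app_id {x y z t} (w : one B x y) (G : bpath y z) (H : bpath z t) :
  lb_app w G H ≈ id2 (lb (lb w G) H).
Proof. revert x w; induction G as [|? ? ? c G IH]; simpl; auto. Qed.

Lemma lb_map_app {x y z t} {w w' : one B x y} (p : two w w') (G : bpath y z) (H : bpath z t) :
  lb_map p (G ++ H) ≈ lb_map (lb_map p G) H.
Proof. revert w w' p; induction G as [|? ? ? c G IH]; simpl; auto. Qed.

Lemma lb_tens_nat_l {x y z t} {w w' : one B x y} (p : two w w') (c : one B y z) (G : bpath z t) :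
  lb_map (p ⊗₂ id2 c) G ⋅ lb_tens w' c G = lb_tens w c G ⋅ (p ⊗₂ id2 (lb c G)).
Proof.
revert c; induction G as [|? ? ? d G IH]; simpl; intros.
- now rewrite (vcomp_id_l HB), (vcomp_id_r HB).
- rewrite <- (vcomp_assoc HB), <- lb_map_vcomp, (assoc_nat HB), (tens2_id HB).
  now rewrite lb_map_vcomp, !(vcomp_assoc HB), IH.
Qed.

Lemma lb_tens_nat_r {x y z t} (w : one B x y) {c c' : one B y z} (q : two c c') (G : bpath z t) :
  lb_map (id2 w ⊗₂ q) G ⋅ lb_tens w c' G = lb_tens w c G ⋅ (id2 w ⊗₂ lb_map q G).
Proof.
revert c c' q; induction G as [|? ? ? d G IH]; simpl; intros.
- now rewrite (vcomp_id_l HB), (vcomp_id_r HB).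
- rewrite <- (vcomp_assoc HB), <- lb_map_vcomp, (assoc_nat HB).
  now rewrite lb_map_vcomp, !(vcomp_assoc HB), IH.
Qed.

Lemma lb_tens_app {x y z t u} (w : one B x y) (c : one B y z) (G : bpath z t) (H : bpath t u) :
  lb_tens w c (G ++ H) ≈ lb_map (lb_tens w c G) H ⋅ lb_tens w (lb c G) H.
Proof.
revert c; induction G as [|? ? ? d G IH]; simpl; intros.
- now rewrite lb_map_id, (vcomp_id_l HB).
- rewrite lb_map_vcomp, (vcomp_assoc HB).
  eapply bundle_vcomp; [apply lb_map_app|apply IH].
Qed.

(** The pentagon, iterated along [G]. *)
Lemma lb_tens_assoc {x y z t u} (w : one B x y) (v : one B y z) (c : one B z t) (G : bpath t u) :
  lb_tens (w ⊗ v) c G ⋅ assoc w v (lb c G)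
  = lb_map (assoc w v c) G ⋅ (lb_tens w (v ⊗ c) G ⋅ (id2 w ⊗₂ lb_tens v c G)).
Proof.
revert c; induction G as [|? ? ? d G IH]; simpl; intros.
- now rewrite (tens2_id HB), (vcomp_id_l HB), !(vcomp_id_r HB).
- rewrite (vcomp_assoc HB), IH, <- (vcomp_assoc HB), <- lb_map_vcomp, <- (pentagon HB).
  rewrite !lb_map_vcomp, !(vcomp_assoc HB), (tens2_id_vcomp HB).
  now rewrite (vcomp_then (lb_tens_nat_r w (assoc v c d) G)).
Qed.

Lemma invertible_id {x y} (a : one B x y) : invertible (id2 a).
Proof. exists (id2 a); now rewrite (vcomp_id_l HB). Qed.

Lemma invertible_comp {x y} {a b k : one B x y} (p : two a b) (q : two b k) :
  invertible p -> invertible q -> invertible (p ⋅ q).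
Proof. apply (invertible_vcomp HB). Qed.

Lemma invertible_tens2 {x y z} {a a' : one B x y} {b b' : one B y z} (p : two a a') (q : two b b') :
  invertible p -> invertible q -> invertible (p ⊗₂ q).
Proof.
intros [p' [H1 H2]] [q' [H3 H4]]; exists (p' ⊗₂ q').
now rewrite <- !(tens2_vcomp HB), H1, H2, H3, H4, !(tens2_id HB).
Qed.

Lemma invertible_lb_map {x y z} {w w' : one B x y} (p : two w w') (G : bpath y z) :
  invertible p -> invertible (lb_map p G).
Proof.
intros [q [H1 H2]]; exists (lb_map q G).
now rewrite <- !lb_map_vcomp, H1, H2, !lb_map_id.
Qed.

Lemma invertible_lb_tens {x y z t} (w : one B x y) (c : one B y z) (G : bpath z t) :
  invertible (lb_tens w c G).
Proof.
revert c; induction G as [|? ? ? d G IH]; simpl; intros.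
- apply invertible_id.
- apply invertible_comp; [apply invertible_lb_map, (assoc_inv HB)|apply IH].
Qed.

Lemma vcomp_cancel_l {x y} {a b k : one B x y} (p : two a b) (q q' : two b k) :
  invertible p -> p ⋅ q = p ⋅ q' -> q = q'.
Proof.
intros [r [_ H]] E; apply (f_equal (vcomp r)) in E.
now rewrite <- !(vcomp_assoc HB), H, !(vcomp_id_l HB) in E.
Qed.

Lemma vcomp_cancel_r {x y} {a b k : one B x y} (p p' : two a b) (q : two b k) :
  invertible q -> p ⋅ q = p' ⋅ q -> p = p'.
Proof.
intros [r [H _]] E; apply (f_equal (fun s => s ⋅ r)) in E.
now rewrite !(vcomp_assoc HB), H, !(vcomp_id_r HB) in E.
Qed.

Lemma unit_tens_inj {x y} {a b : one B x y} (p q : two a b) :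
  id2 (unit1 x) ⊗₂ p = id2 (unit1 x) ⊗₂ q -> p = q.
Proof.
intros E; apply (vcomp_cancel_l (lunit_inv HB a)).
now rewrite <- !(lunit_nat HB), E.
Qed.

(** The action of [p : (G) -> (a)] on the left bracketings that continue [w]: re-bracket,
then apply [p]. *)
Definition insertion {x y z} (w : one B x y) {P : bpath y z} {a : one B y z} :
    int_two P a -> two (lb w P) (w ⊗ a) :=
  match P in path _ y z
    return forall (w : one B x y) (a : one B y z), int_two P a -> two (lb w P) (w ⊗ a)
  with
  | nil => fun w a p => match p with end
  | c :: G => fun w a p => lb_tens w c G ⋅ (id2 w ⊗₂ p)
  end w a.

(** This naturality is what makes cuts at disjoint positions commute. *)
Lemma insertion_nat {x y z} {w w' : one B x y} (q : two w w') {P : bpath y z} {a : one B y z}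
    (p : int_two P a) : lb_map q P ⋅ insertion w' p = insertion w p ⋅ (q ⊗₂ id2 a).
Proof.
destruct P as [|? ? ? c G]; [destruct p|]; simpl.
rewrite <- (vcomp_assoc HB), lb_tens_nat_l, !(vcomp_assoc HB); f_equal.
apply interchange_l.
Qed.

Lemma insertion_assoc {x y z t} (w : one B x y) (v : one B y z) {P : bpath z t} {a : one B z t}
    (p : int_two P a) :
  insertion (w ⊗ v) p ⋅ assoc w v a = lb_tens w v P ⋅ (id2 w ⊗₂ insertion v p).
Proof.
destruct P as [|? ? ? c G]; [destruct p|]; simpl.
rewrite (vcomp_assoc HB), <- (tens2_id HB), (assoc_nat HB), <- (vcomp_assoc HB), lb_tens_assoc.
now rewrite (tens2_id_vcomp HB), !(vcomp_assoc HB).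
Qed.

(** Re-bracketing is invertible and tensoring with a unit is faithful. *)
Lemma insertion_unit_inj {x y} {P : bpath x y} {a : one B x y} (p q : int_two P a) :
  insertion (unit1 x) p = insertion (unit1 x) q -> p = q.
Proof.
destruct P as [|? ? ? c G]; [destruct p|]; simpl; intros E.
apply unit_tens_inj, (vcomp_cancel_l (invertible_lb_tens _ c G) E).
Qed.

Lemma insertion_mcast {x y z} (w : one B x y) {P Q : bpath y z} {a : one B y z} (e : P = Q)
    (p : int_two P a) : insertion w (mcast (X := int_data B) e p : int_two Q a) ≈ insertion w p.
Proof. now destruct e. Qed.

Lemma insert_insertion {x y z t} (w : one B x y) {G : bpath y z} {a : one B y z} (p : int_two G a)
    (G2 : bpath z t) : int_insert w p G2 ≈ lb_map (insertion w p) G2.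
Proof.
destruct G as [|? ? ? c G]; [destruct p|]; simpl.
apply (bundle_id_vcomp (lb_app_id _ _ _)).
Qed.

Lemma whisker_insertion {x y z t u} (w : one B x y) (G1 : bpath y z) {G : bpath z t} {a : one B z t}
    (p : int_two G a) (G2 : bpath t u) :
  int_whisker w G1 p G2 ≈ lb_map (insertion (lb w G1) p) G2.
Proof.
revert x w; induction G1 as [|? ? ? c G1 IH]; simpl; intros; [apply insert_insertion|apply IH].
Qed.

(** Whiskering commutes with the re-bracketing that moves [w] out; through
[insertion_assoc] this rests on the pentagon. *)
Lemma whisker_lb_tens {x y z t u v} (w : one B x y) (c : one B y z) (G1 : bpath z t)
    {G : bpath t u} {a : one B t u} (p : int_two G a) (G2 : bpath u v) :
  lb_tens w c (G1 ++ (G ++ G2)) ⋅ (id2 w ⊗₂ int_whisker c G1 p G2)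
  = int_whisker (w ⊗ c) G1 p G2 ⋅ lb_tens w c (G1 ++ a :: G2).
Proof.
apply bundle_inj.
etransitivity.
{ eapply bundle_vcomp; [|eapply bundle_tens2_l, whisker_insertion].
  etransitivity; [apply lb_tens_app|].
  eapply bundle_vcomp; [apply lb_map_app|apply lb_tens_app]. }
symmetry; etransitivity.
{ eapply bundle_vcomp; [apply whisker_insertion|exact (lb_tens_app w c G1 (a :: G2))]. }
symmetry; simpl; f_equal.
rewrite !(vcomp_assoc HB), <- lb_tens_nat_r.
rewrite <- !(vcomp_assoc HB), <- !lb_map_vcomp; f_equal; f_equal.
rewrite !(vcomp_assoc HB), <- insertion_assoc, <- !(vcomp_assoc HB), insertion_nat; auto.
Qed.

(** Cuts become composites of whiskered insertions.  The case distinction on an empty [G1]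
in the definition of cuts disappears here. *)
Lemma insertion_cut {x y z t v} (w : one B v x) (G1 : bpath x y) {G : bpath y z} {a : one B y z}
    (G2 : bpath z t) {b : one B x t} (p : int_two G a) (s : int_two (G1 ++ a :: G2) b) :
  insertion w (int_cut p s) ≈ int_whisker w G1 p G2 ⋅ insertion w s.
Proof.
destruct G1 as [|? ? ? c G1]; simpl.
- destruct G as [|? ? ? d G]; [destruct p|]; simpl.
  etransitivity.
  { eapply bundle_vcomp; [apply lb_tens_app|].
    eapply bundle_tens2_l; eapply bundle_vcomp; [|reflexivity].
    apply (bundle_id_vcomp (lb_app_id _ _ _)). }
  symmetry; etransitivity.
  { eapply bundle_vcomp; [|reflexivity].
    apply (bundle_id_vcomp (lb_app_id _ _ _)). }
  symmetry; f_equal.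
  rewrite (tens2_id_vcomp HB), !(vcomp_assoc HB), lb_map_vcomp, (vcomp_assoc HB); f_equal.
  now rewrite <- (vcomp_assoc HB), <- lb_tens_nat_r, (vcomp_assoc HB).
- rewrite (tens2_id_vcomp HB), <- (vcomp_assoc HB), whisker_lb_tens.
  now rewrite (vcomp_assoc HB).
Qed.

(** Equations of cuts are checked on insertions at a unit.  There, associativity of cuts
is functoriality of [lb_map], and interchange is [insertion_nat]. *)
Lemma int_is_regular : is_regular_mb (int_data B).
Proof.
constructor.
- intros x y [|? ? ? a G] b t; [destruct t|exact I].
- intros x y z t u v G1 D1 D c D2 a G2 b r q s; simpl in *.
  apply insertion_unit_inj, bundle_inj.
  set (w := unit1 x).
  destruct (bundle_source (lb_app_eq w G1 (a :: G2)) (insertion w s)) as [s' Hs].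
  change (two (lb (lb w G1 ⊗ a) G2) (w ⊗ b)) in (type of s').
  transitivity (bundle (lb_map (int_whisker (lb w G1) D1 r D2) G2
    ⋅ (lb_map (insertion (lb w G1) q) G2 ⋅ s'))).
  + etransitivity; [apply insertion_cut|]; apply bundle_vcomp.
    * etransitivity; [apply whisker_insertion|].
      etransitivity; [apply lb_map_app|].
      apply bundle_lb_map; rewrite lb_app_eq; symmetry; apply whisker_insertion.
    * etransitivity; [apply insertion_mcast|].
      etransitivity; [apply insertion_cut|].
      apply bundle_vcomp; [apply whisker_insertion|exact Hs].
  + rewrite <- (vcomp_assoc HB), <- lb_map_vcomp.
    symmetry; etransitivity; [apply insertion_mcast|].
    etransitivity; [apply insertion_cut|].
    apply bundle_vcomp; [|exact Hs].
    etransitivity; [apply whisker_insertion|apply bundle_lb_map, insertion_cut].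
- intros x y z t u v G1 G a G2 D c G3 b p q s; simpl in *.
  apply insertion_unit_inj, bundle_inj.
  set (w := unit1 x).
  assert (e : lb w (G1 ++ a :: (G2 ++ c :: G3)) = lb (lb (lb w G1 ⊗ a) G2 ⊗ c) G3).
  { rewrite lb_app_eq; simpl; now rewrite lb_app_eq. }
  destruct (bundle_source e (insertion w s)) as [s' Hs].
  set (P := lb_map (insertion (lb w G1) p) G2).
  transitivity (bundle (lb_map (insertion _ q) G3 ⋅ (lb_map (P ⊗₂ id2 c) G3 ⋅ s'))).
  + etransitivity; [apply insertion_cut|]; apply bundle_vcomp.
    * etransitivity; [apply whisker_insertion|].
      apply bundle_lb_map; now rewrite !lb_app_eq.
    * etransitivity; [apply insertion_mcast|].
      etransitivity; [apply insertion_cut|].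
      apply bundle_vcomp; [|exact Hs].
      etransitivity; [apply whisker_insertion|exact (lb_map_app (insertion (lb w G1) p) G2 (c :: G3))].
  + rewrite <- (vcomp_assoc HB); rewrite <- lb_map_vcomp, <- insertion_nat.
    rewrite lb_map_vcomp, (vcomp_assoc HB).
    symmetry; etransitivity; [apply insertion_mcast|].
    etransitivity; [apply insertion_cut|].
    apply bundle_vcomp.
    * etransitivity; [apply whisker_insertion|].
      etransitivity; [apply lb_map_app|apply lb_map_app].
    * etransitivity; [apply insertion_mcast|].
      etransitivity; [apply insertion_cut|].
      apply bundle_vcomp; [|etransitivity; [apply insertion_mcast|exact Hs]].
      etransitivity; [apply whisker_insertion|].
      apply bundle_lb_map; rewrite lb_app_eq; reflexivity.
Qed.
End Rebracketing.

(** * Invertible 2-cells and equivalences as universal cells *)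

Section Rep.
Context {B : bicategory}.
Let HB := bicat_ax B.
Local Notation bpath := (path (one B)).

Lemma bundle_invertible {x y} {a b a' b' : one B x y} {p : two a b} {p' : two a' b'} :
  p ≈ p' -> invertible p' -> invertible p.
Proof.
intros H.
assert (a = a') by exact (f_equal (fun s => fst (projT1 s)) H).
assert (b = b') by exact (f_equal (fun s => snd (projT1 s)) H).
subst; apply bundle_inj in H; now subst.
Qed.

Lemma invertible_lb_app {x y z t} (w : one B x y) (G : bpath y z) (H : bpath z t) :
  invertible (lb_app w G H).
Proof. exact (bundle_invertible (lb_app_id w G H) (invertible_id _)). Qed.

Lemma invertible_insertion {x y z t} (w : one B x y) (c : one B y z) (G : bpath z t) a
    (p : two (lb c G) a) : invertible p -> invertible (insertion w (P := c :: G) p).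
Proof.
intros H; apply invertible_comp; [apply invertible_lb_tens|].
apply invertible_tens2; [apply invertible_id|exact H].
Qed.

Lemma invertible_whisker {x y z t u v} (w : one B x y) (G1 : bpath y z) (c : one B z t)
    (G : bpath t u) a (p : two (lb c G) a) (G2 : bpath u v) :
  invertible p -> invertible (int_whisker w G1 (G := c :: G) p G2).
Proof.
intros H; apply (bundle_invertible (whisker_insertion w G1 (G := c :: G) p G2)).
now apply invertible_lb_map, invertible_insertion.
Qed.

Lemma solve_vcomp_l {x y} {a b k : one B x y} (p : two a b) (s : two a k) :
  invertible p -> exists! r : two b k, p ⋅ r = s.
Proof.
intros H; pose proof H as [q [H1 H2]]; exists (q ⋅ s); split.
- now rewrite <- (vcomp_assoc HB), H1, (vcomp_id_l HB).
- intros r <-; now rewrite <- (vcomp_assoc HB), H2, (vcomp_id_l HB).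
Qed.

(** Cutting [p] in any position is composition with an invertible 2-cell. *)
Lemma int_univ_out {x y z} {c : one B x y} {G : bpath y z} {a} (p : two (lb c G) a) :
  invertible p -> @univ_out (int_data B) _ _ (c :: G) a p.
Proof.
intros H x' y' G1; revert c p H; destruct G1 as [|? ? ? d G1]; simpl;
  intros c p H G2 b s.
- apply solve_vcomp_l, invertible_comp; [apply invertible_lb_app|].
  now apply invertible_lb_map.
- now apply solve_vcomp_l, invertible_whisker.
Qed.

(** Precomposition with [p] is bijective, and this forces [p] to be invertible. *)
Lemma univ_out_invertible {x y z} {c : one B x y} {G : bpath y z} {a} (p : two (lb c G) a) :
  @univ_out (int_data B) _ _ (c :: G) a p -> invertible p.
Proof.
intros H.
assert (H' : forall b (s : two (lb c G) b), exists! r : two a b, p ⋅ r = s).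
{ intros b s; destruct (H _ _ nil nil b (lb_app c G nil ⋅ s)) as [r [Hr Ur]].
  assert (E : forall r' : two a b, lb_app c G nil ⋅ p ⋅ r' = lb_app c G nil ⋅ s <-> p ⋅ r' = s).
  { intros r'; rewrite (vcomp_assoc HB); split.
    - apply vcomp_cancel_l, invertible_lb_app.
    - intros E; exact (f_equal (vcomp (lb_app c G nil)) E). }
  exists r; split; [apply E, Hr|].
  intros r' Hr'; apply Ur, E, Hr'. }
destruct (H' _ (id2 _)) as [r [Hr _]]; exists r; split; [exact Hr|].
destruct (H' _ p) as [q [_ Uq]]; transitivity q; [symmetry|]; apply Uq.
- now rewrite <- (vcomp_assoc HB), Hr, (vcomp_id_l HB).
- apply (vcomp_id_r HB).
Qed.

(** The insertion of an identity is an identity. *)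
Lemma int_id_unit {x y} (a : one B x y) : @is_unit (int_data B) x y a (id2 a).
Proof.
assert (E : forall v (w : one B v x), insertion w (P := [a]) (id2 a) = id2 (w ⊗ a)).
{ intros; simpl; rewrite (tens2_id HB); apply (vcomp_id_l HB). }
split; simpl; intros.
- apply insertion_unit_inj, bundle_inj; symmetry.
  etransitivity; [apply insertion_mcast|]; symmetry.
  etransitivity; [apply (insertion_cut (unit1 x) (G1 := nil) (G2 := nil) t (id2 a))|].
  rewrite E, (vcomp_id_r HB); apply (whisker_insertion (unit1 x) nil t nil).
- apply insertion_unit_inj, bundle_inj.
  etransitivity; [apply (insertion_cut (unit1 x') (G1 := G1) (G := [a]) (id2 a) s)|].
  eapply bundle_id_vcomp.
  etransitivity; [apply (whisker_insertion (unit1 x') G1 (G := [a]) (id2 a) G2)|].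
  now rewrite E, lb_map_id.
Qed.

Definition isomorphic {x y} (a b : one B x y) := exists p : two a b, invertible p.

Lemma iso_refl {x y} (a : one B x y) : isomorphic a a.
Proof. exists (id2 a); apply invertible_id. Qed.

Lemma iso_sym {x y} (a b : one B x y) : isomorphic a b -> isomorphic b a.
Proof. intros [p [q [H1 H2]]]; exists q, p; auto. Qed.

Lemma iso_trans {x y} (a b k : one B x y) :
  isomorphic a b -> isomorphic b k -> isomorphic a k.
Proof. intros [p Hp] [q Hq]; exists (p ⋅ q); now apply invertible_comp. Qed.

Lemma iso_tens {x y z} (a a' : one B x y) (b b' : one B y z) :
  isomorphic a a' -> isomorphic b b' -> isomorphic (a ⊗ b) (a' ⊗ b').
Proof. intros [p Hp] [q Hq]; exists (p ⊗₂ q); now apply invertible_tens2. Qed.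

Lemma iso_assoc {x y z t} (a : one B x y) (b : one B y z) (c : one B z t) :
  isomorphic (a ⊗ b ⊗ c) (a ⊗ (b ⊗ c)).
Proof. exists (assoc a b c); apply (assoc_inv HB). Qed.

Lemma iso_lunit {x y} (a : one B x y) : isomorphic (unit1 x ⊗ a) a.
Proof. exists (lunit a); apply (lunit_inv HB). Qed.

Lemma iso_runit {x y} (a : one B x y) : isomorphic (a ⊗ unit1 y) a.
Proof. exists (runit a); apply (runit_inv HB). Qed.

Definition equivalence {x x'} (e : one B x x') : Prop :=
  exists v : one B x' x, isomorphic (e ⊗ v) (unit1 x) /\ isomorphic (v ⊗ e) (unit1 x').

(** If [v ⊗ e] is isomorphic to a unit, tensoring with [e] and then with [v] is naturally
isomorphic to the identity. *)
Lemma retraction_l {x x'} (e : one B x x') (v : one B x' x) :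
  isomorphic (v ⊗ e) (unit1 x') ->
  forall y, exists N : forall c : one B x' y, two (v ⊗ (e ⊗ c)) c,
    (forall c, invertible (N c)) /\
    forall c d (r : two c d), (id2 v ⊗₂ (id2 e ⊗₂ r)) ⋅ N d = N c ⋅ r.
Proof.
intros [k Hk] y.
assert (N : forall c : one B x' y, exists n : two (v ⊗ (e ⊗ c)) c,
  assoc v e c ⋅ n = (k ⊗₂ id2 c) ⋅ lunit c).
{ intros c.
  destruct (solve_vcomp_l ((k ⊗₂ id2 c) ⋅ lunit c) (assoc_inv HB v e c)) as [n [Hn _]].
  eauto. }
exists (fun c => proj1_sig (constructive_indefinite_description _ (N c))); split.
- intros c; destruct (constructive_indefinite_description _ _) as [n Hn]; simpl.
  destruct (assoc_inv HB v e c) as [s [H1 H2]].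
  replace n with (s ⋅ ((k ⊗₂ id2 c) ⋅ lunit c)).
  + apply invertible_comp; [exists (assoc v e c); auto|].
    apply invertible_comp; [|apply (lunit_inv HB)].
    apply invertible_tens2; [exact Hk|apply invertible_id].
  + now rewrite <- Hn, <- (vcomp_assoc HB), H2, (vcomp_id_l HB).
- intros c d r.
  destruct (constructive_indefinite_description _ (N c)) as [n Hn],
    (constructive_indefinite_description _ (N d)) as [m Hm]; simpl.
  apply (vcomp_cancel_l (assoc_inv HB v e c)).
  rewrite <- !(vcomp_assoc HB), <- (assoc_nat HB), (vcomp_assoc HB), Hm, Hn.
  rewrite <- (vcomp_assoc HB), (tens2_id HB), <- interchange_l.
  now rewrite !(vcomp_assoc HB), (lunit_nat HB).
Qed.

Lemma retraction_r {x x'} (e : one B x x') (v : one B x' x) :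
  isomorphic (e ⊗ v) (unit1 x) ->
  forall z, exists N : forall c : one B z x, two ((c ⊗ e) ⊗ v) c,
    (forall c, invertible (N c)) /\
    forall c d (r : two c d), ((r ⊗₂ id2 e) ⊗₂ id2 v) ⋅ N d = N c ⋅ r.
Proof.
intros [k Hk] z; exists (fun c => assoc c e v ⋅ ((id2 c ⊗₂ k) ⋅ runit c)); split.
- intros c; apply invertible_comp; [apply (assoc_inv HB)|].
  apply invertible_comp; [|apply (runit_inv HB)].
  apply invertible_tens2; [apply invertible_id|exact Hk].
- intros c d r.
  rewrite <- (vcomp_assoc HB), (assoc_nat HB), (tens2_id HB), !(vcomp_assoc HB).
  f_equal; rewrite <- (runit_nat HB).
  now rewrite <- (vcomp_assoc HB), interchange_l, (vcomp_assoc HB).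
Qed.

(** Tensoring with an equivalence is fully faithful.  Given [s], the retraction [N] yields
[r] with [v ⊗ (e ⊗ r)] equal to [v ⊗ s], and the retraction [M] shows that tensoring with
[v] is faithful. *)
Lemma equivalence_ff_l {x x'} {e : one B x x'} (v : one B x' x) :
  isomorphic (e ⊗ v) (unit1 x) -> isomorphic (v ⊗ e) (unit1 x') ->
  forall y (c d : one B x' y) (s : two (e ⊗ c) (e ⊗ d)), exists! r, id2 e ⊗₂ r = s.
Proof.
intros H1 H2 y c d s.
destruct (retraction_l H2 y) as [N [HN NN]], (retraction_l H1 y) as [M [HM MM]].
destruct (solve_vcomp_l ((id2 v ⊗₂ s) ⋅ N d) (HN c)) as [r [Hr Ur]].
exists r; split.
- rewrite <- NN in Hr; apply (vcomp_cancel_r (HN d)) in Hr.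
  apply (vcomp_cancel_l (HM _)); rewrite <- !MM, Hr; auto.
- intros r' Hr'; apply Ur; now rewrite <- NN, Hr'.
Qed.

Lemma equivalence_ff_r {x x'} {e : one B x x'} (v : one B x' x) :
  isomorphic (e ⊗ v) (unit1 x) -> isomorphic (v ⊗ e) (unit1 x') ->
  forall z (c d : one B z x) (s : two (c ⊗ e) (d ⊗ e)), exists! r, r ⊗₂ id2 e = s.
Proof.
intros H1 H2 y c d s.
destruct (retraction_r H1 y) as [N [HN NN]], (retraction_r H2 y) as [M [HM MM]].
destruct (solve_vcomp_l ((s ⊗₂ id2 v) ⋅ N d) (HN c)) as [r [Hr Ur]].
exists r; split.
- rewrite <- NN in Hr; apply (vcomp_cancel_r (HN d)) in Hr.
  apply (vcomp_cancel_l (HM _)); rewrite <- !MM, Hr; auto.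
- intros r' Hr'; apply Ur; now rewrite <- NN, Hr'.
Qed.

Lemma solve_vcomp_lr {x y} {a b k l : one B x y} (p : two a b) (q : two k l) (s : two a l) :
  invertible p -> invertible q -> exists! r : two b k, p ⋅ r ⋅ q = s.
Proof.
intros Hp [q' [H1 H2]]; destruct (solve_vcomp_l (s ⋅ q') Hp) as [r [Hr Ur]].
exists r; split.
- now rewrite Hr, (vcomp_assoc HB), H2, (vcomp_id_r HB).
- intros r' <-; apply Ur; now rewrite (vcomp_assoc HB), H1, (vcomp_id_r HB).
Qed.

(** Solving for the inserted cell amounts to inverting the re-bracketing and [p], and then
using that tensoring with [e] is fully faithful. *)
Lemma int_univ_in_l {x x' y} {e : one B x x'} {u : one B x' y} {a} (p : two (e ⊗ u) a) :
  equivalence e -> invertible p -> @univ_in (int_data B) _ _ _ _ [e] u nil a p.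
Proof.
intros He Hp G; revert e u p He Hp; destruct G as [|? ? ? c G];
  intros e u p [v [H1 H2]] Hp HG s; [destruct HG|]; simpl in *.
destruct (solve_vcomp_lr s (invertible_comp (invertible_lb_app (e ⊗ c) G nil)
  (invertible_lb_tens e c G)) Hp) as [r [Hr Ur]].
destruct (equivalence_ff_l H1 H2 r) as [q [Hq Uq]].
exists q; split.
- rewrite Hq, <- (vcomp_assoc HB); exact Hr.
- intros q' Hq'; apply Uq; symmetry; apply Ur.
  now rewrite (vcomp_assoc HB (lb_app _ _ _)).
Qed.

Lemma int_univ_in_r {z x x'} {u : one B z x} {e : one B x x'} {a} (p : two (u ⊗ e) a) :
  equivalence e -> invertible p -> @univ_in (int_data B) _ _ _ _ nil u [e] a p.
Proof.
intros He Hp G; revert u e p He Hp; destruct G as [|? ? ? c G];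
  intros u e p [v [H1 H2]] Hp HG s; [destruct HG|]; simpl in *.
destruct (solve_vcomp_lr s (invertible_lb_app c G [e]) Hp) as [r [Hr Ur]].
destruct (equivalence_ff_r H1 H2 r) as [q [Hq Uq]].
exists q; split.
- rewrite Hq; exact Hr.
- intros q' Hq'; apply Uq; symmetry; apply Ur; exact Hq'.
Qed.

(** Conversely, universal cells into units make [e] invertible on both sides up to
isomorphism, and the one-sided inverses are then isomorphic. *)
Lemma equivalence_tensor_universal {x x'} (e : one B x x') :
  equivalence e <-> @tensor_universal (int_data B) x x' e.
Proof.
split.
- intros He; pose proof He as [v [H1 H2]].
  split; [|split; [|split]].
  + intros y a; destruct (retraction_l H1 y) as [N [HN _]].
    exists (v ⊗ a), (N a); split; [apply int_univ_out, HN|].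
    now apply int_univ_in_l.
  + intros y a; exists (e ⊗ a), (id2 (e ⊗ a)); split.
    * apply int_univ_out, invertible_id.
    * apply int_univ_in_l; [exact He|apply invertible_id].
  + intros z b; destruct (retraction_r H2 z) as [N [HN _]].
    exists (b ⊗ v), (N b); split; [apply int_univ_out, HN|].
    now apply int_univ_in_r.
  + intros z b; exists (b ⊗ e), (id2 (b ⊗ e)); split.
    * apply int_univ_out, invertible_id.
    * apply int_univ_in_r; [exact He|apply invertible_id].
- intros [E1 [_ [E3 _]]].
  destruct (E1 _ (unit1 x)) as (u & p & Hp & _).
  destruct (E3 _ (unit1 x')) as (u' & p' & Hp' & _).
  apply (univ_out_invertible (c := e) (G := [u])) in Hp.
  apply (univ_out_invertible (c := u') (G := [e])) in Hp'.
  assert (I : isomorphic (e ⊗ u) (unit1 x)) by (exists p; exact Hp).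
  assert (I' : isomorphic (u' ⊗ e) (unit1 x')) by (exists p'; exact Hp').
  (* The left inverse is isomorphic to the right inverse, as in a monoid. *)
  exists u; split; [exact I|].
  eapply iso_trans; [|exact I']; apply iso_tens; [|apply iso_refl].
  eapply iso_trans; [apply iso_sym, iso_lunit|].
  eapply iso_trans; [apply iso_tens; [apply iso_sym, I'|apply iso_refl]|].
  eapply iso_trans; [apply iso_assoc|].
  eapply iso_trans; [apply iso_tens; [apply iso_refl|exact I]|apply iso_runit].
Qed.

Lemma unit_equivalence x : equivalence (unit1 x : one B x x).
Proof. exists (unit1 x); split; apply iso_lunit. Qed.

Lemma int_representable : tensor_representable (int_data B).
Proof.
constructor.
- intros x y a; exists (id2 a); apply int_id_unit.
- intros x; exists (unit1 x); split.
  + intros y a; exists (lunit a); split.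
    * apply int_univ_out, (lunit_inv HB).
    * apply int_univ_in_l; [apply unit_equivalence|apply (lunit_inv HB)].
  + intros y a; exists (runit a); split.
    * apply int_univ_out, (runit_inv HB).
    * apply int_univ_in_r; [apply unit_equivalence|apply (runit_inv HB)].
- intros x y z a b; exists (a ⊗ b), (id2 (a ⊗ b)).
  apply int_univ_out, invertible_id.
Qed.
End Rep.

(** * Pseudofunctors induce tensor strong morphisms *)

Section IntMor.
Context {B C : bicategory} (f : pseudofunctor B C).
Let HB := bicat_ax B.
Let HC := bicat_ax C.
Let Hf := pf_ax f.
Local Notation bpath := (path (one B)).
Local Notation fp := (pmap (@pf1 _ _ f)).

Lemma bundle_pf2 {x y} {a b a' b' : one B x y} {p : two a b} {p' : two a' b'} :
  p ≈ p' -> pf2 f p ≈ pf2 f p'.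
Proof. intros H; exact (f_equal (fun s : bundled x y => bundle (pf2 f (projT2 s))) H). Qed.

Lemma int_mor_coh_nat {x y z} {w w' : one B x y} (p : two w w') (G : bpath y z) :
  lb_map (pf2 f p) (fp G) ⋅ int_mor_coh f w' G = int_mor_coh f w G ⋅ pf2 f (lb_map p G).
Proof.
revert w w' p; induction G as [|? ? ? c G IH]; simpl; intros.
- now rewrite (vcomp_id_l HC), (vcomp_id_r HC).
- rewrite <- (vcomp_assoc HC), <- lb_map_vcomp, (pf_tens_nat_l Hf).
  now rewrite lb_map_vcomp, !(vcomp_assoc HC), IH.
Qed.

Lemma int_mor_coh_app {x y z t} (w : one B x y) (G : bpath y z) (H : bpath z t) :
  int_mor_coh f w (G ++ H) ≈ lb_map (int_mor_coh f w G) (fp H) ⋅ int_mor_coh f (lb w G) H.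
Proof.
revert x w; induction G as [|? ? ? c G IH]; simpl; intros.
- now rewrite lb_map_id, (vcomp_id_l HC).
- rewrite lb_map_vcomp, (vcomp_assoc HC); apply bundle_vcomp; [|apply IH].
  rewrite pmap_app; apply lb_map_app.
Qed.

(** The associativity axiom of [f], iterated along [G]. *)
Lemma int_mor_coh_tens {x y z t} (w : one B x y) (c : one B y z) (G : bpath z t) :
  int_mor_coh f w (c :: G) ⋅ pf2 f (lb_tens w c G)
  = lb_tens (pf1 f w) (pf1 f c) (fp G)
    ⋅ ((id2 (pf1 f w) ⊗₂ int_mor_coh f c G) ⋅ pf_tens f w (lb c G)).
Proof.
revert c; induction G as [|? ? ? d G IH]; simpl; intros.
- now rewrite (pf2_id Hf), (tens2_id HC), !(vcomp_id_r HC), !(vcomp_id_l HC).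
- rewrite (pf2_vcomp Hf), (tens2_id_vcomp HC), !(vcomp_assoc HC).
  rewrite <- (vcomp_then (int_mor_coh_nat (assoc w c d) G)).
  rewrite <- (vcomp_assoc HC (lb_map _ _)), <- (vcomp_assoc HC (lb_map _ _ ⋅ _)).
  rewrite <- !lb_map_vcomp, (pf_assoc Hf), !lb_map_vcomp, !(vcomp_assoc HC).
  f_equal; simpl in IH; rewrite <- (vcomp_assoc HC (lb_map (pf_tens f w _) _)), IH.
  now rewrite (vcomp_then (lb_tens_nat_r _ _ _)).
Qed.

Lemma invertible_int_mor_coh {x y z} (w : one B x y) (G : bpath y z) :
  invertible (int_mor_coh f w G).
Proof.
revert x w; induction G as [|? ? ? c G IH]; simpl; intros; [apply invertible_id|].
apply invertible_comp; [|apply IH].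
apply invertible_lb_map, (pf_tens_inv Hf).
Qed.

Lemma int_mor_coh_ins {x y z} (w : one B x y) {P : bpath y z} {a : one B y z} (p : int_two P a) :
  int_mor_coh f w P ⋅ pf2 f (insertion w p)
  = insertion (pf1 f w) (int_mor2 f p) ⋅ pf_tens f w a.
Proof.
destruct P as [|? ? ? c G]; [destruct p|]; simpl insertion.
rewrite (pf2_vcomp Hf).
transitivity ((int_mor_coh f w (c :: G) ⋅ pf2 f (lb_tens w c G)) ⋅ pf2 f (id2 w ⊗₂ p));
  [symmetry; apply (vcomp_assoc HC)|].
rewrite int_mor_coh_tens; simpl; rewrite (tens2_id_vcomp HC), !(vcomp_assoc HC).
now rewrite (pf_tens_nat_r Hf).
Qed.

(** The coherence 2-cells slide past a whiskered insertion.  The two forms [s] and [s'] of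
the 2-cell that follows only differ by the equality of their sources. *)
Lemma int_mor_coh_whisker {x y z t u} (w : one B x y) (G1 : bpath y z)
    {G : bpath z t} {a : one B z t} (p : int_two G a) (G2 : bpath t u) {k} (s : two (lb (lb w G1 ⊗ a) G2) k)
    (s' : two (lb w (G1 ++ a :: G2)) k) : s' ≈ s ->
  int_mor_coh f w (G1 ++ (G ++ G2)) ⋅ pf2 f (int_whisker w G1 p G2 ⋅ s')
  ≈ lb_map (insertion (lb (pf1 f w) (fp G1)) (int_mor2 f p)) (fp G2)
    ⋅ (lb_map (int_mor_coh f w G1 ⊗₂ id2 (pf1 f a)) (fp G2)
       ⋅ (int_mor_coh f (lb w G1) (a :: G2) ⋅ pf2 f s)).
Proof.
intros Hs; etransitivity.
{ eapply bundle_vcomp.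
  - etransitivity; [apply int_mor_coh_app|].
    eapply bundle_vcomp; [|apply int_mor_coh_app].
    rewrite pmap_app; apply lb_map_app.
  - eapply bundle_pf2, bundle_vcomp; [apply whisker_insertion|exact Hs]. }
f_equal; simpl.
rewrite (pf2_vcomp Hf), !(vcomp_assoc HC).
rewrite <- (vcomp_then (int_mor_coh_nat (insertion (lb w G1) p) G2)).
rewrite <- !(vcomp_assoc HC), <- !lb_map_vcomp; do 3 f_equal.
rewrite !(vcomp_assoc HC), int_mor_coh_ins, <- !(vcomp_assoc HC); f_equal.
apply insertion_nat.
Qed.

(** The image of a unit under a pseudofunctor is only isomorphic to a unit, which is all
that the recovery of [p] needs. *)
Lemma insertion_inj {x z} (w : one C x x) {P : path (one C) x z} {a : one C x z}
    (p q : int_two P a) :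
  isomorphic w (unit1 x) -> insertion w p = insertion w q -> p = q.
Proof.
intros [k Hk]; destruct P as [|? ? ? c G]; [destruct p|]; simpl; intros E.
apply unit_tens_inj.
apply (vcomp_cancel_l (invertible_lb_tens w c G)) in E.
apply (vcomp_cancel_l (p := k ⊗₂ id2 (lb c G))).
- apply invertible_tens2; [exact Hk|apply invertible_id].
- now rewrite !interchange_l, E.
Qed.

(** Both sides are compared through their insertions at the image of a unit. *)
Lemma int_morphism_law : is_morphism (int_mor f).
Proof.
intros x y z t G1 G a G2 b p s; simpl in *.
set (w := unit1 x).
apply (insertion_inj (w := pf1 f w)).
{ exists (proj1_sig (constructive_indefinite_description _ (pf_unit_inv Hf x))).
  destruct (constructive_indefinite_description _ _) as [u [H1 H2]]; simpl.
  exists (pf_unit f x); auto. }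
apply (vcomp_cancel_r (pf_tens_inv Hf w b)), bundle_inj.
destruct (bundle_source (lb_app_eq w G1 (a :: G2)) (insertion w s)) as [S HS].
etransitivity.
{ eapply bundle_vcomp; [apply insertion_mcast|reflexivity]. }
rewrite <- int_mor_coh_ins.
etransitivity.
{ eapply bundle_vcomp; [reflexivity|]. eapply bundle_pf2; apply insertion_cut. }
etransitivity; [apply (int_mor_coh_whisker p HS)|].
symmetry; etransitivity.
{ eapply bundle_vcomp; [apply insertion_cut|reflexivity]. }
rewrite (vcomp_assoc HC); apply bundle_vcomp; [apply whisker_insertion|].
etransitivity.
{ eapply bundle_vcomp; [apply insertion_mcast|reflexivity]. }
rewrite <- int_mor_coh_ins.
rewrite <- (vcomp_assoc HC).
apply bundle_vcomp; [exact (int_mor_coh_app w G1 (a :: G2))|].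
apply bundle_pf2, HS.
Qed.

(** Units are identities, tensors are the invertible cells and tensor universal 1-cells are
the equivalences; pseudofunctors preserve all three. *)
Lemma int_strong_law : tensor_strong (int_mor f).
Proof.
constructor.
- intros x y a i Hi.
  assert (i = id2 a) as ->.
  { pose proof (proj1 (int_id_unit a) _ i) as H1.
    pose proof (proj2 Hi _ _ nil nil _ (id2 a : mtwo (m := int_data B) [a] a)) as H2.
    rewrite H1 in H2; rewrite <- H2; symmetry; apply (mcast_id (X := int_data B)). }
  assert (E : int_mor2 f (G := [a]) (id2 a) = id2 (pf1 f a)).
  { simpl; rewrite (pf2_id Hf); apply (vcomp_id_l HC). }
  change (@is_unit (int_data C) _ _ (pf1 f a) (int_mor2 f (G := [a]) (id2 a))).
  rewrite E; apply int_id_unit.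
- intros x x' e He; apply equivalence_tensor_universal in He.
  apply equivalence_tensor_universal; destruct He as [v [H1 H2]].
  assert (F : forall x y (a b : one B x y), isomorphic a b -> isomorphic (pf1 f a) (pf1 f b)).
  { intros ? ? ? ? [p Hp]; exists (pf2 f p); now apply (invertible_pf2 Hf). }
  assert (T : forall x y (a : one B x y) (b : one B y x), isomorphic (a ⊗ b) (unit1 x) ->
    isomorphic (pf1 f a ⊗ pf1 f b) (unit1 _)).
  { intros ? ? a b H; eapply iso_trans; [exists (pf_tens f a b); apply (pf_tens_inv Hf)|].
    eapply iso_trans; [apply F, H|].
    apply iso_sym; exists (pf_unit f x0); apply (pf_unit_inv Hf). }
  exists (pf1 f v); split; now apply T.
- intros x y z a b c t Ht; apply (univ_out_invertible (c := a) (G := [b])) in Ht.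
  apply (int_univ_out (c := pf1 f a) (G := [pf1 f b])).
  apply invertible_comp; [apply invertible_int_mor_coh|now apply (invertible_pf2 Hf)].
Qed.
End IntMor.

(** Forgets which input sequence a 2-cell of the integral was given with, so that casts
along equal sequences can be ignored. *)
Definition head_two {B : bicategory} {x y} {P : path (one B) x y} {a : one B x y} :
    int_two P a -> bundled x y :=
  match P in path _ x y return forall a : one B x y, int_two P a -> bundled x y with
  | nil => fun _ p => match p with end
  | c :: G => fun _ p => bundle p
  end a.

Lemma head_two_inj {B : bicategory} {x y} {P : path (one B) x y} {a : one B x y}
  (p q : int_two P a) : head_two p = head_two q -> p = q.
Proof. destruct P; [destruct p|apply bundle_inj]. Qed.

Lemma head_two_mcast {B : bicategory} {x y} {P Q : path (one B) x y} {a : one B x y}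
  (e : P = Q) (p : int_two P a) :
  head_two (mcast (X := int_data B) e p : int_two Q a) = head_two p.
Proof. now destruct e. Qed.

Lemma int_mor_coh_id {B : bicategory} {x y z} (w : one B x y) (G : path (one B) y z) :
  int_mor_coh (pf_id B) w G ≈ id2 (lb w G).
Proof.
revert x w; induction G as [|? ? ? c G IH]; simpl; intros; [reflexivity|].
rewrite lb_map_id; etransitivity; [|apply IH].
eapply bundle_id_vcomp; reflexivity.
Qed.

Lemma int_mor_id (B : bicategory) : int_mor (pf_id B) = mm_id_data (int_data B).
Proof.
apply (mm_data_eq (X := int_data B) (Y := int_data B)); intros x y P b p; simpl in *.
apply head_two_inj; etransitivity; [|symmetry; apply head_two_mcast].
destruct P as [|? ? ? c G]; [destruct p|]; simpl.
eapply bundle_id_vcomp, int_mor_coh_id.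
Qed.

Lemma int_mor_coh_comp {B C D : bicategory} (f : pseudofunctor B C) (g : pseudofunctor C D)
    {x y z} (w : one B x y) (G : path (one B) y z) :
  int_mor_coh (pf_comp f g) w G
  ≈ int_mor_coh g (pf1 f w) (pmap (@pf1 _ _ f) G) ⋅ pf2 g (int_mor_coh f w G).
Proof.
revert x w; induction G as [|? ? ? c G IH]; simpl; intros.
- now rewrite (pf2_id (pf_ax g)), (vcomp_id_l (bicat_ax D)).
- rewrite lb_map_vcomp, (pf2_vcomp (pf_ax g)), !(vcomp_assoc (bicat_ax D)).
  rewrite <- (vcomp_then (int_mor_coh_nat g (pf_tens f w c) (pmap (@pf1 _ _ f) G))).
  apply bundle_vcomp; [now rewrite pmap_comp|].
  apply bundle_vcomp; [now rewrite pmap_comp|apply IH].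
Qed.

Lemma int_mor_comp (B C D : bicategory) (f : pseudofunctor B C) (g : pseudofunctor C D) :
  int_mor (pf_comp f g) = mm_comp_data (int_mor f) (int_mor g).
Proof.
apply (mm_data_eq (X := int_data B) (Y := int_data D)); intros x y P b p; simpl in *.
apply head_two_inj; etransitivity; [|symmetry; apply head_two_mcast].
destruct P as [|? ? ? c G]; [destruct p|]; simpl.
rewrite (pf2_vcomp (pf_ax g)), <- (vcomp_assoc (bicat_ax D)).
apply bundle_vcomp; [apply int_mor_coh_comp|reflexivity].
Qed.

Lemma int_functorial : int_is_functor.
Proof.
constructor; intros.
- apply int_is_regular.
- apply int_representable.
- apply int_morphism_law.
- apply int_strong_law.
- apply int_mor_id.
- apply int_mor_comp.
Qed.

(** * Isomorphisms that fix 0-cells and 1-cells *)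

Section Recell.
Context {O : Type} {M : O -> O -> Type}.
Context {two1 two2 : forall x y, path M x y -> M x y -> Type}.
Context {cut1 : forall x y z w (G1 : path M x y) (G : path M y z) (a : M y z)
  (G2 : path M z w) (b : M x w), two1 G a -> two1 (G1 ++ a :: G2) b -> two1 (G1 ++ (G ++ G2)) b}.
Context {cut2 : forall x y z w (G1 : path M x y) (G : path M y z) (a : M y z)
  (G2 : path M z w) (b : M x w), two2 G a -> two2 (G1 ++ a :: G2) b -> two2 (G1 ++ (G ++ G2)) b}.
Local Notation X1 := (MbData cut1).
Local Notation X2 := (MbData cut2).
Context (φ : forall x y (P : path M x y) (b : M x y), two1 P b -> two2 P b).
Context (ψ : forall x y (P : path M x y) (b : M x y), two2 P b -> two1 P b).
Context (φK : forall x y (P : path M x y) (b : M x y) (p : two1 P b), ψ (φ p) = p).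
Context (ψK : forall x y (P : path M x y) (b : M x y) (p : two2 P b), φ (ψ p) = p).
Context (φ_cut : forall x y z w (G1 : path M x y) (G : path M y z) (a : M y z)
  (G2 : path M z w) (b : M x w) (t : two1 G a) (s : two1 (G1 ++ a :: G2) b),
  φ (cut1 t s) = cut2 (φ t) (φ s)).

Lemma recell_mcast {x y} {P Q : path M x y} {b : M x y} (e : P = Q) (p : two1 P b) :
  φ (mcast (X := X1) e p : two1 Q b) = mcast (X := X2) e (φ p).
Proof. now destruct e. Qed.

(** A bijection of 2-cells over the same 0-cells and 1-cells.  The cast only accounts for
[pmap] along identity functions, which is not convertible with the identity. *)
Definition recell_data : mm_data X1 X2 :=
  MmData (X := X1) (Y := X2) (mm0 := fun x => x) (mm1 := fun _ _ a => a)
    (fun _ _ P _ p => mcast (X := X2) (pmap_id P) (φ p)).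

Lemma recell_morphism : is_morphism recell_data.
Proof.
intros x y z w G1 G a G2 b t s; simpl.
rewrite φ_cut, !mcast_mcast.
symmetry; etransitivity.
{ apply (cut_mcast (X := X2) (pmap_id G1) (pmap_id G) (pmap_id G2)) with
    (h := eq_refl)
    (k := eq_trans (pmap_id _) (pmap_app3 (f0 := fun x => x) _ G1 G G2)). }
reflexivity.
Qed.

Lemma recell_unit x y (a : M x y) (i : two1 [a] a) :
  is_unit (X := X1) i -> is_unit (X := X2) (φ i : @mtwo X2 _ _ [a] a).
Proof.
intros [H1 H2]; split.
- intros G t; simpl in *; rewrite <- (ψK t) at 1.
  etransitivity; [symmetry; apply (φ_cut (G1 := nil) (G2 := nil) (ψ t) (i : two1 (nil ++ [a]) a))|].
  etransitivity; [apply f_equal, H1|].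
  rewrite recell_mcast, ψK; reflexivity.
- intros x' y' G1 G2 b s; simpl in *; rewrite <- (ψK s) at 1.
  etransitivity; [exact (eq_sym (φ_cut (G1 := G1) (G := [a]) i (ψ s)))|].
  etransitivity; [apply f_equal, H2|apply ψK].
Qed.

Lemma exists_unique_transfer A A' (g : A -> A') (h : A' -> A) (Q : A -> Prop) (Q' : A' -> Prop) :
  (forall a', g (h a') = a') -> (forall a, Q a <-> Q' (g a)) ->
  (forall a, h (g a) = a) -> (exists! a, Q a) -> exists! a', Q' a'.
Proof.
intros gh E hg [a [Ha U]]; exists (g a); split; [now apply E|].
intros a' Ha'; rewrite <- (gh a'); f_equal; apply U, E; now rewrite gh.
Qed.

Lemma recell_univ_out x y (G : path M x y) (a : M x y) (t : two1 G a) :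
  univ_out (X := X1) t -> univ_out (X := X2) (φ t : @mtwo X2 _ _ G a).
Proof.
intros H x' y' G1 G2 b s; simpl in *.
refine (exists_unique_transfer (g := @φ _ _ _ _) (h := @ψ _ _ _ _) _ _ _
  (H x' y' G1 G2 b (ψ s))); simpl; [auto| |auto].
intros r; rewrite <- φ_cut; split; [intros ->; apply ψK|intros <-; now rewrite φK].
Qed.

Lemma recell_univ_in x y z w (G1 : path M x y) (a : M y z) (G2 : path M z w) (b : M x w)
    (t : two1 (G1 ++ a :: G2) b) :
  univ_in (X := X1) G1 a G2 t -> univ_in (X := X2) G1 a G2 (φ t : @mtwo X2 _ _ (G1 ++ a :: G2) b).
Proof.
intros H G HG s; simpl in *.
refine (exists_unique_transfer (g := @φ _ _ _ _) (h := @ψ _ _ _ _) _ _ _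
  (H G HG (ψ s))); simpl; [auto| |auto].
intros r; rewrite <- φ_cut; split; [intros ->; apply ψK|intros <-; now rewrite φK].
Qed.

Lemma recell_universal x y (e : M x y) :
  tensor_universal (X := X1) e -> tensor_universal (X := X2) (e : @mone X2 x y).
Proof.
intros (H1 & H2 & H3 & H4); split; [|split; [|split]]; intros z a;
  [destruct (H1 z a) as (u & t & Ho & Hi)|destruct (H2 z a) as (u & t & Ho & Hi)
  |destruct (H3 z a) as (u & t & Ho & Hi)|destruct (H4 z a) as (u & t & Ho & Hi)];
  exists u, (φ t); split; first [exact (recell_univ_out Ho) | idtac].
- exact (recell_univ_in (G1 := [e]) (G2 := nil) Hi).
- exact (recell_univ_in (G1 := [e]) (G2 := nil) Hi).
- exact (recell_univ_in (G1 := nil) (G2 := [e]) Hi).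
- exact (recell_univ_in (G1 := nil) (G2 := [e]) Hi).
Qed.

Lemma recell_strong : tensor_strong recell_data.
Proof.
constructor; simpl; intros.
- exact (eq_rect_r (@is_unit X2 x y a) (recell_unit H) (mcast_id (X := X2) _ _)).
- exact (recell_universal H).
- exact (eq_rect_r (@is_tensor X2 x y z a b c) (recell_univ_out H) (mcast_id (X := X2) _ _)).
Qed.

Definition recell : strong_morphism X1 X2 := StrongMorphism recell_morphism recell_strong.
End Recell.

Section RecellInverse.
Context {O : Type} {M : O -> O -> Type}.
Context {two1 two2 : forall x y, path M x y -> M x y -> Type}.
Context {cut1 : forall x y z w (G1 : path M x y) (G : path M y z) (a : M y z)
  (G2 : path M z w) (b : M x w), two1 G a -> two1 (G1 ++ a :: G2) b -> two1 (G1 ++ (G ++ G2)) b}.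
Context {cut2 : forall x y z w (G1 : path M x y) (G : path M y z) (a : M y z)
  (G2 : path M z w) (b : M x w), two2 G a -> two2 (G1 ++ a :: G2) b -> two2 (G1 ++ (G ++ G2)) b}.
Local Notation X1 := (MbData cut1).
Local Notation X2 := (MbData cut2).
Context {φ : forall x y (P : path M x y) (b : M x y), two1 P b -> two2 P b}.
Context {ψ : forall x y (P : path M x y) (b : M x y), two2 P b -> two1 P b}.
Context (φK : forall x y (P : path M x y) (b : M x y) (p : two1 P b), ψ (φ p) = p).
Context (ψK : forall x y (P : path M x y) (b : M x y) (p : two2 P b), φ (ψ p) = p).
Context (φ_cut : forall x y z w (G1 : path M x y) (G : path M y z) (a : M y z)
  (G2 : path M z w) (b : M x w) (t : two1 G a) (s : two1 (G1 ++ a :: G2) b),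
  φ (cut1 t s) = cut2 (φ t) (φ s)).

Lemma recell_inverse_cut x y z w (G1 : path M x y) (G : path M y z) (a : M y z)
    (G2 : path M z w) (b : M x w) (t : two2 G a) (s : two2 (G1 ++ a :: G2) b) :
  ψ (cut2 t s) = cut1 (ψ t) (ψ s).
Proof. rewrite <- (ψK t), <- (ψK s) at 1; now rewrite <- φ_cut, φK. Qed.

(** A bijection that respects cuts has an inverse that respects cuts, and both transport
every universal property. *)
Lemma recell_iso (H1 : is_regular_mb X1) (R1 : tensor_representable X1)
    (H2 : is_regular_mb X2) (R2 : tensor_representable X2) :
  is_iso (C := rMulBiCat_tens) (x := RepMb H1 R1) (y := RepMb H2 R2)
    (recell φK ψK φ_cut).
Proof.
exists (recell ψK φK recell_inverse_cut); split; apply strong_morphism_eq.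
- apply (mm_data_eq (X := X1) (Y := X1)); intros x y P b p; simpl.
  rewrite (recell_mcast (cut1 := cut2) (cut2 := cut1) ψ), φK, !mcast_mcast.
  apply (mcast_pi (X := X1)).
- apply (mm_data_eq (X := X2) (Y := X2)); intros x y P b p; simpl.
  rewrite (recell_mcast (cut1 := cut1) (cut2 := cut2) φ), ψK, !mcast_mcast.
  apply (mcast_pi (X := X2)).
Qed.
End RecellInverse.

Section IdentityOnCells.
Context {D : bicategory}.
Let HD := bicat_ax D.
Context {id' : forall x y (a : one D x y), two a a}.
Context {vc' : forall x y (a b c : one D x y), two a b -> two b c -> two a c}.
Context {e' : forall x, one D x x}.
Context {T' : forall x y z, one D x y -> one D y z -> one D x z}.
Context {T2' : forall x y z (a c : one D x y) (b d : one D y z),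
    two a c -> two b d -> two (T' a b) (T' c d)}.
Context {A' : forall x y z t (a : one D x y) (b : one D y z) (c : one D z t),
    two (T' (T' a b) c) (T' a (T' b c))}.
Context {L' : forall x y (a : one D x y), two (T' (e' x) a) a}.
Context {R' : forall x y (a : one D x y), two (T' a (e' y)) a}.
Local Notation E := (BicatData id' vc' T2' A' L' R').
Context (t : forall x y z (a : one D x y) (b : one D y z), two (a ⊗ b) (T' a b)).
Context (u : forall x, two (unit1 x) (e' x)).
(** A pseudofunctor that is the identity on cells, between two bicategory structures on
the same cells. *)
Definition same_cells_data : pf_data E D := PfData (B := E) (C := D) (pf0 := fun x => x)
  (pf1 := fun _ _ a => a) (fun _ _ _ _ p => p) t u.
Context (Hf : is_pseudofunctor same_cells_data).

Lemma same_id x y (a : one D x y) : id' a = id2 a.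
Proof. exact (pf2_id Hf (a : one E x y)). Qed.

Lemma same_vcomp x y (a b c : one D x y) (p : two a b) (q : two b c) : vc' p q = p ⋅ q.
Proof. exact (pf2_vcomp Hf (p : @two E x y a b) (q : @two E x y b c)). Qed.

Lemma same_tens x y z (a c : one D x y) (b d : one D y z) (p : two a c) (q : two b d) :
  (p ⊗₂ q) ⋅ t c d = t a b ⋅ T2' p q.
Proof. exact (pf_tens_nat Hf (p : @two E x y a c) (q : @two E y z b d)). Qed.

Lemma same_assoc x y z w (a : one D x y) (b : one D y z) (c : one D z w) :
  (t a b ⊗₂ id2 c) ⋅ t (T' a b) c ⋅ A' a b c = assoc a b c ⋅ (id2 a ⊗₂ t b c) ⋅ t a (T' b c).
Proof. exact (pf_assoc Hf (a : one E x y) (b : one E y z) (c : one E z w)). Qed.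

Definition inverse_cell {x y} {a b : one D x y} {p : two a b} (H : invertible p) : two b a :=
  proj1_sig (constructive_indefinite_description _ H).

Lemma inverse_l {x y} {a b : one D x y} {p : two a b} (H : invertible p) :
  inverse_cell H ⋅ p = id2 b.
Proof. apply (proj2_sig (constructive_indefinite_description _ H)). Qed.

Lemma inverse_r {x y} {a b : one D x y} {p : two a b} (H : invertible p) :
  p ⋅ inverse_cell H = id2 a.
Proof. apply (proj2_sig (constructive_indefinite_description _ H)). Qed.

Definition tens_inverse x y z (a : one D x y) (b : one D y z) : two (T' a b) (a ⊗ b) :=
  inverse_cell (pf_tens_inv Hf (a : one E x y) (b : one E y z)).
Definition unit_inverse x : two (e' x) (unit1 x) := inverse_cell (pf_unit_inv Hf x).
Local Notation s := tens_inverse.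
Local Notation v := unit_inverse.

Lemma tens_inverse_r x y z (a : one D x y) (b : one D y z) : t a b ⋅ s a b = id2 _.
Proof. apply inverse_r. Qed.
Lemma tens_inverse_l x y z (a : one D x y) (b : one D y z) : s a b ⋅ t a b = id2 _.
Proof. apply inverse_l. Qed.
Lemma unit_inverse_r x : u x ⋅ v x = id2 _.
Proof. apply inverse_r. Qed.
Lemma unit_inverse_l x : v x ⋅ u x = id2 _.
Proof. apply inverse_l. Qed.

Lemma invertible_same_tens x y z (a : one D x y) (b : one D y z) : invertible (t a b).
Proof. exact (pf_tens_inv Hf (a : one E x y) (b : one E y z)). Qed.

Lemma same_tens_inverse x y z (a c : one D x y) (b d : one D y z) (p : two a c) (q : two b d) :
  T2' p q ⋅ s c d = s a b ⋅ (p ⊗₂ q).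
Proof.
apply (vcomp_cancel_l (invertible_same_tens a b)).
rewrite <- !(vcomp_assoc HD), <- same_tens, tens_inverse_r, (vcomp_id_l HD), (vcomp_assoc HD), tens_inverse_r.
apply (vcomp_id_r HD).
Qed.

Definition same_cells_inverse : pf_data D E := PfData (B := D) (C := E) (pf0 := fun x => x)
  (pf1 := fun _ _ a => a) (fun _ _ _ _ p => p) tens_inverse unit_inverse.

(** Each axiom is the corresponding axiom of the given pseudofunctor, conjugated by the
structure 2-cells. *)
Lemma same_cells_inverse_pseudofunctor : is_pseudofunctor same_cells_inverse.
Proof.
constructor; simpl; intros.
- symmetry; apply same_id.
- symmetry; apply same_vcomp.
- rewrite !same_vcomp; apply same_tens_inverse.
- exists (t a b : @two E _ _ _ _); simpl.
  rewrite !same_vcomp, !same_id, tens_inverse_l, tens_inverse_r; auto.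
- exists (u x : @two E _ _ _ _); simpl.
  rewrite !same_vcomp, !same_id, unit_inverse_r, unit_inverse_l; auto.
- rewrite !same_vcomp, !same_id.
  apply (vcomp_cancel_l (p := (t a b ⊗₂ id2 c) ⋅ t (T' a b) c)).
  { apply invertible_comp; [|apply invertible_same_tens].
    apply invertible_tens2; [apply invertible_same_tens|apply invertible_id]. }
  symmetry; rewrite <- !(vcomp_assoc HD), same_assoc.
  rewrite !(vcomp_assoc HD), same_tens_inverse.
  rewrite <- (vcomp_assoc HD (t a (T' b c))), tens_inverse_r, (vcomp_id_l HD).
  rewrite <- (tens2_id_vcomp HD), tens_inverse_r, (tens2_id HD), (vcomp_id_r HD).
  rewrite <- (vcomp_assoc HD (t (T' a b) c)), <- same_tens.
  rewrite (vcomp_assoc HD (s a b ⊗₂ id2 c)), <- (vcomp_assoc HD (t (a ⊗ b) c)), tens_inverse_r, (vcomp_id_l HD).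
  rewrite <- (vcomp_assoc HD), <- (tens2_vcomp_id HD), tens_inverse_r, (tens2_id HD).
  now rewrite (vcomp_id_l HD).
- rewrite !same_vcomp, !same_id.
  pose proof (pf_lunit Hf (a : one E x y)) as H; simpl in H; rewrite <- H.
  rewrite same_tens_inverse, (vcomp_assoc HD), <- !(vcomp_assoc HD (v x ⊗₂ _)).
  rewrite <- (tens2_vcomp_id HD), unit_inverse_l, (tens2_id HD), (vcomp_id_l HD).
  now rewrite <- (vcomp_assoc HD), tens_inverse_l, (vcomp_id_l HD).
- rewrite !same_vcomp, !same_id.
  pose proof (pf_runit Hf (a : one E x y)) as H; simpl in H; rewrite <- H.
  rewrite same_tens_inverse, (vcomp_assoc HD), <- !(vcomp_assoc HD (_ ⊗₂ v y)).
  rewrite <- (tens2_id_vcomp HD), unit_inverse_l, (tens2_id HD), (vcomp_id_l HD).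
  now rewrite <- (vcomp_assoc HD), tens_inverse_l, (vcomp_id_l HD).
Qed.

Lemma same_cells_comp_l : pf_comp_data same_cells_data same_cells_inverse = pf_id_data E.
Proof.
apply pf_data_eq; simpl; intros; rewrite same_vcomp, same_id; [apply tens_inverse_l|apply unit_inverse_l].
Qed.

Lemma same_cells_comp_r : pf_comp_data same_cells_inverse same_cells_data = pf_id_data D.
Proof. apply pf_data_eq; simpl; intros; [apply tens_inverse_r|apply unit_inverse_r]. Qed.

Lemma same_cells_iso (HE : is_bicategory E) :
  is_iso (C := BiCat) (x := Bicategory HE) (y := D) (Pseudofunctor Hf).
Proof.
exists (Pseudofunctor same_cells_inverse_pseudofunctor).
split; apply pseudofunctor_eq; [apply same_cells_comp_l|apply same_cells_comp_r].
Qed.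
End IdentityOnCells.

(** * The natural isomorphism from the integral of [G X] to [X] *)

Section Iterated.
Context {X : rep_mb} (c : coherent_choice X).
Local Notation "a ⊠ b" := (ch_tens c a b) (at level 40, left associativity).
Local Notation τ a b := (pack (ch_t c a b)).
Local Notation GX := (G_data c).

(** The universal cell from a sequence to its left bracketing. *)
Fixpoint iter_tensor {x y z} (w : @mone X x y) (G : mpath X y z) :
    mtwo (w :: G) (lb (B := GX) w G) :=
  match G in path _ y z return forall w : @mone X x y, mtwo (w :: G) (lb (B := GX) w G) with
  | nil => fun w => mid w
  | d :: G => fun w => cut nil G (ch_t c w d) (iter_tensor (w ⊠ d) G)
  end w.
Local Notation T w G := (pack (iter_tensor w G)).

Lemma iter_tensor_cons {x y z t} (w : @mone X x y) (d : @mone X y z) (G : mpath X z t) :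
  T w (d :: G) = Cut nil G (τ w d) (T (w ⊠ d) G).
Proof. exact (pack_cut (G1 := nil) (G := [w; d]) (ch_t c w d) (iter_tensor (w ⊠ d) G)). Qed.

Lemma iter_tensor_out {x y z} (w : @mone X x y) (G : mpath X y z) : universal_out (T w G).
Proof.
revert x w; induction G as [|? ? ? d G IH]; intros x' w.
- apply universal_out_intro.
  + intros ? ? G1 G2 b s Is; exists s; split; [exact Is|now apply Cut_mid].
  + intros ? ? G1 G2 b s s' Is Is'; simpl; now rewrite !Cut_mid by auto.
- rewrite iter_tensor_cons; apply universal_out_Cut; [reflexivity|apply tensor_out|apply IH].
Qed.
Local Opaque iter_tensor.
Local Notation "p ⊙ q" := (Cut nil nil p q) (at level 45, left associativity).

Lemma iter_tensor_lb_map {x y z} {w w' : @mone X x y} (p : mtwo [w] w') (G : mpath X y z) :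
  T w G ⊙ pack (lb_map (B := GX) (p : two (b := GX) w w') G : mtwo [_] _)
  = Cut nil G (pack p) (T w' G).
Proof.
revert w w' p; induction G as [|? ? ? d G IH]; intros w w' p.
- change (pack (mid w) ⊙ pack p = pack p ⊙ pack (mid w')).
  now rewrite mid_Cut, Cut_mid.
- rewrite !iter_tensor_cons; simpl lb_map.
  erewrite Cut_nest_at with (D1 := nil) by solve_inputs; cbn [app].
  etransitivity; [exact (f_equal (Cut nil G (τ w d)) (IH _ _ (G_tens2 c p (mid d))))|].
  rewrite tens2_spec_in by solve_inputs; cbn [app].
  now rewrite Cut_mid by solve_inputs.
Qed.

Lemma iter_tensor_lb_app {x y z t} (w : @mone X x y) (G : mpath X y z) (H : mpath X z t) :
  T w (G ++ H) ⊙ pack (lb_app (B := GX) w G H : mtwo [_] _)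
  = Cut nil H (T w G) (T (lb (B := GX) w G) H).
Proof.
revert x w; induction G as [|? ? ? d G IH]; intros x' w.
- change (T w H ⊙ pack (mid (lb (B := GX) w H)) = Cut nil H (pack (mid w)) (T w H)).
  now rewrite mid_Cut, Cut_mid.
- simpl app; rewrite !iter_tensor_cons; simpl lb_app.
  erewrite Cut_nest_at with (D1 := nil) by solve_inputs; cbn [app].
  etransitivity; [exact (f_equal (Cut nil (G ++ H) (τ w d)) (IH H _ (w ⊠ d)))|].
  now erewrite Cut_nest_at with (D1 := nil) by solve_inputs.
Qed.

(** The associator [lb_tens] is characterized like the associators of [G X]: it compares
bracketing [G] onto [w ⊠ a] with bracketing it onto [a] first. *)
Lemma iter_tensor_lb_tens {x y z t} (w : @mone X x y) (a : @mone X y z) (G : mpath X z t) :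
  T w (a :: G) ⊙ pack (lb_tens (B := GX) w a G : mtwo [_] _)
  = Cut [w] nil (T a G) (τ w (lb (B := GX) a G)).
Proof.
revert a; induction G as [|? ? ? d G IH]; intros a.
- rewrite iter_tensor_cons.
  change (Cut nil nil (τ w a) (pack (mid (w ⊠ a))) ⊙ pack (mid (w ⊠ a))
    = Cut [w] nil (pack (mid a)) (τ w a)).
  now rewrite !mid_Cut, Cut_mid.
- rewrite !iter_tensor_cons.
  change (Cut nil (d :: G) (τ w a) (Cut nil G (τ (w ⊠ a) d) (T (w ⊠ a ⊠ d) G))
    ⊙ pack (cut nil nil (lb_map (B := GX) (G_assoc c w a d : two (b := GX) _ _) G : mtwo [_] _)
              (lb_tens (B := GX) w (a ⊠ d) G : mtwo [_] _))
    = Cut [w] nil (Cut nil G (τ a d) (T (a ⊠ d) G)) (τ w (lb (B := GX) (a ⊠ d) G))).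
  push_pack.
  erewrite Cut_nest_at with (D1 := nil) by solve_inputs; cbn [app].
  erewrite Cut_nest_at with (D1 := nil) by solve_inputs; cbn [app].
  rewrite <- Cut_vertical, iter_tensor_lb_map by solve_inputs.
  erewrite Cut_nest_at with (D1 := nil) by solve_inputs; cbn [app].
  rewrite assoc_spec_in by solve_inputs; cbn [app].
  erewrite <- (Cut_nest_at (G1 := nil) (G2 := nil) (D1 := nil) (D2 := G) (τ w (a ⊠ d))) by solve_inputs.
  rewrite <- iter_tensor_cons.
  etransitivity; [exact (f_equal (Cut [w] G (τ a d)) (IH (a ⊠ d)))|].
  now erewrite Cut_nest_at with (D1 := nil) by solve_inputs.
Qed.

(** A 2-cell of the integral of [G X] has a single input, the left bracketing; the
universal cell replaces it by the sequence itself. *)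
Definition unfold_two {x y} {P : mpath X x y} {b : @mone X x y} :
    int_two (B := GX) P b -> mtwo P b :=
  match P in path _ x y return forall b : @mone X x y, int_two (B := GX) P b -> mtwo P b with
  | nil => fun _ p => match p with end
  | a :: G => fun b p => post (iter_tensor a G) (p : mtwo [lb (B := GX) a G] b)
  end b.

Lemma pack_post {x y} {P : mpath X x y} {a b : @mone X x y} (q : mtwo P a) (p : mtwo [a] b) :
  pack (post q p) = pack q ⊙ pack p.
Proof.
unfold post; rewrite pack_mcast.
exact (pack_cut (G1 := nil) (G2 := nil) q p).
Qed.

Lemma pack_unfold {x y z} {a : @mone X x y} {G : mpath X y z} {b : @mone X x z}
    (p : mtwo [lb (B := GX) a G] b) :
  pack (unfold_two (P := a :: G) p) = T a G ⊙ pack p.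
Proof. apply pack_post. Qed.

Lemma unfold_insert {x y z t} (w : @mone X x y) {P : mpath X y z} {a : @mone X y z}
    (p : int_two (B := GX) P a) (G2 : mpath X z t) :
  T w (P ++ G2) ⊙ pack (int_insert (B := GX) w p G2 : mtwo [_] _)
  = Cut [w] G2 (pack (unfold_two p)) (T w (a :: G2)).
Proof.
destruct P as [|x' y' z' d G]; [destruct p|].
rewrite pack_unfold; simpl app.
change (T w (d :: (G ++ G2))
    ⊙ pack (cut nil nil (lb_app (B := GX) (w ⊠ d) G G2 : mtwo [_] _)
        (lb_map (B := GX) (cut nil nil (lb_tens (B := GX) w d G : mtwo [_] _)
           (G_tens2 c (mid w) p) : two (b := GX) _ _) G2 : mtwo [_] _))
    = Cut [w] G2 (T d G ⊙ pack p) (T w (a :: G2))).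
push_pack.
rewrite !iter_tensor_cons.
erewrite Cut_nest_at with (D1 := nil) by solve_inputs; cbn [app].
rewrite <- Cut_vertical, iter_tensor_lb_app by solve_inputs.
erewrite Cut_nest_at with (D1 := nil) by solve_inputs; cbn [app].
rewrite iter_tensor_lb_map; push_pack.
erewrite (Cut_nest_at (D1 := nil) (D2 := nil)) by solve_inputs; cbn [app].
erewrite <- (Cut_nest_at (D1 := nil) (D2 := nil) (T (w ⊠ d) G)) by solve_inputs.
erewrite <- (Cut_nest_at (D1 := nil) (D2 := G) (τ w d)) by solve_inputs.
erewrite <- (Cut_nest_at (G1 := nil) (G2 := nil) (D1 := nil) (D2 := G) (τ w d)) by solve_inputs.
rewrite <- iter_tensor_cons.
etransitivity; [exact (f_equal (fun m => Cut nil G2 m _) (iter_tensor_lb_tens w d G))|].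
erewrite (Cut_nest_at (D1 := [w]) (D2 := nil)) by solve_inputs; cbn [app].
change (Cut [w] G2 (T d G) (Cut nil G2 (τ w (lb (B := GX) d G))
    (Cut nil G2 (pack (G_tens2 c (mid w) p)) (T (w ⊠ a) G2)))
  = Cut [w] G2 (T d G ⊙ pack p) (Cut nil G2 (τ w a) (T (w ⊠ a) G2))).
rewrite tens2_spec_in, Cut_mid by solve_inputs; cbn [app].
now erewrite (Cut_nest_at (D1 := nil) (D2 := nil)) by solve_inputs.
Qed.

Lemma unfold_whisker {x y z t u} (w : @mone X x y) (G1 : mpath X y z) {P : mpath X z t}
    {a : @mone X z t} (p : int_two (B := GX) P a) (G2 : mpath X t u) :
  T w (G1 ++ (P ++ G2)) ⊙ pack (int_whisker (B := GX) w G1 p G2 : mtwo [_] _)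
  = Cut (w :: G1) G2 (pack (unfold_two p)) (T w (G1 ++ a :: G2)).
Proof.
revert x w; induction G1 as [|? ? ? d G1 IH]; intros x' w; [exact (unfold_insert w p G2)|].
simpl app; rewrite !iter_tensor_cons; simpl int_whisker.
erewrite Cut_nest_at with (D1 := nil) by solve_inputs; cbn [app].
etransitivity; [exact (f_equal (Cut nil _ (τ w d)) (IH P a p _ (w ⊠ d)))|].
now erewrite <- (Cut_swap_at (G1 := nil)) by solve_inputs.
Qed.

(** The cuts of the integral re-bracket, whisker and compose.  By the preceding lemmas each
of these is absorbed by [iter_tensor]. *)
Lemma unfold_cut {x y z t} (G1 : mpath X x y) {P : mpath X y z} {a : @mone X y z}
    (G2 : mpath X z t) {b : @mone X x t} (p : int_two (B := GX) P a)
    (s : int_two (B := GX) (G1 ++ a :: G2) b) :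
  unfold_two (int_cut (B := GX) p s) = cut G1 G2 (unfold_two p) (unfold_two s).
Proof.
apply pack_inj; push_pack.
destruct G1 as [|? ? ? d G1].
- destruct P as [|? ? ? d G]; [destruct p|].
  change (pack (unfold_two (P := d :: (G ++ G2)) (cut nil nil
    (cut nil nil (lb_app (B := GX) d G G2 : mtwo [_] _)
    (lb_map (B := GX) (p : two (b := GX) _ _) G2 : mtwo [_] _)) (s : mtwo [_] _)))
  = Cut nil G2 (pack (unfold_two (P := d :: G) p)) (pack (unfold_two (P := a :: G2) s))).
  rewrite !pack_unfold; push_pack.
  rewrite Cut_vertical by solve_inputs.
  rewrite <- Cut_vertical, iter_tensor_lb_app by solve_inputs.
  erewrite Cut_nest_at with (D1 := nil) by solve_inputs; cbn [app].
  rewrite <- Cut_vertical, iter_tensor_lb_map by solve_inputs.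
  erewrite !Cut_nest_at with (D1 := nil) by solve_inputs; reflexivity.
- change (pack (unfold_two (P := d :: (G1 ++ (P ++ G2))) (cut nil nil
    (int_whisker (B := GX) d G1 p G2 : mtwo [_] _) (s : mtwo [_] _)))
  = Cut (d :: G1) G2 (pack (unfold_two p)) (pack (unfold_two (P := d :: (G1 ++ a :: G2)) s))).
  rewrite !pack_unfold; push_pack.
  rewrite <- Cut_vertical, unfold_whisker by solve_inputs.
  now erewrite Cut_nest_at with (D1 := d :: G1) by solve_inputs.
Qed.

Lemma unfold_two_bijective x y (P : mpath X x y) (b : @mone X x y) (q : mtwo P b) :
  exists! p : int_two (B := GX) P b, unfold_two p = q.
Proof.
destruct P as [|? ? ? d G]; [destruct (mregular (rep_mb_regular X) q)|].
destruct (@Cut_univ_out_ex X _ _ _ _ nil _ nil _ (T d G) (pack q)) as [r [Ir Hr]].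
- apply iter_tensor_out.
- solve_inputs.
- destruct (cell_pack Ir) as [r' ->]; exists r'; split.
  + apply pack_inj; rewrite pack_unfold; exact Hr.
  + intros p Hp; apply pack_inj.
    apply (Cut_univ_out_inj (G1 := nil) (G2 := nil)) with (T d G); [apply iter_tensor_out|solve_inputs|solve_inputs|].
    transitivity (pack q); [exact Hr|]; rewrite <- Hp; apply pack_unfold.
Qed.

Definition fold_two x y (P : mpath X x y) (b : @mone X x y) (q : mtwo P b) :
    int_two (B := GX) P b := the (unfold_two_bijective q).

Lemma unfold_fold x y (P : mpath X x y) (b : @mone X x y) (q : mtwo P b) :
  unfold_two (fold_two q) = q.
Proof. apply (the_spec (unfold_two_bijective q)). Qed.

Lemma fold_unfold x y (P : mpath X x y) (b : @mone X x y) (p : int_two (B := GX) P b) :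
  fold_two (unfold_two p) = p.
Proof.
destruct (unfold_two_bijective (unfold_two p)) as [r [_ Ur]].
transitivity r; [symmetry|]; apply Ur; auto using unfold_fold.
Qed.
End Iterated.
Arguments unfold_two {X} c {x y P b} p.

Section UnfoldNatural.
Context {X Y : rep_mb} (c : coherent_choice X) (d : coherent_choice Y).
Context (f : strong_morphism X Y).
Local Notation fp := (pmap (mm1 f)).
Local Opaque iter_tensor.

(** [int_mor_coh] with its boundary expressed in [Y]. *)
Definition G_coh {x y z} (w : @mone X x y) (G : mpath X y z) :
    @mtwo Y _ _ [lb (B := G_data d) (mm1 f _ _ w) (fp G)] (mm1 f _ _ (lb (B := G_data c) w G)) :=
  int_mor_coh (G_mor c d f) w G.

(** The coherence cells of a pseudofunctor [G f] compare the universal cells of [Y] with the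
images of those of [X]. *)
Lemma int_mor_coh_iter_tensor {x y z} (w : @mone X x y) (G : mpath X y z) :
  Cut nil nil (pack (iter_tensor d (mm1 f _ _ w) (fp G))) (pack (G_coh w G))
  = cmap f (pack (iter_tensor c w G)).
Proof.
revert x w; induction G as [|? ? ? a G IH]; intros x' w.
- change (Cut nil nil (pack (mid (mm1 f _ _ w))) (pack (mid (mm1 f _ _ w))) = cmap f (pack (mid w))).
  rewrite mid_Cut; unfold cmap; simpl; f_equal.
  symmetry; apply unit_unique, (ts_unit (mm_strong f)), mid_unit.
- simpl pmap; rewrite !iter_tensor_cons, cmap_Cut by solve_inputs; cbn [pmap].
  set (t' := ch_tens d (mm1 f _ _ w) (mm1 f _ _ a)).
  change (Cut nil nil
    (Cut nil (fp G) (pack (ch_t d (mm1 f _ _ w) (mm1 f _ _ a))) (pack (iter_tensor d t' (fp G))))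
    (pack (cut nil nil
       (lb_map (B := G_data d) (G_mor_tens c d f w a : two (b := G_data d) _ _) (fp G) : mtwo [_] _)
       (G_coh (ch_tens c w a) G)))
    = Cut nil (fp G) (cmap f (pack (ch_t c w a))) (cmap f (pack (iter_tensor c (ch_tens c w a) G)))).
  push_pack.
  erewrite Cut_nest_at with (D1 := nil) by solve_inputs; cbn [app].
  rewrite <- Cut_vertical, iter_tensor_lb_map by solve_inputs.
  erewrite Cut_nest_at with (D1 := nil) by solve_inputs; cbn [app].
  etransitivity.
  { do 2 apply f_equal; exact (IH _ (ch_tens c w a)). }
  now apply mor_tens_spec_in.
Qed.

Lemma unfold_mor {x y} {P : mpath X x y} {a : @mone X x y} (p : int_two (B := G_data c) P a) :
  pack (unfold_two d (int_mor2 (G_mor c d f) p)) = cmap f (pack (unfold_two c p)).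
Proof.
destruct P as [|? ? ? b G]; [destruct p|].
rewrite pack_unfold, cmap_Cut by solve_inputs; rewrite <- int_mor_coh_iter_tensor.
change (pack (unfold_two d (P := mm1 f _ _ b :: fp G)
  (cut nil nil (G_coh b G) (mm2 f (p : mtwo [_] _))))
  = Cut nil nil (Cut nil nil (pack (iter_tensor d (mm1 f _ _ b) (fp G)))
     (pack (G_coh b G))) (pack (mm2 f (p : mtwo [_] _)))).
rewrite pack_unfold, Cut_vertical by solve_inputs; f_equal.
exact (@pack_cut Y _ _ _ _ nil (mm1 f _ _ (lb (B := G_data c) b G)) nil _ _ (G_coh b G)
  (mm2 f (p : mtwo [_] _))).
Qed.
End UnfoldNatural.

(** [X] is taken apart because an isomorphism fixing 1-cells needs both sides to have
convertible 1-cells. *)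
Definition unfold_int (X : rep_mb) :
    forall c : coherent_choice X, strong_morphism (int_data (G_data c)) X :=
  match X return forall c : coherent_choice X, strong_morphism (int_data (G_data c)) X with
  | @RepMb (@MbData Ob M mtwo0 cut0) HX RX => fun c =>
      let X := RepMb (mdata := MbData cut0) HX RX in
      recell (cut1 := @int_cut (G_data c)) (cut2 := cut0)
        (@fold_unfold X c) (@unfold_fold X c)
        (fun _ _ _ _ G1 P a G2 b p s => @unfold_cut X c _ _ _ _ G1 P a G2 b p s)
  end.

Lemma mm2_unfold_int (X : rep_mb) (c : coherent_choice X) :
  mmdata (unfold_int c) = MmData (X := int_data (G_data c)) (Y := X) (mm0 := fun x => x) (mm1 := fun _ _ a => a)
    (fun _ _ P _ p => mcast (X := X) (pmap_id P) (unfold_two c p)).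
Proof. now destruct X as [[O M mtwo0 cut0] HX RX]. Qed.

Lemma unfold_int_iso (X : rep_mb) (c : coherent_choice X)
    (H : is_regular_mb (int_data (G_data c))) (R : tensor_representable (int_data (G_data c))) :
  is_iso (C := rMulBiCat_tens) (x := RepMb H R) (y := X) (unfold_int c).
Proof.
destruct X as [[O M mtwo0 cut0] HX RX].
exact (recell_iso (cut1 := @int_cut (G_data c)) (cut2 := cut0) _ _ _ H R HX RX).
Qed.

Lemma unfold_natural (X Y : rep_mb) (c : coherent_choice X) (d : coherent_choice Y)
    (f : strong_morphism X Y) (g : strong_morphism (int_data (G_data c)) (int_data (G_data d))) :
  mmdata g = int_mor (G_mor c d f) -> mm_comp g (unfold_int d) = mm_comp (unfold_int c) f.
Proof.
intros Hg; apply strong_morphism_eq.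
change (mm_comp_data g (unfold_int d) = mm_comp_data (unfold_int c) f).
rewrite Hg, !mm2_unfold_int.
apply (mm_data_eq (X := int_data (G_data c)) (Y := Y)); intros x y P b p; simpl.
apply (pack_inj (X := Y)).
etransitivity; [apply pack_mcast|]; etransitivity; [apply pack_mcast|].
symmetry; etransitivity; [apply pack_mcast|].
rewrite mm2_mcast.
etransitivity; [apply pack_mcast|]; symmetry; exact (@unfold_mor X Y c d f _ _ _ _ p).
Qed.

(** * The natural isomorphism from [G] of the integral of [B] to [B] *)

Definition int_rep_mb (B : bicategory) : rep_mb :=
  RepMb (int_regular int_functorial B) (int_rep int_functorial B).

Section Counit.
Context {B : bicategory}.
Let HB := bicat_ax B.
Local Notation X := (int_rep_mb B).
Context (c : coherent_choice X).
Local Notation "a ⊠ b" := (ch_tens c a b) (at level 40, left associativity).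
Local Notation GB := (G_data c).
Local Notation e x := (ch_unit c x : one B x x).
Local Notation t a b := (ch_t c a b : two (b := B) (a ⊗ b) (a ⊠ b)).
Local Notation l a := (ch_l c a : two (b := B) (e _ ⊗ a) a).
Local Notation r a := (ch_r c a : two (b := B) (a ⊗ e _) a).

(** This and the next lemmas read the structure cells of [G] in terms of [B], by computing
the cuts that define them. *)
Lemma int_mid {x y} (a : one B x y) : mid (X := X) a = id2 a.
Proof. symmetry; apply (unit_unique (X := X)), int_id_unit. Qed.

Lemma int_vertical {x y} {a b k : one B x y} (p : two a b) (q : two b k) :
  cut (m := X) nil nil (p : mtwo (m := X) [a] b) (q : mtwo (m := X) [b] k) = p ⋅ q.
Proof. simpl; now rewrite (vcomp_id_l HB). Qed.

Lemma int_tens2 {x y z} {a a' : one B x y} {b b' : one B y z} (p : two a a') (q : two b b') :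
  t a b ⋅ (G_tens2 c (p : mtwo (m := X) [a] a') (q : mtwo (m := X) [b] b')
           : two (b := B) (a ⊠ b) (a' ⊠ b'))
  = (p ⊗₂ q) ⋅ t a' b'.
Proof.
pose proof (the_spec (ch_t_tensor c a b _ _ nil nil _
  (cut (m := X) [a] nil (q : mtwo (m := X) [b] b')
    (cut (m := X) nil [b'] (p : mtwo (m := X) [a] a') (ch_t c a' b'))))) as H.
change (the _) with (G_tens2 c (p : mtwo (m := X) [a] a') (q : mtwo (m := X) [b] b')) in H.
revert H; generalize (G_tens2 c (p : mtwo (m := X) [a] a') (q : mtwo (m := X) [b] b')).
simpl; intros h H; rewrite !(vcomp_id_l HB) in H; rewrite H.
rewrite <- (vcomp_assoc HB), <- interchange_l.
now rewrite <- (tens2_vcomp HB), (vcomp_id_l HB), (vcomp_id_r HB).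
Qed.

Lemma int_assoc {x y z w} (a : one B x y) (b : one B y z) (d : one B z w) :
  (t a b ⊗₂ id2 d) ⋅ t (a ⊠ b) d ⋅ (G_assoc c a b d : two (b := B) (a ⊠ b ⊠ d) (a ⊠ (b ⊠ d)))
  = assoc a b d ⋅ (id2 a ⊗₂ t b d) ⋅ t a (b ⊠ d).
Proof.
pose proof (the_spec (tensor_tensor_out (cut (m := X) [a] nil (ch_t c b d) (ch_t c a (b ⊠ d)))
      (ch_t_tensor c a b) (ch_t_tensor c (a ⊠ b) d))) as H.
change (the _) with (G_assoc c a b d) in H.
revert H; generalize (G_assoc c a b d); simpl; intros h H.
rewrite !(vcomp_id_l HB), !(vcomp_id_r HB) in H; exact H.
Qed.

Lemma int_lunit {x y} (a : one B x y) :
  t (e x) a ⋅ (G_lunit c a : two (b := B) (e x ⊠ a) a) = l a.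
Proof.
pose proof (the_spec (ch_t_tensor c (ch_unit c x) a _ _ nil nil _ (ch_l c a))) as H.
change (the _) with (G_lunit c a) in H.
revert H; generalize (G_lunit c a); simpl; intros h H.
rewrite !(vcomp_id_l HB) in H; exact H.
Qed.

Lemma int_runit {x y} (a : one B x y) :
  t a (e y) ⋅ (G_runit c a : two (b := B) (a ⊠ e y) a) = r a.
Proof.
pose proof (the_spec (ch_t_tensor c a (ch_unit c y) _ _ nil nil _ (ch_r c a))) as H.
change (the _) with (G_runit c a) in H.
revert H; generalize (G_runit c a); simpl; intros h H.
rewrite !(vcomp_id_l HB) in H; exact H.
Qed.

(** This and the next lemma are instances of the coherence of the choice, for a left unitor
and for an identity. *)
Lemma int_l_coh {x y} (a : one B x y) :
  assoc (e x) (unit1 x) a ⋅ (id2 (e x) ⊗₂ lunit a) ⋅ l a = (l (unit1 x) ⊗₂ id2 a) ⋅ lunit a.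
Proof.
pose proof (ch_coh_l c (lunit a : mtwo (m := X) [unit1 x; a] a)) as H.
rewrite mcast_id in H; simpl in H; rewrite !(vcomp_id_l HB), (vcomp_id_r HB) in H; exact H.
Qed.

Lemma int_m_coh {x y z} (a : one B x y) (b : one B y z) :
  assoc a (e y) b ⋅ (id2 a ⊗₂ l b) = r a ⊗₂ id2 b.
Proof.
pose proof (ch_coh_m c (G1 := nil) (G2 := nil) (id2 (a ⊗ b) : mtwo (m := X) [a; b] _)) as H.
rewrite !mcast_id in H; simpl in H; rewrite ?(vcomp_id_l HB), ?(vcomp_id_r HB) in H; exact H.
Qed.

Lemma invertible_choice_t {x y z} (a : one B x y) (b : one B y z) : invertible (t a b).
Proof. apply (univ_out_invertible (c := a) (G := [b])), (ch_t_tensor c a b). Qed.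

Lemma invertible_choice_l {x y} (a : one B x y) : invertible (l a).
Proof. apply (univ_out_invertible (c := e x) (G := [a])), (ch_l_witness c a). Qed.

Lemma tens_unit_inj {x y} {a b : one B x y} (p q : two a b) :
  p ⊗₂ id2 (unit1 y) = q ⊗₂ id2 (unit1 y) -> p = q.
Proof.
intros E; apply (vcomp_cancel_l (runit_inv HB a)).
now rewrite <- !(runit_nat HB), E.
Qed.

Lemma invertible_factor_l {x y} {a b k : one B x y} (p : two a b) (q : two b k) :
  invertible (p ⋅ q) -> invertible q -> invertible p.
Proof.
intros H [q' [H1 H2]].
replace p with (p ⋅ q ⋅ q') by (rewrite (vcomp_assoc HB), H1; apply (vcomp_id_r HB)).
apply invertible_comp; [exact H|exists q; auto].
Qed.

Lemma invertible_factor_r {x y} {a b k : one B x y} (p : two a b) (q : two b k) :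
  invertible (p ⋅ q) -> invertible p -> invertible q.
Proof.
intros H [p' [H1 H2]].
replace q with (p' ⋅ (p ⋅ q)) by (rewrite <- (vcomp_assoc HB), H2; apply (vcomp_id_l HB)).
apply invertible_comp; [exists p; auto|exact H].
Qed.

(** The right-hand side is [runit] because this is what the triangle axiom produces in
[unit_comparison_l]. *)
Lemma unit_comparison_exists x : exists u : two (unit1 x) (e x),
  (u ⊗₂ id2 (unit1 x)) ⋅ l (unit1 x) = runit (unit1 x).
Proof.
destruct (solve_vcomp_lr (runit (unit1 x)) (invertible_id _) (invertible_choice_l (unit1 x)))
  as [s [Hs _]].
destruct (equivalence_ff_r (e := unit1 x) (v := unit1 x) (iso_lunit _) (iso_lunit _) s)
  as [u [Hu _]].
exists u; now rewrite Hu, <- Hs, (vcomp_id_l HB).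
Qed.

Definition unit_comparison x : two (unit1 x) (e x) :=
  proj1_sig (constructive_indefinite_description _ (unit_comparison_exists x)).
Local Notation u := unit_comparison.

Lemma unit_comparison_spec x : (u x ⊗₂ id2 (unit1 x)) ⋅ l (unit1 x) = runit (unit1 x).
Proof. exact (proj2_sig (constructive_indefinite_description _ (unit_comparison_exists x))). Qed.

(** Compare after composing with [id2 (unit1 x) ⊗₂ lunit a]: the triangle turns this into
[runit (unit1 x)], where the comparison is defined, and the coherence of [ch_l] gives
the rest. *)
Lemma unit_comparison_l {x y} (a : one B x y) : (u x ⊗₂ id2 a) ⋅ l a = lunit a.
Proof.
apply (vcomp_cancel_l (p := assoc (unit1 x) (unit1 x) a ⋅ (id2 (unit1 x) ⊗₂ lunit a))).
{ apply invertible_comp; [apply (assoc_inv HB)|].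
  apply invertible_tens2; [apply invertible_id|apply (lunit_inv HB)]. }
rewrite !(vcomp_assoc HB), <- (vcomp_assoc HB (id2 _ ⊗₂ lunit a) (_ ⊗₂ id2 a)), <- interchange_l.
rewrite <- !(vcomp_assoc HB), <- (tens2_id HB), <- (assoc_nat HB), (triangle HB).
rewrite (vcomp_assoc HB (_ ⊗₂ id2 a)), (vcomp_assoc HB (_ ⊗₂ id2 a)), int_l_coh.
now rewrite <- (vcomp_assoc HB), <- (tens2_vcomp_id HB), unit_comparison_spec.
Qed.

Lemma unit_comparison_r {x y} (a : one B x y) : (id2 a ⊗₂ u y) ⋅ r a = runit a.
Proof.
apply tens_unit_inj; rewrite (tens2_vcomp_id HB), <- int_m_coh, <- (triangle HB).
rewrite <- (vcomp_assoc HB), (assoc_nat HB), (vcomp_assoc HB), <- (tens2_id_vcomp HB).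
now rewrite unit_comparison_l.
Qed.

Lemma invertible_unit_comparison x : invertible (u x).
Proof.
apply (invertible_factor_r (p := runit (unit1 x))); [|apply (runit_inv HB)].
rewrite <- (runit_nat HB); apply invertible_comp; [|apply (runit_inv HB)].
apply (invertible_factor_l (q := l (unit1 x))); [|apply invertible_choice_l].
rewrite unit_comparison_spec; apply (runit_inv HB).
Qed.

Definition counit_data : pf_data GB B :=
  PfData (B := GB) (C := B) (pf0 := fun x => x) (pf1 := fun _ _ a => a)
    (fun _ _ a b p => (p : two (b := B) a b))
    (fun (x y z : ob B) (a : one B x y) (b : one B y z) => t a b)
    unit_comparison.

Lemma counit_pseudofunctor : is_pseudofunctor counit_data.
Proof.
constructor; simpl pf0; simpl pf1; simpl pf2; simpl pf_tens; simpl pf_unit.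
- intros x y a; apply int_mid.
- intros x y a b k p q; apply int_vertical.
- intros x y z a k b d p q; symmetry; apply int_tens2.
- intros x y z a b; apply invertible_choice_t.
- apply invertible_unit_comparison.
- intros x y z w a b d; apply int_assoc.
- intros x y a.
  etransitivity; [|apply unit_comparison_l].
  rewrite <- int_lunit; apply (vcomp_assoc HB).
- intros x y a.
  etransitivity; [|apply unit_comparison_r].
  rewrite <- int_runit; apply (vcomp_assoc HB).
Qed.
End Counit.

(** * Naturality and the mutually inverse functors *)

Lemma counit_iso (B : bicategory) (c : coherent_choice (int_rep_mb B))
    (H : is_bicategory (G_data c)) :
  is_iso (C := BiCat) (x := Bicategory H) (y := B) (Pseudofunctor (counit_pseudofunctor c)).
Proof.
exact (same_cells_iso (D := B) (counit_pseudofunctor c) H).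
Qed.

Section CounitNatural.
Context {B C : bicategory} (f : pseudofunctor B C).
Context (c : coherent_choice (int_rep_mb B)) (d : coherent_choice (int_rep_mb C)).
Context (g : strong_morphism (int_rep_mb B) (int_rep_mb C)).
Context (Hg : mmdata g = int_mor f).
Let HB := bicat_ax B.
Let HC := bicat_ax C.
Let Hf := pf_ax f.

(** On units, both sides are determined by composition with the image of [ch_l] at the unit,
since tensoring with the image of the unit is faithful. *)
Lemma counit_natural :
  pf_comp_data (G_mor c d g) (counit_data d) = pf_comp_data (counit_data c) f.
Proof.
destruct g as [g' M S]; simpl in Hg; subst g'.
pose (h := StrongMorphism M S : strong_morphism (int_rep_mb B) (int_rep_mb C)).
apply (pf_data_ext (B := G_data c) (C := C)); simpl.
- intros x y a b p; apply (vcomp_id_l HC).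
- intros x y z a b.
  change (ch_t d (pf1 f a) (pf1 f b) ⋅ (G_mor_tens c d h a b : two (b := C) (ch_tens d _ _) _)
    = pf_tens f a b ⋅ pf2 f (ch_t c a b)).
  pose proof (the_spec (ch_t_tensor d (pf1 f a) (pf1 f b) _ _ nil nil _ (mm2 h (ch_t c a b)))) as H.
  change (the _) with (G_mor_tens c d h a b) in H.
  revert H; generalize (G_mor_tens c d h a b); simpl; intros k H.
  rewrite !(vcomp_id_l HC), (vcomp_id_r HC) in H; exact H.
- intros x.
  change (unit_comparison d (pf0 f x) ⋅ (G_mor_unit c d h x : two (b := C) (ch_unit d _) _)
    = pf_unit f x ⋅ pf2 f (unit_comparison c x)).
  pose proof (the_spec (@mm2_l_unit_univ (int_rep_mb B) (int_rep_mb C) c h x [ch_unit d (pf0 f x)] I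
      (ch_l d (pf1 f (ch_unit c x))))) as H.
  change (the _) with (G_mor_unit c d h x) in H.
  revert H; generalize (G_mor_unit c d h x); simpl; intros k H.
  rewrite !(vcomp_id_l HC), (vcomp_id_r HC) in H.
  set (K := unit_comparison d (pf0 f x) ⋅ k).
  set (K' := pf_unit f x ⋅ pf2 f (unit_comparison c x)).
  assert (I : isomorphic (pf1 f (ch_unit c x)) (unit1 (pf0 f x))).
  { apply iso_sym; exists K'; apply invertible_comp; [apply (pf_unit_inv Hf)|].
    apply (invertible_pf2 Hf), invertible_unit_comparison. }
  assert (E : K ⊗₂ id2 (pf1 f (ch_unit c x)) = K' ⊗₂ id2 (pf1 f (ch_unit c x))).
  { apply (vcomp_cancel_r (q := pf_tens f (ch_unit c x) (ch_unit c x)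
      ⋅ pf2 f (ch_l c (ch_unit c x) : two (b := B) (ch_unit c x ⊗ ch_unit c x) (ch_unit c x)))).
    { apply invertible_comp; [apply (pf_tens_inv Hf)|].
      apply (invertible_pf2 Hf), invertible_choice_l. }
    transitivity (lunit (pf1 f (ch_unit c x))).
    - unfold K; rewrite (tens2_vcomp_id HC), (vcomp_assoc HC).
      etransitivity; [exact (f_equal (vcomp _) H)|apply unit_comparison_l].
    - unfold K'; rewrite (tens2_vcomp_id HC), (vcomp_assoc HC).
      rewrite <- (vcomp_assoc HC (pf2 f _ ⊗₂ _)), (pf_tens_nat_l Hf), (vcomp_assoc HC).
      rewrite <- (pf2_vcomp Hf), unit_comparison_l, <- (vcomp_assoc HC).
      symmetry; apply (pf_lunit Hf). }
  destruct (equivalence_ff_r (e := pf1 f (ch_unit c x)) (v := unit1 _)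
    (iso_trans (iso_runit _) I) (iso_trans (iso_lunit _) I) (K' ⊗₂ id2 (pf1 f (ch_unit c x)))) as [q [_ Uq]].
  transitivity q; [symmetry|]; apply Uq; [exact E|reflexivity].
Qed.
End CounitNatural.

Theorem corollary4p10 :
  exists Int : int_is_functor,
  (forall X : rep_mb, inhabited (coherent_choice X)) /\
  forall c : (forall X : rep_mb, coherent_choice X),
  exists (Gc : G_is_functor c)
    (IntMon : forall B : obj BiCat,
       single_0cell_bicat B -> single_0cell_mb (int_functor Int B))
    (GcMon : forall X : obj rMulBiCat_tens,
       single_0cell_mb X -> single_0cell_bicat (G_functor Gc X)),
  let intM : functor MonCat rMulCat_tens :=
    restrict (int_functor Int) IntMon in
  let GM : functor rMulCat_tens MonCat := restrict (G_functor Gc) GcMon in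
  inverse_up_to_iso (int_functor Int) (G_functor Gc) /\
  inverse_up_to_iso intM GM.
Proof.
exists int_functorial; split; [exact coherent_choice_exists|].
intros c; exists (G_functorial c), (fun B H => H), (fun X H => H); intros intM GM.
set (I := int_functor int_functorial); set (G := G_functor (G_functorial c)).
pose (eps := (fun B : bicategory => Pseudofunctor (counit_pseudofunctor (c (int_rep_mb B))))
  : forall B : obj BiCat, hom (functor_comp I G B) (functor_id BiCat B)).
pose (eta := (fun X : rep_mb => unfold_int (c X))
  : forall X : obj rMulBiCat_tens, hom (functor_comp G I X) (functor_id rMulBiCat_tens X)).
assert (Ei : forall B, is_iso (eps B)) by (intros B; apply counit_iso).
assert (En : forall (B C : obj BiCat) (f : hom B C),
  ccomp (fhom (functor_comp I G) f) (eps C) = ccomp (eps B) (fhom (functor_id BiCat) f)).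
{ intros B C f; apply pseudofunctor_eq; now apply counit_natural. }
assert (Ui : forall X, is_iso (eta X)) by (intros X; apply unfold_int_iso).
assert (Un : forall (X Y : obj rMulBiCat_tens) (f : hom X Y),
  ccomp (fhom (functor_comp G I) f) (eta Y) = ccomp (eta X) (fhom (functor_id rMulBiCat_tens) f)).
{ intros X Y f; now apply unfold_natural. }
split; split.
- exists eps; split; [exact Ei|exact En].
- exists eta; split; [exact Ui|exact Un].
- exists (fun B => eps (proj1_sig B)); split; [intros B; exact (Ei _)|intros B C f; exact (En _ _ f)].
- exists (fun X => eta (proj1_sig X)); split; [intros X; exact (Ui _)|intros X Y f; exact (Un _ _ f)].
Qed.
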